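(* Let $p\in(\tfrac14,\tfrac13]$ be fixed, let $y_p$ be the area enclosed by the $p$-Koch snowflake and let $x_p$ be the area enclosed by the $p$-Koch anti-snowflake. Then for each $y\in[x_p,y_p]$ there exists a generalised $p$-Koch snowflake $\mathcal F$ such that the area of the region enclosed by $\mathcal F$ equals $y$.
   Context: Notation: $\mathbb N=\{1,2,\dots\}$, $\mathbb N_0=\mathbb N\cup\{0\}$, $p\in(\tfrac14,\tfrac13]$, $q=\sqrt{4p-1}$. $V\subset\mathbb R^2$ is the closed filled-in rhombus (closed convex hull) with vertices $P_\pm=(\pm\tfrac12,0)$ and $Q_\pm=(0,\pm\tfrac12 q)$. Maps: for $(a,b)\in A=\{0,1,2,3\}\times\{0,1\}$ the affine maps $\phi_{(a,b)}$ (which map $V$ into $V$) are $\phi_{(0,0)}(x,y)=\phi_{(0,1)}(x,y)=(px-\tfrac{1-p}{2},\,py)$; $\phi_{(3,0)}(x,y)=\phi_{(3,1)}(x,y)=(px+\tfrac{1-p}{2},\,py)$; $\phi_{(1,0)}(x,y)=\big(\tfrac12((1-2p)x-qy)+\tfrac{2p-1}{4},\ \tfrac12(qx+(1-2p)y)+\tfrac q4\big)$; $\phi_{(2,0)}(x,y)=\big(\tfrac12((1-2p)x+qy)+\tfrac{1-2p}{4},\ \tfrac12(-qx+(1-2p)y)+\tfrac q4\big)$; $\phi_{(1,1)}(x,y)=\big(\tfrac12((1-2p)x+qy)+\tfrac{2p-1}{4},\ \tfrac12(-qx+(1-2p)y)-\tfrac q4\big)$; $\phi_{(2,1)}(x,y)=\big(\tfrac12((1-2p)x-qy)+\tfrac{1-2p}{4},\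 \tfrac12(qx+(1-2p)y)-\tfrac q4\big)$. Generalised $p$-Koch curves: an element $\mathbf s\in\mathds S=\prod_{k=0}^\infty\{0,1\}^{4^k}$ is written $\mathbf s=((s_k(0),s_k(1),\dots,s_k(4^k-1)))_{k=0}^\infty$ with $s_k(i)\in\{0,1\}$. For $\mathbf u=(u_k)_{k\in\mathbb N}\in\{0,1,2,3\}^{\mathbb N}$ put $\omega_1(\mathbf u,\mathbf s)=(u_1,s_0(0))$ and, for $k\ge2$, $\omega_k(\mathbf u,\mathbf s)=\big(u_k,\,s_{k-1}(\sum_{j=1}^{k-1}u_j4^{k-1-j})\big)\in A$; write $\omega(\mathbf u,\mathbf s)=(\omega_k(\mathbf u,\mathbf s))_{k\in\mathbb N}$. For $\omega\in A^{\mathbb N}$, $\pi(\omega)$ denotes the unique element of $\bigcap_{k\in\mathbb N}(\phi_{\omega_1}\circ\cdots\circ\phi_{\omega_k})(V)$. The generalised $p$-Koch curve associated with $\mathbf s$ is $\mathcal C(\mathbf s)=\{\pi(\omega(\mathbf u,\mathbf s)):\mathbf u\in\{0,1,2,3\}^{\mathbb N}\}$. Its (continuous) parameterisation $\rho_{\mathbf s}:[0,1]\to\mathcal C(\mathbf s)$ is $\rho_{\mathbf s}(t)=\pi(\omega(\mathbf u,\mathbf s))$, where $\mathbf u=(u_k)_{k\in\mathbb N}\in\{0,1,2,3\}^{\mathbb N}$ is any sequence with $t=\sum_{k\in\mathbb N}u_k4^{-k}$ (the value does not depend on the chosen base 4 expansion). Generalised $p$-Koch snowflakes: let $f_1(x,y)=\big(-\tfrac12x+\tfrac{\sqrt3}{2}y+\tfrac14,\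 -\tfrac{\sqrt3}{2}x-\tfrac12y-\tfrac{\sqrt3}{4}\big)$ and $f_2(x,y)=\big(-\tfrac12x-\tfrac{\sqrt3}{2}y-\tfrac14,\ \tfrac{\sqrt3}{2}x-\tfrac12y-\tfrac{\sqrt3}{4}\big)$. For $\mathbf s,\mathbf t,\mathbf r\in\mathds S$, the corresponding generalised $p$-Koch snowflake is $\mathcal F(\mathbf s,\mathbf t,\mathbf r)=\mathcal C(\mathbf s)\cup f_1(\mathcal C(\mathbf t))\cup f_2(\mathcal C(\mathbf r))$. The $p$-Koch snowflake is the case in which all entries of $\mathbf s,\mathbf t,\mathbf r$ are $0$; the $p$-Koch anti-snowflake is the case in which all entries are $1$. The parameterisation $\gamma:[0,1]\to\mathcal F(\mathbf s,\mathbf t,\mathbf r)$, a closed path traversing the snowflake counter-clockwise, is $\gamma(t)=\rho_{\mathbf s}(1-3t)$ for $t\in[0,\tfrac13)$, $\gamma(t)=f_2(\rho_{\mathbf r}(2-3t))$ for $t\in[\tfrac13,\tfrac23)$, and $\gamma(t)=f_1(\rho_{\mathbf t}(3-3t))$ for $t\in[\tfrac23,1]$. Enclosed area: the region enclosed by $\mathcal F(\mathbf s,\mathbf t,\mathbf r)$ is the union of those bounded connected components of $\mathbb R^2\setminus\mathcal F(\mathbf s,\mathbf t,\mathbf r)$ whose points have winding number $1$ with respect to $\gamma$; the area enclosed is the two-dimensional Lebesgue measure of this region. *)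

(* Defs.v *)
From HB Require Import structures.
From mathcomp Require Import all_boot all_order all_algebra.
From mathcomp Require Import all_classical all_reals all_analysis.

Set Implicit Arguments.
Unset Strict Implicit.
Unset Printing Implicit Defensive.

Import Order.TTheory GRing.Theory Num.Theory.
Import numFieldNormedType.Exports.

Local Open Scope classical_set_scope.
Local Open Scope ring_scope.

(* The alphabet {0,1,2,3} x {0,1}; [false] stands for 0 and [true] for 1. *)
Definition letter : Type := ('I_4 * bool)%type.

Section Koch.
Context {R : realType}.
Implicit Types (p t : R) (z : R * R).

Definition koch_q p : R := Num.sqrt (4 * p - 1).

(* [smallest C G] is the intersection of the sets in [C] that contain [G],
   so this is the closed convex hull of the four vertices. *)
Definition rhombus p : set (R * R) :=
  smallest [set C : set (R * R) | closed C /\ convex_set C]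
    [set (2^-1, 0); (- 2^-1, 0); (0, koch_q p / 2); (0, - (koch_q p / 2))].

Definition phi p (a : letter) z : R * R :=
  let q := koch_q p in
  let: (x, y) := z in
  match val a.1, a.2 with
  | 0%N, _ => (p * x - (1 - p) / 2, p * y)
  | 1%N, false => (2^-1 * ((1 - 2 * p) * x - q * y) + (2 * p - 1) / 4,
                   2^-1 * (q * x + (1 - 2 * p) * y) + q / 4)
  | 2%N, false => (2^-1 * ((1 - 2 * p) * x + q * y) + (1 - 2 * p) / 4,
                   2^-1 * (- q * x + (1 - 2 * p) * y) + q / 4)
  | 1%N, true  => (2^-1 * ((1 - 2 * p) * x + q * y) + (2 * p - 1) / 4,
                   2^-1 * (- q * x + (1 - 2 * p) * y) - q / 4)
  | 2%N, true  => (2^-1 * ((1 - 2 * p) * x - q * y) + (1 - 2 * p) / 4,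
                   2^-1 * (q * x + (1 - 2 * p) * y) - q / 4)
  | _, _ => (p * x + (1 - p) / 2, p * y)
  end.

(* Sequences indexed by {1, 2, ...} are shifted to start at 0: the [k]-th term
   below is the [(k+1)]-st term in the usual numbering. *)
Fixpoint phi_comp p (w : nat -> letter) (k : nat) : R * R -> R * R :=
  if k is k'.+1 then phi_comp p w k' \o phi p (w k') else id.

(* [get] picks the unique element of the intersection. *)
Definition coding_point p (w : nat -> letter) : R * R :=
  get (\bigcap_k (phi_comp p w k.+1 @` rhombus p)).

Definition prefix_val (u : nat -> 'I_4) (k : nat) : nat :=
  (\sum_(j < k) u j * 4 ^ (k.-1 - j))%N.

Lemma prefix_valS (u : nat -> 'I_4) (k : nat) :
  prefix_val u k.+1 = (4 * prefix_val u k + u k)%N.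
Proof.
rewrite /prefix_val big_ord_recr /= subnn expn0 muln1 big_distrr /=.
congr (_ + _)%N; apply: eq_bigr => j _.
case: k j => [[]//|k] j /=.
by rewrite mulnCA -expnS -subSn // -ltnS ltn_ord.
Qed.

Lemma prefix_val_lt (u : nat -> 'I_4) (k : nat) : (prefix_val u k < 4 ^ k)%N.
Proof.
elim: k => [|k IH]; first by rewrite /prefix_val big_ord0.
rewrite prefix_valS expnS (@leq_trans (4 * (prefix_val u k).+1)%N) //.
  by rewrite mulnS addnC ltn_add2r.
by rewrite leq_mul2l.
Qed.

Definition signs : Type := forall k : nat, 'I_(4 ^ k) -> bool.

Definition omega (u : nat -> 'I_4) (s : signs) (k : nat) : letter :=
  (u k, s k (Ordinal (prefix_val_lt u k))).

Definition koch_curve p (s : signs) : set (R * R) :=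
  [set coding_point p (omega u s) | u in [set: nat -> 'I_4]].

Definition base4_expansion (u : nat -> 'I_4) t : Prop :=
  series (fun k : nat => (u k)%:R / 4 ^+ k.+1 : R) @ \oo --> t.

(* For [t] in [0,1] this set is a singleton: the base 4 expansion exists, and
   the coded point does not depend on which one is used. *)
Definition koch_path p (s : signs) t : R * R :=
  get [set coding_point p (omega u s) | u in [set u | base4_expansion u t]].

Definition side1 z : R * R :=
  let: (x, y) := z in
  let r3 : R := Num.sqrt 3 in
  (- 2^-1 * x + r3 / 2 * y + 4^-1, - (r3 / 2) * x - 2^-1 * y - r3 / 4).

Definition side2 z : R * R :=
  let: (x, y) := z in
  let r3 : R := Num.sqrt 3 in
  (- 2^-1 * x - r3 / 2 * y - 4^-1, r3 / 2 * x - 2^-1 * y - r3 / 4).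

Definition snowflake p (s t r : signs) : set (R * R) :=
  koch_curve p s `|` side1 @` koch_curve p t `|` side2 @` koch_curve p r.

Definition snowflake_path p (s t r : signs) (x : R) : R * R :=
  if x < 3^-1 then koch_path p s (1 - 3 * x)
  else if x < 2 / 3 then side2 (koch_path p r (2 - 3 * x))
  else side1 (koch_path p t (3 - 3 * x)).

(* The winding number of a closed path around a point off the path, read off a
   continuous choice [theta] of the angle in polar coordinates centred at the
   point. *)
Definition has_winding_number (g : R -> R * R) z (n : int) : Prop :=
  exists rad theta : R -> R,
    [/\ {within `[0, 1], continuous theta},
        forall x, x \in `[0, 1] ->
          0 < rad x /\
          g x = (z.1 + rad x * cos (theta x), z.2 + rad x * sin (theta x))
      & theta 1 - theta 0 = 2 * pi * n%:~R].

Definition is_component (A C : set (R * R)) : Prop :=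
  exists2 z, A z & C = connected_component A z.

Definition enclosed_region p (s t r : signs) : set (R * R) :=
  \bigcup_(C in [set C | [/\ is_component (~` snowflake p s t r) C,
                             bounded_set C
                           & forall z, C z ->
                               has_winding_number (snowflake_path p s t r) z 1]])
    C.

Definition enclosed_area p (s t r : signs) : \bar R :=
  (lebesgue_measure \x lebesgue_measure)%E (enclosed_region p s t r).

End Koch.

Definition signs0 : signs := fun _ _ => false.
Definition signs1 : signs := fun _ _ => true.

(* Main.v *)
Require Import Defs.
From mathcomp Require Import all_boot all_order all_algebra.
From mathcomp Require Import all_classical all_reals all_analysis.
From mathcomp Require Import measurable_realfun.
From mathcomp Require Import ring lra.

(** A curve C(s) runs from P- to P+ inside the rhombus V, so it cuts the open
rhombus into a part below and a part above it.  The three sides of the snowflake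
turn their lower parts to the centre, so the enclosed region is, up to a null
set, the disjoint union of a fixed set (the triangle minus the three rhombi, here
[core]) and of the parts below the three curves.  It remains to see which values
the sum of the three lower areas can take.

The area below C(s).  The curve is made of four copies, scaled by p, of the
curves C([sub s a]), placed along a tent which points up or down according to
the first sign of s.  Inside V, the part below C(s) is the part below the tent
outside the four small rhombi together with the parts below the four small
curves.  Unfolding this recursion ([area_lower], [area_lower_approx]), the area
is  half_area + bump * sum_k p^(2k) * (sum of the 4^k signs of level k),  so that
only the number of signs + on each level matters.

Intermediate values.  A snowflake has N_k = 3 * 4^k signs on level k and their
sum m_k is any integer of the parity of N_k in [-N_k, N_k].  One flip on level k
changes the sum of the p^(2k) m_k by 2 p^(2k), while the later levels can still
contribute anything up to sum_(j > k) 3 (4 p^2)^j on either side.  As 4 p^2 >= 1/4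
the later levels cover that gap, and choosing m_0, m_1, ... greedily reaches every
value between the all-minus and the all-plus sums ([greedy_expansion],
[area_lower_surj]).

The enclosed region.  Winding numbers are read off continuous angles along a path
([lift_on]).  A point off C(s) is outside all rhombi after finitely many
subdivisions ([clear], [clearP]), and a curve whose rhombus misses the point
turns around it by an angle in (-pi, pi) because V is convex; hence the total
angle is a finite sum of such angles.  Comparing the four copies with the four
edges of the tent, an induction ([clear_angle]) shows that the total angle around
a point of V is in (-2 pi, 0) below the curve and in (0, 2 pi) above it, except on
the null set of the points that some subdivision puts on the boundary or on the
long diagonal of a rhombus.  Together with the angles under which the three
sides of the triangle are seen ([triangle_sum]) this gives the total angle along
the snowflake: one turn at the points of [snow_interior] and none elsewhere
([windsP]).  Finally the total angle is locally constant off the snowflake,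
hence constant on components, and it vanishes far away, so the enclosed region is
the open set of the points with total angle 2 pi ([enclosed_regionE]), which is
[snow_interior] up to a null set ([enclosed_areaE]). *)

Set Implicit Arguments.
Unset Strict Implicit.
Unset Printing Implicit Defensive.

Import Order.TTheory GRing.Theory Num.Theory.
Import numFieldNormedType.Exports.

Local Open Scope classical_set_scope.
Local Open Scope ring_scope.

(** * Plane measure of preimages under similarities *)

(** With (a, b) read as a + b i this is z |-> m z + t: all the maps of the construction
are orientation preserving similarities, and in this form they multiply areas by
|m|^2 and add the argument of m to every angle. *)
Definition sim {R : pzRingType} (m t z : R * R) : R * R :=
  (m.1 * z.1 - m.2 * z.2 + t.1, m.2 * z.1 + m.1 * z.2 + t.2).

Lemma sim_continuous {R : realType} (m t : R * R) : continuous (sim m t).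
Proof.
move=> z.
have c1 : (fun z : R * R => m.1 * z.1 - m.2 * z.2 + t.1) @ z --> m.1 * z.1 - m.2 * z.2 + t.1.
  by apply: cvgD; [apply: cvgB; apply: cvgM|]; try exact: cvg_cst; [exact: cvg_fst|exact: cvg_snd].
have c2 : (fun z : R * R => m.2 * z.1 + m.1 * z.2 + t.2) @ z --> m.2 * z.1 + m.1 * z.2 + t.2.
  by apply: cvgD; [apply: cvgD; apply: cvgM|]; try exact: cvg_cst; [exact: cvg_fst|exact: cvg_snd].
exact: (cvg_pair c1 c2).
Qed.

Section PlaneMeasure.
Context {R : realType}.
Local Open Scope ereal_scope.
Local Notation lambda := (@lebesgue_measure R).
Local Notation lambda2 := ((@lebesgue_measure R) \x (@lebesgue_measure R)).
Local Notation mR := (measurableTypeR R).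

Lemma measurable_affine (a b : R) : measurable_fun setT (fun x : mR => a * x + b : mR)%R.
Proof. by apply: measurable_funD => //; apply: measurable_funM. Qed.

Lemma preimage_affine_oc (a b x y : R) : (a != 0)%R ->
  lambda ((fun u : R => a * u + b)%R @^-1` `]x, y]%classic) = `|a|^-1%:E * lambda `]x, y]%classic.
Proof.
move=> a0; have [xy|yx] := ltP x y; last first.
  by rewrite set_itv_ge ?preimage_set0 ?measure0 ?mule0 // bnd_simp -leNgt.
have [ap|an] : (0 < a \/ a < 0)%R by apply/orP; rewrite orbC -neq_lt.
- have -> : (fun u : R => a * u + b)%R @^-1` `]x, y]%classic = `]((x - b) / a)%R, ((y - b) / a)%R]%classic.
    apply/seteqP; split => u /=; rewrite !in_itv/= ltr_pdivrMr // ler_pdivlMr //;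
      move=> /andP[h1 h2]; apply/andP; split; lra.
  rewrite !lebesgue_measure_itv/= !lte_fin xy ltr_pM2r ?invr_gt0// ltrD2r xy.
  by rewrite -!EFinB -EFinM gtr0_norm//; congr (_%:E); field.
- have -> : (fun u : R => a * u + b)%R @^-1` `]x, y]%classic = `[((y - b) / a)%R, ((x - b) / a)%R[%classic.
    apply/seteqP; split => u /=; rewrite !in_itv/= ltr_ndivlMr // ler_ndivrMr //;
      move=> /andP[h1 h2]; apply/andP; split; lra.
  rewrite !lebesgue_measure_itv/= !lte_fin xy ltr_nM2r ?invr_lt0// ltrD2r xy.
  by rewrite -!EFinB -EFinM ltr0_norm//; congr (_%:E); field.
Qed.

(** Both sides are measures in A, up to the factor |a|; they agree on intervals, and the
Lebesgue measure is the only measure with the values it takes there. *)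
Lemma lebesgue_measure_affine (a b : R) (A : set R) : (a != 0)%R -> measurable A ->
  lambda ((fun x => a * x + b)%R @^-1` A) = `|a|^-1%:E * lambda A.
Proof.
move=> a0 mA.
have na : (0 <= `|a|)%R by [].
pose f := (fun x : mR => a * x + b : mR)%R.
have [mu muE] : exists mu : {measure set mR -> \bar R},
    forall X, mu X = `|a|%:E * lambda (f @^-1` X).
  unshelve eexists (mscale (NngNum na) (pushforward lambda f)) => //.
  exact: measurable_affine.
have h : `|a|%:E * lambda (f @^-1` A) = lambda A.
  rewrite -muE; apply/esym.
  apply: (@lebesgue_measure_unique R mu) mA => X /ocitvP[->|[[x y] _ ->]].
    by rewrite !measure0.
  by rewrite muE preimage_affine_oc // muleA -EFinM mulfV ?normr_eq0 // mul1e.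
by rewrite -h muleA -EFinM mulVf ?normr_eq0 // mul1e.
Qed.

Lemma measurable_plane_affine (a b c : R) : measurable_fun setT
  (fun z : mR * mR => a * z.1 + b * z.2 + c : mR)%R.
Proof.
by apply: measurable_funD => //; apply: measurable_funD; apply: measurable_funM.
Qed.

Lemma measurable_affine_map (a b c a' b' c' : R) (A : set (mR * mR)) : measurable A ->
  measurable ((fun z => (a * z.1 + b * z.2 + c, a' * z.1 + b' * z.2 + c'))%R @^-1` A).
Proof.
move=> mA; rewrite -[X in measurable X]setTI.
apply: measurable_fun_pair => //; exact: measurable_plane_affine.
Qed.

(** Fubini: every vertical section is an affine preimage, to which
[lebesgue_measure_affine] applies with the same factor. *)
Lemma lambda2_shear_y (a k b : R) (A : set (mR * mR)) : (a != 0)%R -> measurable A ->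
  lambda2 ((fun z => (z.1, k * z.1 + a * z.2 + b)%R) @^-1` A) = `|a|^-1%:E * lambda2 A.
Proof.
move=> a0 mA; rewrite /product_measure1 /= -ge0_integralZl //; last first.
  exact: measurable_fun_xsection.
apply: eq_integral => x _ /=.
have -> : xsection ((fun z => (z.1, k * z.1 + a * z.2 + b)%R) @^-1` A) x =
    (fun y => a * y + (k * x + b))%R @^-1` xsection A x.
  by apply/seteqP; split => y; rewrite /xsection /= !inE /=;
  rewrite (_ : a * y + (k * x + b) = k * x + a * y + b)%R //; ring.
by rewrite lebesgue_measure_affine //; apply: measurable_xsection.
Qed.

(** The mirror case of [lambda2_shear_y], integrating horizontal sections; the two orders
of integration define the same product measure. *)
Lemma lambda2_shear_x (a k b : R) (A : set (mR * mR)) : (a != 0)%R -> measurable A ->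
  lambda2 ((fun z => (a * z.1 + k * z.2 + b, z.2)%R) @^-1` A) = `|a|^-1%:E * lambda2 A.
Proof.
move=> a0 mA.
have swapE X : measurable X -> lambda2 X = (lambda \x^ lambda) X.
  by move=> mX; apply: product_measure_unique => //= *; rewrite product_measure2E.
rewrite !swapE //; last first.
  have := measurable_affine_map a k b 0 1 0 mA.
  by congr measurable; apply/seteqP; split => -[x y] /=; rewrite mul0r mul1r add0r addr0.
rewrite /product_measure2 /= -ge0_integralZl //; last first.
  exact: measurable_fun_ysection.
apply: eq_integral => y _ /=.
have -> : ysection ((fun z => (a * z.1 + k * z.2 + b, z.2)%R) @^-1` A) y =
    (fun x => a * x + (k * y + b))%R @^-1` ysection A y.
  by apply/seteqP; split => x; rewrite /ysection /= !inE /= addrA.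
by rewrite lebesgue_measure_affine //; apply: measurable_ysection.
Qed.

Lemma lambda2_graph (f : R -> R) : measurable_fun setT (f : mR -> mR) ->
  measurable [set z : mR * mR | z.2 = f z.1] /\ lambda2 [set z | z.2 = f z.1] = 0.
Proof.
move=> mf.
have mG : measurable [set z : mR * mR | z.2 = f z.1].
  have -> : [set z : mR * mR | z.2 = f z.1] =
      (fun z : mR * mR => z.2 - f z.1 : mR)%R @^-1` [set 0%R].
    apply/seteqP; split => z /=; first by move=> ->; rewrite subrr.
    by move/eqP; rewrite subr_eq0 => /eqP.
  rewrite -[X in measurable X]setTI.
  by apply: measurable_funB => //; apply: measurableT_comp.
split=> //; rewrite /product_measure1 /= integral0_eq // => x _ /=.
have -> : xsection [set z : R * R | z.2 = f z.1] x = [set f x].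
  by apply/seteqP; split => y; rewrite /xsection /= inE.
exact: lebesgue_measure_set1.
Qed.

(** The measurable sets of the plane are generated by products, not by open sets; an open
set is the union of the countably many rational boxes that it contains. *)
Lemma open_plane_measurable (A : set (R * R)) : open A -> measurable (A : set (mR * mR)).
Proof.
move=> oA.
pose box (q : (rat * rat) * (rat * rat)) : set (mR * mR) :=
  `]ratr q.1.1, ratr q.1.2[%classic `*` `]ratr q.2.1, ratr q.2.2[%classic.
have mbox q : measurable (box q) by apply: measurableX.
have -> : A = \bigcup_(q in [set q | box q `<=` A]) box q.
  apply/seteqP; split => [z Az|z [q /= qA zq]]; last exact: qA.
  have : nbhs z A by exact: open_nbhs_nbhs.
  case=> -[B1 B2] /= [/nbhs_ballP[e1 /= e10 B1e] /nbhs_ballP[e2 /= e20 B2e]] BA.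
  have /rat_in_itvoo[a1 ha1] : (z.1 - e1 < z.1)%R by rewrite ltrBlDr ltrDl.
  have /rat_in_itvoo[a2 ha2] : (z.1 < z.1 + e1)%R by rewrite ltrDl.
  have /rat_in_itvoo[b1 hb1] : (z.2 - e2 < z.2)%R by rewrite ltrBlDr ltrDl.
  have /rat_in_itvoo[b2 hb2] : (z.2 < z.2 + e2)%R by rewrite ltrDl.
  rewrite !in_itv/= in ha1 ha2 hb1 hb2.
  exists ((a1, a2), (b1, b2)); last first.
    split; rewrite /= in_itv/=.
      by move: ha1 ha2 => /andP[_ ->] /andP[->].
    by move: hb1 hb2 => /andP[_ ->] /andP[->].
  move=> -[x y] [/=]; rewrite !in_itv/= => /andP[h1 h2] /andP[h3 h4].
  move: ha1 ha2 hb1 hb2 => /andP[A1 A2] /andP[A3 A4] /andP[A5 A6] /andP[A7 A8].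
  apply: BA; split => /=.
    by apply: B1e; rewrite /ball /= ltr_distlC; apply/andP; split; lra.
  by apply: B2e; rewrite /ball /= ltr_distlC; apply/andP; split; lra.
rewrite bigcup_mkcond; apply: countable_bigcupT_measurable => // q.
by case: ifPn.
Qed.

Lemma measurable_sim (m t : R * R) (A : set (mR * mR)) : measurable A ->
  measurable (sim m t @^-1` A : set (mR * mR)).
Proof.
move=> /(measurable_affine_map m.1 (- m.2) t.1 m.2 m.1 t.2).
by congr measurable; apply/seteqP; split => -[x y] /=; rewrite /sim /= mulNr.
Qed.

(** A similarity whose linear part c + d i has c <> 0 is a composition of two shears, first
(x, y) |-> (c x - d y, y) and then (x, y) |-> (x, (d x + (c^2 + d^2) y) / c), whose
determinants c and (c^2 + d^2) / c multiply to c^2 + d^2. *)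
Lemma lambda2_sim (m t : R * R) (A : set (mR * mR)) : (m.1 != 0)%R -> measurable A ->
  lambda2 (sim m t @^-1` A) = (m.1 ^+ 2 + m.2 ^+ 2)^-1%:E * lambda2 A.
Proof.
move=> c0 mA; set c := m.1; set d := m.2.
have det_gt0 : (0 < c ^+ 2 + d ^+ 2)%R.
  by rewrite ltr_pwDl ?sqr_ge0 // lt_def sqr_ge0 expf_neq0.
have det0 := lt0r_neq0 det_gt0.
have k0 : ((c ^+ 2 + d ^+ 2) / c != 0)%R by rewrite mulf_neq0 ?invr_neq0.
pose k := (d / c)%R; pose e := (t.2 - d / c * t.1)%R.
have -> : sim m t @^-1` A = (fun z => (c * z.1 + (- d) * z.2 + t.1, z.2)%R) @^-1`
    ((fun z => (z.1, k * z.1 + (c ^+ 2 + d ^+ 2) / c * z.2 + e)%R) @^-1` A).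
  rewrite /preimage; congr mkset; apply/funext => -[x y] /=; congr A.
  by rewrite /sim /= /k /e -/c -/d mulNr; congr pair; field.
have mB : measurable ((fun z : mR * mR =>
    (z.1, k * z.1 + (c ^+ 2 + d ^+ 2) / c * z.2 + e)%R) @^-1` A).
  have := measurable_affine_map 1 0 0 k ((c ^+ 2 + d ^+ 2) / c) e mA.
  by congr measurable; apply/seteqP; split => -[x y] /=; rewrite mul0r mul1r !addr0.
rewrite lambda2_shear_x // lambda2_shear_y // muleA -EFinM; congr (_%:E * _).
rewrite -normfV -normfV -normrM; rewrite -[RHS]ger0_norm ?invr_ge0 ?(ltW det_gt0) //.
by congr `|_|%R; field; rewrite det0.
Qed.

End PlaneMeasure.

(** * Angles between plane vectors *)

Section Angles.
Context {R : realType}.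
Implicit Types (u v w z : R * R) (x y a b th : R).

Definition dot u v : R := u.1 * v.1 + u.2 * v.2.
Definition crs u v : R := u.1 * v.2 - u.2 * v.1.
Definition nrm u : R := Num.sqrt (u.1 ^+ 2 + u.2 ^+ 2).
Definition dsp z u : R * R := (u.1 - z.1, u.2 - z.2).

(** The angle th, a real number and not a class modulo 2 pi, carries the direction of u
to the direction of v. *)
Definition turns u v th : Prop := exists2 k, 0 < k &
  v = (k * (u.1 * cos th - u.2 * sin th), k * (u.1 * sin th + u.2 * cos th)).

Lemma nrm_ge0 u : 0 <= nrm u. Proof. exact: sqrtr_ge0. Qed.

Lemma nrm_sqr u : nrm u ^+ 2 = u.1 ^+ 2 + u.2 ^+ 2.
Proof. by rewrite sqr_sqrtr // addr_ge0 ?sqr_ge0. Qed.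

Lemma nrm_gt0 u : (0 < nrm u) = (u != (0, 0)).
Proof.
rewrite /nrm sqrtr_gt0 lt_def addr_ge0 ?sqr_ge0 // andbT.
by rewrite paddr_eq0 ?sqr_ge0 // !sqrf_eq0; case: u => ? ?.
Qed.

Lemma dot_crs u v : dot u v ^+ 2 + crs u v ^+ 2 = (nrm u * nrm v) ^+ 2.
Proof. by rewrite exprMn !nrm_sqr /dot /crs; ring. Qed.

Lemma cos1_small x : cos x = 1 -> `|x| < 2 * pi -> x = 0.
Proof.
move=> cx; rewrite ltr_norml => /andP[x1 x2].
have s0 : sin (x / 2) = 0.
  have h : cos x = 1 - 2 * sin (x / 2) ^+ 2.
    by rewrite {1}(splitr x) cosD -!expr2 cos2sin2; ring.
  have /eqP : sin (x / 2) ^+ 2 = 0 by move: h; rewrite cx; lra.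
  by rewrite sqrf_eq0 => /eqP.
have [xn|xp|//] := ltrgtP x 0.
- have : 0 < sin (- (x / 2)) by apply: sin_gt0_pi; apply/andP; split; lra.
  by rewrite sinN s0; lra.
- have : 0 < sin (x / 2) by apply: sin_gt0_pi; apply/andP; split; lra.
  by rewrite s0; lra.
Qed.

Lemma turns_trans u v w a b : turns u v a -> turns v w b -> turns u w (a + b).
Proof.
move=> [k k0 ->] [l l0 ->]; exists (l * k); first exact: mulr_gt0.
by rewrite /= cosD sinD; congr pair; ring.
Qed.

Lemma turns_sym u v a : turns u v a -> turns v u (- a).
Proof.
move=> [k k0 ->]; exists k^-1; rewrite ?invr_gt0 //= cosN sinN.
have k_neq0 := lt0r_neq0 k0.
case: u => x y /=; congr pair.
- by rewrite -[LHS]mulr1 -(cos2Dsin2 a); field.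
- by rewrite -[LHS]mulr1 -(cos2Dsin2 a); field.
Qed.

Lemma turns_crs u v th : turns u v th ->
  exists2 k, 0 < k & crs u v = k * nrm u ^+ 2 * sin th /\ dot u v = k * nrm u ^+ 2 * cos th.
Proof. by move=> [k k0 ->]; exists k => //; rewrite nrm_sqr /crs /dot /=; split; ring. Qed.

Lemma turns_refl_cos u th : u != (0, 0) -> turns u u th -> cos th = 1.
Proof.
move=> u0 /turns_crs[k k0 [c d]].
have s0 : sin th = 0.
  have n0 : 0 < nrm u by rewrite nrm_gt0.
  move: c; rewrite /crs mulrC subrr => /esym/eqP; rewrite !mulf_eq0.
  by rewrite (gt_eqF k0) (gt_eqF n0) => /eqP.
have dn : dot u u = nrm u ^+ 2 by rewrite nrm_sqr /dot; ring.
have n0 : 0 < nrm u ^+ 2 by rewrite exprn_gt0 // nrm_gt0.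
have cp : 0 < cos th.
  by move: (n0); rewrite -{1}dn d pmulr_rgt0 // mulr_gt0.
have /eqP := cos2Dsin2 th; rewrite s0 expr0n addr0 sqrf_eq1 => /orP[/eqP//|/eqP c1].
by move: cp; rewrite c1 oppr_gt0 ltr10.
Qed.

(** Two angles with the same effect differ by a multiple of 2 pi. *)
Lemma turns_uniq u v a b : u != (0, 0) -> turns u v a -> turns u v b ->
  `|a - b| < 2 * pi -> a = b.
Proof.
move=> u0 ta tb ab; apply/eqP; rewrite -subr_eq0; apply/eqP/cos1_small => //.
exact: turns_refl_cos u0 (turns_trans ta (turns_sym tb)).
Qed.

(** The half angle formula tan (th / 2) = sin th / (1 + cos th): this is the angle in
(-pi, pi) from u to v as soon as u and v are not opposite, and as a formula it is
visibly continuous there, with the sign of the cross product. *)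
Definition signed_angle u v : R := 2 * atan (crs u v / (nrm u * nrm v + dot u v)).

Lemma signed_angle_lt u v : - pi < signed_angle u v < pi.
Proof.
have := atan_gtNpi2 (crs u v / (nrm u * nrm v + dot u v)).
have := atan_ltpi2 (crs u v / (nrm u * nrm v + dot u v)).
by rewrite /signed_angle => *; apply/andP; split; lra.
Qed.

Lemma signed_angle_turns u v : 0 < nrm u * nrm v + dot u v -> turns u v (signed_angle u v).
Proof.
move=> h; set N := nrm u * nrm v; set D := dot u v; set X := crs u v.
have N_ge0 : 0 <= N by rewrite mulr_ge0 ?nrm_ge0.
have DX : D ^+ 2 + X ^+ 2 = N ^+ 2 by exact: dot_crs.
have N_gt0 : 0 < N.
  rewrite lt_def N_ge0 andbT; apply: contraTneq h => N0; rewrite -/N N0 add0r -leNgt.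
  have : D ^+ 2 <= 0 by have := sqr_ge0 X; move: DX; rewrite N0; lra.
  by rewrite le_eqVlt ltNge sqr_ge0 orbF sqrf_eq0 => /eqP; rewrite /D => ->.
have nu : 0 < nrm u by rewrite lt_def nrm_ge0 andbT; apply: contraTneq N_gt0; rewrite /N => ->; rewrite mul0r ltxx.
have nv : 0 < nrm v by rewrite lt_def nrm_ge0 andbT; apply: contraTneq N_gt0; rewrite /N => ->; rewrite mulr0 ltxx.
pose a := atan (X / (N + D)); have ND0 : N + D != 0 := lt0r_neq0 h; have N0 := lt0r_neq0 N_gt0.
have nu0 := lt0r_neq0 nu; have nv0 := lt0r_neq0 nv.
have tE : 1 + (X / (N + D)) ^+ 2 = 2 * N / (N + D).
  apply: (mulIf (expf_neq0 2 ND0)); rewrite mulrDl -exprMn divfK // mul1r.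
  have -> : X ^+ 2 = N ^+ 2 - D ^+ 2 by rewrite -DX; ring.
  by field.
have ca2 : cos a ^+ 2 = (N + D) / (2 * N).
  rewrite cos_atan exprVn sqr_sqrtr; last by rewrite addr_ge0 ?sqr_ge0.
  by rewrite tE invf_div.
have ca0 : cos a != 0.
  by rewrite -sqrf_eq0 ca2 mulf_neq0 // invr_neq0 // mulf_neq0 // pnatr_eq0.
have sa : sin a = X / (N + D) * cos a.
  by have := atanK (X / (N + D)); rewrite -/a /tan => <-; rewrite divfK.
have cd : cos (signed_angle u v) = D / N.
  rewrite /signed_angle -/X -/D -/N -/a mulr2n mulrDl mul1r cosD -!expr2 sin2cos2 ca2.
  by field; rewrite N0.
have sd : sin (signed_angle u v) = X / N.
  rewrite /signed_angle -/X -/D -/N -/a mulr2n mulrDl mul1r sinD sa.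
  rewrite (_ : _ + _ = 2 * (X / (N + D)) * cos a ^+ 2); last by ring.
  by rewrite ca2; field; rewrite ND0 N0.
exists (nrm v / nrm u); first exact: divr_gt0.
have nu2 : u.1 ^+ 2 + u.2 ^+ 2 = nrm u ^+ 2 by rewrite nrm_sqr.
rewrite cd sd [LHS]surjective_pairing; congr pair.
- transitivity (v.1 * (u.1 ^+ 2 + u.2 ^+ 2) / nrm u ^+ 2).
    by rewrite nu2 mulfK // expf_neq0.
  by rewrite /D /X /N /dot /crs; field; rewrite nu0 nv0.
- transitivity (v.2 * (u.1 ^+ 2 + u.2 ^+ 2) / nrm u ^+ 2).
    by rewrite nu2 mulfK // expf_neq0.
  by rewrite /D /X /N /dot /crs; field; rewrite nu0 nv0.
Qed.

Lemma signed_angle_gt0 u v : 0 < nrm u * nrm v + dot u v -> 0 < crs u v -> 0 < signed_angle u v.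
Proof.
move=> h c; rewrite /signed_angle mulr_gt0 //.
by rewrite -(@atan0 R) lt_atan // divr_gt0.
Qed.

Lemma signed_angle_lt0 u v : 0 < nrm u * nrm v + dot u v -> crs u v < 0 -> signed_angle u v < 0.
Proof.
move=> h c; rewrite /signed_angle pmulr_rlt0 //.
by rewrite -(@atan0 R) lt_atan // pmulr_llt0 // invr_gt0.
Qed.

Lemma signed_angle_eq0 u v : crs u v = 0 -> signed_angle u v = 0.
Proof. by rewrite /signed_angle => ->; rewrite mul0r atan0 mulr0. Qed.

Definition between l u v := ((1 - l) * u.1 + l * v.1, (1 - l) * u.2 + l * v.2).

(** Vectors u and v are opposite, or one vanishes, exactly when the segment between them
meets the origin. *)
Lemma not_opposite u v : (forall l, 0 <= l <= 1 -> between l u v != (0, 0)) ->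
  0 < nrm u * nrm v + dot u v.
Proof.
move=> uv.
have nu : 0 < nrm u.
  rewrite nrm_gt0; have := uv 0; rewrite lexx ler01 => /(_ isT).
  by rewrite /between subr0 !mul1r !mul0r !addr0 -surjective_pairing.
have nv : 0 < nrm v.
  rewrite nrm_gt0; have := uv 1; rewrite lexx ler01 => /(_ isT).
  by rewrite /between subrr !mul1r !mul0r !add0r -surjective_pairing.
set N := nrm u * nrm v; have N_gt0 : 0 < N by rewrite mulr_gt0.
have DX := dot_crs u v; rewrite -/N in DX.
rewrite ltNge; apply/negP => h.
have D_ge : dot u v = - N.
  have h1 : dot u v <= - N by lra.
  have h2 : dot u v ^+ 2 <= N ^+ 2 by have := sqr_ge0 (crs u v); lra.
  by apply/eqP; rewrite eq_le h1 /=; nra.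
have s0 : 0 < nrm u + nrm v by rewrite addr_gt0.
pose l := nrm u / (nrm u + nrm v).
have l01 : 0 <= l <= 1.
  by rewrite divr_ge0 ?(ltW s0) ?(ltW nu) //= ler_pdivrMr // mul1r lerDl ltW.
have := uv l l01; rewrite -nrm_gt0 /nrm sqrtr_gt0 /between /=.
have l1 : 1 - l = nrm v / (nrm u + nrm v) by rewrite /l; field; rewrite lt0r_neq0.
rewrite [X in 0 < X](_ : _ = (1 - l) ^+ 2 * (u.1 ^+ 2 + u.2 ^+ 2) + l ^+ 2 * (v.1 ^+ 2 + v.2 ^+ 2)
   + 2 * l * (1 - l) * dot u v); last by rewrite /dot; ring.
rewrite -!nrm_sqr D_ge l1 /l /N.
rewrite [X in 0 < X](_ : _ = 0) ?ltxx //; field; exact: lt0r_neq0.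
Qed.

(** Reflecting turns tents that point up into tents that point down. *)
Definition mirror u : R * R := (u.1, - u.2).

Lemma mirrorK : involutive mirror.
Proof. by move=> [a b]; rewrite /mirror /= opprK. Qed.

Lemma turns_mirror u v th : turns u v th -> turns (mirror u) (mirror v) (- th).
Proof.
move=> [k k0 ->]; exists k => //; rewrite /mirror /= cosN sinN; congr pair; ring.
Qed.

Lemma crs_mirror u v : crs (mirror u) (mirror v) = - crs u v.
Proof. by rewrite /crs /mirror /=; ring. Qed.

(** The angle from the downward direction; it jumps only across the upward half-line. *)
Definition up_angle v : R := signed_angle (0, -1) v.

Lemma up_pos v : v.1 != 0 \/ v.2 < 0 -> 0 < nrm (0, -1) * nrm v + dot (0, -1) v.
Proof.
move=> h; have -> : nrm (0, -1) = 1.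
  by apply/eqP; rewrite -(eqrXn2 (_ : 0 < 2)%N) ?nrm_ge0 // nrm_sqr /=; apply/eqP; ring.
rewrite /dot /= mul0r add0r mul1r mulN1r subr_gt0.
have [v2|v2] := ltP v.2 0; first exact: lt_le_trans v2 (nrm_ge0 _).
case: h => [v1|]; last by rewrite ltNge v2.
rewrite -(ltr_pXn2r (_ : 0 < 2)%N) ?nnegrE ?nrm_ge0 // nrm_sqr ltrDr.
by rewrite lt_def sqr_ge0 sqrf_eq0 v1.
Qed.

Lemma up_turns v : v.1 != 0 \/ v.2 < 0 -> turns (0, -1) v (up_angle v).
Proof. by move=> /up_pos/signed_angle_turns. Qed.

Lemma crs_down v : crs (0, -1) v = v.1.
Proof. by rewrite /crs /=; ring. Qed.

(** An edge that moves to the right and passes below the origin does not meet the upward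
half-line, so the angle under which it is seen is the difference of the two angles
measured from the downward direction, without any multiple of 2 pi to be added. *)
Lemma edge_up_angle u v th : u.1 < v.1 -> (u.1 <= 0 <= v.1 -> 0 < crs u v) ->
  - pi < th < pi -> turns u v th -> th = up_angle v - up_angle u.
Proof.
move=> uv c /andP[th1 th2] tuv.
have hu : u.1 != 0 \/ u.2 < 0.
  have [u1|] := eqVneq u.1 0; [right|by left].
  have : 0 < crs u v by apply: c; lra.
  by rewrite /crs u1 mul0r sub0r; nra.
have hv : v.1 != 0 \/ v.2 < 0.
  have [v1|] := eqVneq v.1 0; [right|by left].
  have : 0 < crs u v by apply: c; lra.
  by rewrite /crs v1; nra.
have tu := up_turns hu; have tv := up_turns hv.
have t2 : turns u v (up_angle v - up_angle u).
  by rewrite addrC; exact: turns_trans (turns_sym tu) tv.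
have u0 : u != (0, 0) by case: hu; apply: contraPneq => -> /=; rewrite ?eqxx // ltxx.
have /andP[a1 a2] := signed_angle_lt (0, -1) u; have /andP[b1 b2] := signed_angle_lt (0, -1) v.
rewrite -!/(up_angle _) in a1 a2 b1 b2.
apply: (turns_uniq u0 tuv t2).
have sgn w : w.1 != 0 \/ w.2 < 0 -> (w.1 < 0 -> up_angle w < 0) /\ (0 < w.1 -> 0 < up_angle w) /\
   (w.1 = 0 -> up_angle w = 0).
  move=> /up_pos hw; split; [|split] => w1.
  - by apply: signed_angle_lt0 => //; rewrite crs_down.
  - by apply: signed_angle_gt0 => //; rewrite crs_down.
  - by apply: signed_angle_eq0; rewrite crs_down.
have [su1 [su2 su3]] := sgn _ hu; have [sv1 [sv2 sv3]] := sgn _ hv.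
have [u1|u1|u1] := ltrgtP u.1 0; have [v1|v1|v1] := ltrgtP v.1 0; try lra;
  rewrite ltr_norml; apply/andP.
- by have := su1 u1; have := sv1 v1; split; lra.
- have sp : 0 < crs u v by apply: c; lra.
  have [k k0 [e _]] := turns_crs t2.
  have := su1 u1; have := sv2 v1 => h1 h2.
  have sn : 0 < sin (up_angle v - up_angle u).
    by move: sp; rewrite e pmulr_rgt0 // mulr_gt0 // exprn_gt0 // nrm_gt0.
  have : up_angle v - up_angle u < pi; last by split; lra.
  rewrite ltNge; apply/negP => hge.
  have : 0 <= sin (up_angle v - up_angle u - pi) by apply: sin_ge0_pi; apply/andP; split; lra.
  by rewrite sinB sinpi cospi; lra.
- by have := su1 u1; have := sv3 v1; split; lra.
- by have := su2 u1; have := sv2 v1; split; lra.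
- by have := su3 u1; have := sv2 v1; split; lra.
Qed.

Lemma up_angle_sign v : v.1 != 0 -> (v.1 < 0 -> - pi < up_angle v < 0) /\
  (0 < v.1 -> 0 < up_angle v < pi).
Proof.
move=> v0; have hv : 0 < nrm (0, -1) * nrm v + dot (0, -1) v by apply: up_pos; left.
have /andP[a1 a2] := signed_angle_lt (0, -1) v; rewrite -!/(up_angle _) in a1 a2.
split=> v1; rewrite ?a1 ?a2 ?andbT /=.
- by apply: signed_angle_lt0 => //; rewrite crs_down.
- by apply: signed_angle_gt0 => //; rewrite crs_down.
Qed.

(** By [edge_up_angle] the sum telescopes to the difference of the angles of the two end
points, of which the first is to the left and the last to the right of the origin. *)
Lemma graph_turns_above (u0 u1 u2 u3 u4 : R * R) t0 t1 t2 t3 :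
  u0.1 < u1.1 -> u1.1 < u2.1 -> u2.1 < u3.1 -> u3.1 < u4.1 -> u0.1 < 0 -> 0 < u4.1 ->
  (u0.1 <= 0 <= u1.1 -> 0 < crs u0 u1) -> (u1.1 <= 0 <= u2.1 -> 0 < crs u1 u2) ->
  (u2.1 <= 0 <= u3.1 -> 0 < crs u2 u3) -> (u3.1 <= 0 <= u4.1 -> 0 < crs u3 u4) ->
  - pi < t0 < pi -> - pi < t1 < pi -> - pi < t2 < pi -> - pi < t3 < pi ->
  turns u0 u1 t0 -> turns u1 u2 t1 -> turns u2 u3 t2 -> turns u3 u4 t3 ->
  0 < t0 + t1 + t2 + t3 < 2 * pi.
Proof.
move=> h01 h12 h23 h34 h0 h4 c0 c1 c2 c3 b0 b1 b2 b3 r0 r1 r2 r3.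
rewrite (edge_up_angle h01 c0 b0 r0) (edge_up_angle h12 c1 b1 r1).
rewrite (edge_up_angle h23 c2 b2 r2) (edge_up_angle h34 c3 b3 r3).
have [|n _] := @up_angle_sign u0; first by rewrite lt_eqF.
have [|_ q] := @up_angle_sign u4; first by rewrite gt_eqF.
by have /andP[? ?] := n h0; have /andP[? ?] := q h4; apply/andP; split; lra.
Qed.

Lemma graph_turns_below (u0 u1 u2 u3 u4 : R * R) t0 t1 t2 t3 :
  u0.1 < u1.1 -> u1.1 < u2.1 -> u2.1 < u3.1 -> u3.1 < u4.1 -> u0.1 < 0 -> 0 < u4.1 ->
  (u0.1 <= 0 <= u1.1 -> crs u0 u1 < 0) -> (u1.1 <= 0 <= u2.1 -> crs u1 u2 < 0) ->
  (u2.1 <= 0 <= u3.1 -> crs u2 u3 < 0) -> (u3.1 <= 0 <= u4.1 -> crs u3 u4 < 0) ->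
  - pi < t0 < pi -> - pi < t1 < pi -> - pi < t2 < pi -> - pi < t3 < pi ->
  turns u0 u1 t0 -> turns u1 u2 t1 -> turns u2 u3 t2 -> turns u3 u4 t3 ->
  - (2 * pi) < t0 + t1 + t2 + t3 < 0.
Proof.
move=> h01 h12 h23 h34 h0 h4 c0 c1 c2 c3 /andP[? ?] /andP[? ?] /andP[? ?] /andP[? ?] r0 r1 r2 r3.
have := @graph_turns_above (mirror u0) (mirror u1) (mirror u2) (mirror u3) (mirror u4)
  (- t0) (- t1) (- t2) (- t3) h01 h12 h23 h34 h0 h4.
rewrite !crs_mirror !oppr_gt0.
move=> /(_ c0 c1 c2 c3) H.
have /andP[] : 0 < - t0 + - t1 + - t2 + - t3 < 2 * pi.
  by apply: H; try exact: turns_mirror; apply/andP; split; lra.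
by move=> *; apply/andP; split; lra.
Qed.

End Angles.

(** * Continuous angles along a path *)

Section Lifts.
Context {R : realType}.
Implicit Types (u v w z : R * R) (x y a b th : R) (g h : R -> R * R).

(** Paths only matter on an interval [a, b]; composing them with the projection onto it
replaces continuity within the interval by plain continuity. *)
Definition clamp a b x : R := Num.max a (Num.min x b).

Lemma clamp_itv a b x : a <= b -> a <= clamp a b x <= b.
Proof.
move=> ab; rewrite /clamp le_max lexx /= ge_max ab /=.
by rewrite ge_min lexx orbT.
Qed.

Lemma clamp_id a b x : a <= x <= b -> clamp a b x = x.
Proof. by move=> /andP[ax xb]; rewrite /clamp min_l // max_r. Qed.

Lemma continuous_clamp a b : continuous (clamp a b).
Proof.
move=> x; apply: (@continuous_max R _ (fun=> a) (fun x => Num.min x b)); first exact: cvg_cst.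
apply: (@continuous_min R _ id (fun=> b)); first exact: cvg_id.
exact: cvg_cst.
Qed.

(** Continuity by coordinates, which is how the paths below are estimated. *)
Definition pcont g := continuous (fun x => (g x).1) /\ continuous (fun x => (g x).2).

(** The angle Phi is asked to be continuous on the whole line and not only within [a, b], so
that pieces can be glued and reparameterised as plain functions. *)
Definition lift_on g a b z th := exists Phi : R -> R, [/\ continuous Phi,
  forall x, a <= x <= b -> exists2 r, 0 < r &
     g x = (z.1 + r * cos (Phi x), z.2 + r * sin (Phi x))
  & Phi b - Phi a = th].

Lemma lift_on_eq g h a b z th : (forall x, a <= x <= b -> g x = h x) ->
  lift_on g a b z th -> lift_on h a b z th.
Proof. by move=> gh [Phi [c p e]]; exists Phi; split=> // x xab; rewrite -gh //; exact: p. Qed.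

Lemma polar_turns z r s a b u v : 0 < r -> 0 < s ->
  u = (z.1 + r * cos a, z.2 + r * sin a) -> v = (z.1 + s * cos b, z.2 + s * sin b) ->
  turns (dsp z u) (dsp z v) (b - a).
Proof.
move=> r0 s0 -> ->; exists (s / r); first exact: divr_gt0.
have rn0 := lt0r_neq0 r0.
rewrite /dsp /= cosB sinB; congr pair.
- transitivity (s * (cos b * (cos a ^+ 2 + sin a ^+ 2))); first by rewrite cos2Dsin2; ring.
  by field.
- transitivity (s * (sin b * (cos a ^+ 2 + sin a ^+ 2))); first by rewrite cos2Dsin2; ring.
  by field.
Qed.

Lemma turns_polar z r a u v th : 0 < r -> u = (z.1 + r * cos a, z.2 + r * sin a) ->
  turns (dsp z u) (dsp z v) th ->
  exists2 s, 0 < s & v = (z.1 + s * cos (a + th), z.2 + s * sin (a + th)).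
Proof.
move=> r0 -> [k k0 [e1 e2]]; exists (k * r); first exact: mulr_gt0.
rewrite /dsp /= in e1 e2; rewrite [LHS]surjective_pairing cosD sinD; congr pair.
- by rewrite -[LHS](subrK z.1) e1; ring.
- by rewrite -[LHS](subrK z.2) e2; ring.
Qed.

Lemma exists_polar z u : u != z -> exists a, exists2 r, 0 < r &
  u = (z.1 + r * cos a, z.2 + r * sin a).
Proof.
move=> uz.
have n0 : dsp z u != (0, 0).
  apply: contraNneq uz => -[/eqP h1 /eqP h2]; move: h1 h2; rewrite !subr_eq0.
  by case: u z => [? ?] [? ?] /= /eqP -> /eqP ->.
set w := dsp z u in n0.
have nw : 0 < nrm w by rewrite nrm_gt0.
have n1 : nrm (1, 0) = 1 :> R by rewrite /nrm /= expr1n expr0n addr0 sqrtr1.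
have [h|h] := ltP 0 (nrm (1, 0) * nrm w + dot (1, 0) w).
  exists (signed_angle (1, 0) w); have [k k0 e] := signed_angle_turns h.
  exists k => //; move: e; set t := signed_angle (1, 0) w; rewrite /w /dsp /= => -[e1 e2].
  rewrite [LHS]surjective_pairing; congr pair.
    by rewrite -[LHS](subrK z.1) e1; ring.
  by rewrite -[LHS](subrK z.2) e2; ring.
exists pi; exists (nrm w) => //.
rewrite n1 mul1r /dot /= mul1r mul0r addr0 in h.
rewrite -[u.1 - z.1]/(w.1) in h.
have w2 := nrm_sqr w.
have w20 : w.2 = 0.
  by apply/eqP; rewrite -sqrf_eq0; apply/eqP; have := sqr_ge0 w.2; nra.
have w1 : w.1 = - nrm w by nra.
rewrite cospi sinpi [LHS]surjective_pairing; congr pair.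
- by rewrite -[LHS](subrK z.1) -[u.1 - z.1]/(w.1) w1; ring.
- by rewrite -[LHS](subrK z.2) -[u.2 - z.2]/(w.2) w20; ring.
Qed.

Lemma lift_on_turns g a b z th : a <= b -> lift_on g a b z th ->
  turns (dsp z (g a)) (dsp z (g b)) th.
Proof.
move=> ab [Phi [_ p <-]].
have [|r r0 ea] := p a; first by rewrite lexx ab.
have [|s s0 eb] := p b; first by rewrite lexx ab.
exact: polar_turns r0 s0 ea eb.
Qed.

Lemma polar_neq z r a : 0 < r -> dsp z (z.1 + r * cos a, z.2 + r * sin a) != (0, 0).
Proof.
move=> r0; rewrite -nrm_gt0 /nrm /dsp /= sqrtr_gt0.
rewrite [X in 0 < X](_ : _ = r ^+ 2 * (cos a ^+ 2 + sin a ^+ 2)); last by ring.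
by rewrite cos2Dsin2 mulr1 exprn_gt0.
Qed.

Lemma lift_on_neq g a b z th x : lift_on g a b z th -> a <= x <= b -> dsp z (g x) != (0, 0).
Proof.
move=> [Phi [_ p _]] xab; have [r r0 ->] := p x xab; exact: polar_neq.
Qed.

(** The difference of two continuous angles takes its values in the multiples of 2 pi, so
by the intermediate value theorem it is constant. *)
Lemma lift_within_uniq g a b z (Phi Psi : R -> R) : a <= b ->
  {within `[a, b], continuous Phi} -> {within `[a, b], continuous Psi} ->
  (forall x, a <= x <= b -> exists2 r, 0 < r & g x = (z.1 + r * cos (Phi x), z.2 + r * sin (Phi x))) ->
  (forall x, a <= x <= b -> exists2 r, 0 < r & g x = (z.1 + r * cos (Psi x), z.2 + r * sin (Psi x))) ->
  Phi b - Phi a = Psi b - Psi a.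
Proof.
move=> ab cP cQ p q.
pose D x := Phi x - Psi x.
have cD : {within `[a, b], continuous D} by exact: within_continuousB.
have D1 x y : a <= x <= b -> a <= y <= b -> cos (D x - D y) = 1.
  have C x' : a <= x' <= b -> turns (dsp z (g x')) (dsp z (g x')) (D x') /\ dsp z (g x') != (0, 0).
    move=> xab; have [r r0 er] := p x' xab; have [s s0 es] := q x' xab; split.
      exact: polar_turns s0 r0 es er.
    by rewrite er polar_neq.
  move=> xab yab; have [tx nx] := C x xab; have [ty ny] := C y yab.
  have cx := turns_refl_cos nx tx; have cy := turns_refl_cos ny ty.
  have sx : sin (D x) = 0.
    by apply/eqP; rewrite -sqrf_eq0 sin2cos2 cx expr1n subrr.
  by rewrite cosB cx cy sx mul0r addr0 mulr1.
have [e|ne] := eqVneq (D a) (D b); first by move: e; rewrite /D; lra.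
exfalso.
have aab : a <= a <= b by rewrite lexx ab.
have bab : a <= b <= b by rewrite lexx ab.
have pi0 := pi_gt0 R.
(* a value of D at distance between 0 and 2 pi from D a *)
pose v := if D a < D b then D a + Num.min (D b - D a) pi else D a - Num.min (D a - D b) pi.
have [|c cab vc] := @IVT R D a b v ab cD.
  rewrite /v; case: (ltrgtP (D a) (D b)) ne => // h _.
    by rewrite minElt; case: ifPn => h2; apply/andP; rewrite -?leNgt in h2; split; lra.
  by rewrite minElt; case: ifPn => h2; apply/andP; rewrite -?leNgt in h2; split; lra.
rewrite in_itv /= in cab.
have : D c - D a = 0.
  apply: cos1_small; first exact: D1.
  rewrite vc /v; case: (ltrgtP (D a) (D b)) ne => // h _; rewrite ltr_norml minElt;
   by case: ifPn => h2; apply/andP; rewrite -?leNgt in h2; split; lra.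
by rewrite vc /v; case: (ltrgtP (D a) (D b)) ne => // h _; rewrite minElt; case: ifPn => h2;
  rewrite -?leNgt in h2; lra.
Qed.

Lemma lift_on_uniq g a b z th th' : a <= b -> lift_on g a b z th -> lift_on g a b z th' ->
  th = th'.
Proof.
move=> ab [P [cP p <-]] [Q [cQ q <-]].
by apply: (lift_within_uniq ab _ _ p q); exact: continuous_subspaceT.
Qed.

(** Two continuous angles are glued at b, after shifting the second one so that they
agree there. *)
Lemma lift_on_cat g a b c z t1 t2 : a <= b -> b <= c ->
  lift_on g a b z t1 -> lift_on g b c z t2 -> lift_on g a c z (t1 + t2).
Proof.
move=> ab bc [P [cP p <-]] [Q [cQ q <-]].
exists (fun x => P (Num.min x b) + (Q (Num.max x b) - Q b)); split.
- move=> x; apply: cvgD.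
    apply: (@continuous_comp _ _ _ (fun x => Num.min x b) P); last exact: cP.
    by apply: (@continuous_min R _ id (fun=> b)); [exact: cvg_id|exact: cvg_cst].
  apply: cvgB; last exact: cvg_cst.
  apply: (@continuous_comp _ _ _ (fun x => Num.max x b) Q); last exact: cQ.
  by apply: (@continuous_max R _ id (fun=> b)); [exact: cvg_id|exact: cvg_cst].
- move=> x /andP[ax xc]; have [xb|bx] := leP x b.
    by rewrite subrr addr0; apply: p; rewrite ax xb.
  have [|r r0 er] := p b; first by rewrite ab lexx.
  have [|s s0 es] := q b; first by rewrite bc lexx.
  have [|s' s0' es'] := q x; first by rewrite ltW.
  have t : turns (dsp z (g b)) (dsp z (g x)) (Q x - Q b) by exact: polar_turns s0 s0' es es'.
  exact: turns_polar r0 er t.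
- rewrite (min_r bc) (min_l ab) (max_l bc) (max_r ab); ring.
Qed.

Lemma continuous_signed_angle (g h : R -> R * R) : pcont g -> pcont h ->
  (forall x, 0 < nrm (g x) * nrm (h x) + dot (g x) (h x)) ->
  continuous (fun x => signed_angle (g x) (h x)).
Proof.
move=> [g1 g2] [h1 h2] pos x.
have cn f : continuous (fun x => (f x).1) -> continuous (fun x => (f x).2) ->
    continuous (fun x : R => nrm (f x : R * R)).
  move=> f1 f2 y; apply: (@continuous_comp _ _ _ (fun x => (f x).1 ^+ 2 + (f x).2 ^+ 2) Num.sqrt).
    apply: cvgD; rewrite /=; under eq_fun do rewrite expr2; apply: cvgM; [exact: f1|exact: f1|exact: f2|exact: f2].
  exact: sqrt_continuous.
apply: cvgM; first exact: cvg_cst.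
apply: (@continuous_comp _ _ _ (fun x => crs (g x) (h x) / (nrm (g x) * nrm (h x) + dot (g x) (h x))) (@atan R)); last exact: continuous_atan.
apply: cvgM.
  by apply: cvgB; apply: cvgM; [exact: g1|exact: h2|exact: g2|exact: h1].
apply: cvgV; first exact: lt0r_neq0.
apply: cvgD; first by apply: cvgM; exact: cn.
by apply: cvgD; apply: cvgM; [exact: g1|exact: h1|exact: g2|exact: h2].
Qed.

Lemma pcont_dsp z g : pcont g -> pcont (fun x => dsp z (g x)).
Proof. by move=> [g1 g2]; split=> x; apply: cvgB; [exact: g1|exact: cvg_cst|exact: g2|exact: cvg_cst]. Qed.

Definition cvx (K : set (R * R)) := forall l u v, 0 <= l <= 1 -> K u -> K v -> K (between l u v).

(** Seen from a point outside a convex set, no two points of the set are in opposite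
directions. *)
Lemma cvx_pos K z u v : cvx K -> K u -> K v -> ~ K z ->
  0 < nrm (dsp z u) * nrm (dsp z v) + dot (dsp z u) (dsp z v).
Proof.
move=> cK Ku Kv nKz; apply: not_opposite => l l01; apply: contra_notN nKz => /eqP[e1 e2].
suff -> : z = between l u v by exact: cK.
rewrite [LHS]surjective_pairing; congr pair; rewrite /dsp /= in e1 e2; lra.
Qed.

(** Around a point outside a convex set that contains the path, the angle can be measured
at every time from the initial direction by [signed_angle], which is continuous. *)
Lemma lift_on_convex K g a b z : cvx K -> ~ K z -> a <= b -> pcont (g \o clamp a b) ->
  (forall x, a <= x <= b -> K (g x)) ->
  exists2 th, - pi < th < pi & lift_on g a b z th.
Proof.
move=> cK nKz ab cg gK.
have Kc x : K (g (clamp a b x)) by apply: gK; exact: clamp_itv.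
have aab : a <= a <= b by rewrite lexx ab.
have bab : a <= b <= b by rewrite lexx ab.
have gaz : g a != z by apply: contra_notN nKz => /eqP <-; exact: gK.
have [t0 [r r0 e0]] := exists_polar gaz.
pose h x := signed_angle (dsp z (g a)) (dsp z (g (clamp a b x))).
have pos x : 0 < nrm (dsp z (g a)) * nrm (dsp z (g (clamp a b x))) + dot (dsp z (g a)) (dsp z (g (clamp a b x))).
  by apply: (cvx_pos cK) => //; exact: gK.
exists (h b - h a).
  have ha : h a = 0 by rewrite /h (clamp_id aab) signed_angle_eq0 // /crs mulrC subrr.
  by rewrite ha subr0; exact: signed_angle_lt.
exists (fun x => t0 + h x); split.
- move=> x; apply: cvgD; first exact: cvg_cst.
  apply: (@continuous_signed_angle (fun=> dsp z (g a)) (fun x => dsp z (g (clamp a b x)))) => //.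
    by split=> ?; exact: cvg_cst.
  exact: (pcont_dsp z cg).
- move=> x xab; apply: (turns_polar r0 e0).
  by rewrite -{1}(clamp_id xab); exact: signed_angle_turns.
- ring.
Qed.

(** If the path never separates z from z', in the sense that it is never seen from them in
opposite directions, then adding the signed angle between the two directions turns a
continuous angle around z into one around z'.  The correction is the same at both
ends because the path is closed. *)
Lemma lift_on_move g a b z z' th : a <= b -> pcont (g \o clamp a b) -> g a = g b ->
  (forall x, a <= x <= b -> 0 < nrm (dsp z (g x)) * nrm (dsp z' (g x)) + dot (dsp z (g x)) (dsp z' (g x))) ->
  lift_on g a b z th -> lift_on g a b z' th.
Proof.
move=> ab cg gab pos [Phi [cP p <-]].
have aab : a <= a <= b by rewrite lexx ab.
have bab : a <= b <= b by rewrite lexx ab.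
pose h x := signed_angle (dsp z (g (clamp a b x))) (dsp z' (g (clamp a b x))).
exists (fun x => Phi x + h x); split.
- move=> x; apply: cvgD; first exact: cP.
  apply: (@continuous_signed_angle (fun x => dsp z (g (clamp a b x))) (fun x => dsp z' (g (clamp a b x)))).
  + exact: (pcont_dsp z cg).
  + exact: (pcont_dsp z' cg).
  + by move=> y; apply: pos; exact: clamp_itv.
- move=> x xab; have [r r0 e] := p x xab.
  have [k k0] := signed_angle_turns (pos x xab).
  have hx : signed_angle (dsp z (g x)) (dsp z' (g x)) = h x by rewrite /h (clamp_id xab).
  rewrite hx e /dsp /= => -[e1 e2].
  exists (k * r); first exact: mulr_gt0.
  rewrite cosD sinD; congr pair; [rewrite -[LHS](subrK z'.1) e1|rewrite -[LHS](subrK z'.2) e2]; ring.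
- by rewrite /h !clamp_id // gab; ring.
Qed.

Lemma lift_on_sim m t g a b z th : m != (0, 0) ->
  lift_on g a b z th -> lift_on (sim m t \o g) a b (sim m t z) th.
Proof.
move=> m0 [Phi [cP p <-]].
have [a0 [k k0 em]] : exists a0, exists2 r, 0 < r & m = (0 + r * cos a0, 0 + r * sin a0).
  exact: (@exists_polar (0, 0)).
exists (fun x => Phi x + a0); split.
- by move=> x; apply: cvgD; [exact: cP|exact: cvg_cst].
- move=> x xab; have [r r0 e] := p x xab; exists (k * r); first exact: mulr_gt0.
  by rewrite /= e em /sim /= cosD sinD; congr pair; ring.
- ring.
Qed.

Lemma lift_on_affine g a b k m z th : 0 < k -> lift_on g (k * a + m) (k * b + m) z th ->
  lift_on (fun x => g (k * x + m)) a b z th.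
Proof.
move=> k0 [Phi [cP p <-]]; exists (fun x => Phi (k * x + m)); split=> //.
- move=> x; apply: (@continuous_comp _ _ _ (fun x => k * x + m) Phi); last exact: cP.
  by apply: cvgD; [apply: cvgM; [exact: cvg_cst|exact: cvg_id]|exact: cvg_cst].
- by move=> x /andP[ax xb]; apply: p; rewrite !lerD2r !ler_pM2l // ax xb.
Qed.

Lemma lift_on_reverse g a b k m z th : k < 0 -> lift_on g (k * b + m) (k * a + m) z th ->
  lift_on (fun x => g (k * x + m)) a b z (- th).
Proof.
move=> k0 [Phi [cP p <-]]; exists (fun x => Phi (k * x + m)); split=> //.
- move=> x; apply: (@continuous_comp _ _ _ (fun x => k * x + m) Phi); last exact: cP.
  by apply: cvgD; [apply: cvgM; [exact: cvg_cst|exact: cvg_id]|exact: cvg_cst].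
- by move=> x /andP[ax xb]; apply: p; rewrite !lerD2r !ler_nM2l // ax xb.
- ring.
Qed.

End Lifts.

(** * Sub-arrays of signs and base 4 expansions *)

Section Signs.

Definition stail {T} (w : nat -> T) : nat -> T := fun k => w k.+1.

Definition sign0 (s : signs) : bool := s 0%N ord0.

Lemma sub_ord_proof (a : 'I_4) k (i : 'I_(4 ^ k)) : (a * 4 ^ k + i < 4 ^ k.+1)%N.
Proof.
rewrite expnS (@leq_trans (a.+1 * 4 ^ k)%N) // ?leq_mul2r ?ltn_ord ?orbT //.
by rewrite mulSn addnC ltn_add2r.
Qed.

(** The signs of the a-th quarter of the curve. *)
Definition sub (s : signs) (a : 'I_4) : signs := fun k i => s k.+1 (Ordinal (sub_ord_proof a i)).

Lemma prefix_val_shift (u : nat -> 'I_4) k :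
  prefix_val u k.+1 = (u 0 * 4 ^ k + prefix_val (stail u) k)%N.
Proof.
rewrite /prefix_val big_ord_recl /= subn0; congr addn; apply: eq_bigr => j _.
by rewrite /stail; case: k j => [[]//|k] j /=; rewrite subSS.
Qed.

Lemma omega0 u s : omega u s 0 = (u 0%N, sign0 s).
Proof. by congr pair; rewrite /sign0; congr (s 0%N _); apply: val_inj; rewrite /= /prefix_val big_ord0. Qed.

(** Self-similarity of the coding: dropping the first digit replaces the array of signs by
the one of the quarter that this digit selects. *)
Lemma omega_shift u s : stail (omega u s) = omega (stail u) (sub s (u 0%N)).
Proof.
apply/funext => k; rewrite /stail /omega /sub; congr pair.
by congr (s k.+1 _); apply: val_inj; rewrite /= prefix_val_shift.
Qed.

End Signs.

Section Expansions.
Context {R : realType}.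
Implicit Types (u : nat -> 'I_4) (t : R).

Definition cons4 (a : 'I_4) u : nat -> 'I_4 := fun k => if k is k'.+1 then u k' else a.

Lemma digits_expansion u t (tau : nat -> R) : tau 0%N = t ->
  (forall k, 0 <= tau k <= 1) -> (forall k, tau k.+1 = 4 * tau k - (u k)%:R) ->
  base4_expansion u t.
Proof.
move=> t0 tau01 tauS; rewrite /base4_expansion.
have e n : series (fun k : nat => (u k)%:R / 4 ^+ k.+1 : R) n = t - tau n * (4^-1) ^+ n.
  elim: n => [|n IH]; first by rewrite /series /= big_geq // t0 mulr1 subrr.
  rewrite /series /= big_nat_recr //= -/(series _ n) [X in X + _]IH tauS.
  by rewrite !exprVn exprS; field; rewrite expf_neq0.
have -> : series (fun k : nat => (u k)%:R / 4 ^+ k.+1 : R) = (fun n => t - tau n * (4^-1) ^+ n).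
  by apply/funext.
rewrite -[X in _ --> X]subr0; apply: cvgB; first exact: cvg_cst.
apply: (@squeeze_cvgr _ _ _ _ (fun=> 0) (fun n => (4^-1) ^+ n)).
- apply: nearW => n; have /andP[a b] := tau01 n.
  rewrite mulr_ge0 ?exprn_ge0 //= ?invr_ge0 //.
  by rewrite -[leRHS]mul1r ler_wpM2r // exprn_ge0 // invr_ge0.
- exact: cvg_cst.
- by apply: cvg_expr; rewrite ger0_norm ?invr_ge0 // invf_lt1 // ltr1n.
Qed.

Lemma series_shift u n : series (fun k : nat => (u k)%:R / 4 ^+ k.+1 : R) n.+1 =
  ((u 0%N)%:R + series (fun k : nat => (stail u k)%:R / 4 ^+ k.+1 : R) n) / 4.
Proof.
rewrite /series /= big_nat_recl //= mulrDl expr1; congr (_ + _).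
rewrite big_distrl /=; apply: eq_bigr => k _.
by rewrite /stail exprSr invfM mulrA.
Qed.

Lemma expansion_shift u t : base4_expansion u t ->
  base4_expansion (stail u) (4 * t - (u 0%N)%:R).
Proof.
rewrite /base4_expansion => h.
have -> : series (fun k : nat => (stail u k)%:R / 4 ^+ k.+1 : R) =
    (fun n => 4 * series (fun k : nat => (u k)%:R / 4 ^+ k.+1 : R) n.+1 - (u 0%N)%:R).
  by apply/funext => n; rewrite series_shift; field.
apply: cvgB; last exact: cvg_cst.
apply: cvgM; first exact: cvg_cst.
by rewrite (cvg_shiftS (series (fun k : nat => (u k)%:R / 4 ^+ k.+1 : R))).
Qed.

Lemma series4_le1 u n : 0 <= series (fun k : nat => (u k)%:R / 4 ^+ k.+1 : R) n <= 1.
Proof.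
elim: n u => [|n IH] u; first by rewrite /series /= big_geq // lexx ler01.
have /andP[a b] := IH (stail u); rewrite series_shift.
have : (u 0%N)%:R <= 3 :> R by rewrite (ler_nat _ _ 3) -ltnS.
have : 0 <= (u 0%N)%:R :> R by [].
by move=> *; apply/andP; split; lra.
Qed.

Lemma expansion_range u t : base4_expansion u t -> 0 <= t <= 1.
Proof.
move=> h; rewrite -(cvg_lim (@Rhausdorff R) h).
apply/andP; split.
  apply: limr_ge; first by apply/cvg_ex; exists t.
  by apply: nearW => n; have /andP[] := series4_le1 u n.
apply: limr_le; first by apply/cvg_ex; exists t.
by apply: nearW => n; have /andP[] := series4_le1 u n.
Qed.

Lemma series4_cvg u : exists t, base4_expansion u t.
Proof.
have : cvgn (series (fun k : nat => (u k)%:R / 4 ^+ k.+1 : R)).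
  apply: nondecreasing_is_cvgn.
    apply/nondecreasing_seqP => n; rewrite /series /= big_nat_recr //= lerDl.
    by rewrite divr_ge0 // exprn_ge0.
  by exists 1 => _ [n _ <-]; have /andP[] := series4_le1 u n.
by move=> /cvg_ex[t ht]; exists t.
Qed.

(** The quarter of [0, 1] that contains t, the left one at a common end. *)
Definition digit t : 'I_4 := if t <= 4^-1 then inord 0 else if t <= 2^-1 then inord 1
  else if t <= 3 / 4 then inord 2 else inord 3.

Lemma digit_range t : 0 <= t <= 1 -> 0 <= 4 * t - (digit t)%:R <= 1.
Proof.
move=> /andP[t0 t1]; rewrite /digit; case: (leP t 4^-1) => h1; [|case: (leP t 2^-1) => h2; [|case: (leP t (3 / 4)) => h3]];
  rewrite inordK //; apply/andP; split; lra.
Qed.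

Lemma expansion_exists t : 0 <= t <= 1 -> exists u, base4_expansion u t.
Proof.
move=> t01; pose tau := fix tau k : R := if k is k'.+1 then 4 * tau k' - (digit (tau k'))%:R else t.
have tau01 k : 0 <= tau k <= 1 by elim: k => [//|k IH] /=; exact: digit_range.
by exists (fun k => digit (tau k)); exact: (@digits_expansion _ _ tau).
Qed.

Lemma expansion_cons a u t : base4_expansion u (4 * t - (a : 'I_4)%:R) ->
  base4_expansion (cons4 a u) t.
Proof.
rewrite /base4_expansion => h; rewrite -(cvg_shiftS (series _)).
have -> : (fun n => series (fun k : nat => (cons4 a u k)%:R / 4 ^+ k.+1 : R) n.+1) =
    (fun n => (a%:R + series (fun k : nat => (u k)%:R / 4 ^+ k.+1 : R) n) / 4).
  by apply/funext => n; rewrite series_shift.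
have -> : t = (a%:R + (4 * t - a%:R)) / 4 by field.
by apply: cvgM; [apply: cvgD; [exact: cvg_cst|exact: h]|exact: cvg_cst].
Qed.

(** The expansions of 1 and of 0 are unique; they occur at the points with two expansions,
where one tail is an expansion of 1 and the other one of 0. *)
Lemma expansion_of_1 u : base4_expansion u (1 : R) -> forall k, u k = ord_max.
Proof.
move=> h k; elim: k u h => [|k IH] u h; have hS := expansion_shift h;
  have /andP[_ a] := expansion_range hS; have u3 : (u 0%N = 3 :> nat).
- apply/eqP; rewrite eqn_leq -ltnS ltn_ord /= -(ler_nat R); lra.
- exact: val_inj.
- apply/eqP; rewrite eqn_leq -ltnS ltn_ord /= -(ler_nat R); lra.
- by apply: (IH (stail u)); move: hS; rewrite u3; congr (base4_expansion _ _); lra.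
Qed.

Lemma expansion_of_0 u : base4_expansion u (0 : R) -> forall k, u k = ord0.
Proof.
move=> h k; elim: k u h => [|k IH] u h; have hS := expansion_shift h;
  have /andP[a _] := expansion_range hS; have u3 : (u 0%N = 0 :> nat).
- apply/eqP; rewrite -leqn0 -(ler_nat R); lra.
- exact: val_inj.
- apply/eqP; rewrite -leqn0 -(ler_nat R); lra.
- by apply: (IH (stail u)); move: hS; rewrite u3; congr (base4_expansion _ _); lra.
Qed.

End Expansions.

(** * Total angles along a closed path *)

Section ClosedPaths.
Context {R : realType}.
Implicit Types (f g : R -> R * R) (h : R -> R) (z : R * R).

Lemma pcont_comp f h : pcont f -> continuous h -> pcont (f \o h).
Proof.
move=> [f1 f2] ch; split=> x.
  by apply: (@continuous_comp _ _ _ h (fun y => (f y).1)); [exact: ch|exact: f1].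
by apply: (@continuous_comp _ _ _ h (fun y => (f y).2)); [exact: ch|exact: f2].
Qed.

Lemma pcont_sim (m t : R * R) f : pcont f -> pcont (sim m t \o f).
Proof.
move=> [f1 f2]; split=> x /=.
  by apply: cvgD; [apply: cvgB; apply: cvgM|]; try exact: cvg_cst; [exact: f1|exact: f2].
by apply: cvgD; [apply: cvgD; apply: cvgM|]; try exact: cvg_cst; [exact: f1|exact: f2].
Qed.

(** Where one of the two pieces moves the other one is constant, so the path is the sum of
both minus their common value. *)
Lemma pcont_cat f (a b c : R) : a <= b -> b <= c ->
  pcont (f \o clamp a b) -> pcont (f \o clamp b c) -> pcont (f \o clamp a c).
Proof.
move=> ab bc [l1 l2] [r1 r2].
have E x : f (clamp a c x) = ((f (clamp a b x)).1 + (f (clamp b c x)).1 - (f b).1,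
    (f (clamp a b x)).2 + (f (clamp b c x)).2 - (f b).2).
  have [xb|bx] := leP x b.
    have -> : clamp b c x = b by rewrite /clamp min_l ?max_l //; exact: le_trans bc.
    have -> : clamp a c x = clamp a b x by rewrite /clamp !min_l //; exact: le_trans bc.
    by rewrite !addrK -surjective_pairing.
  have -> : clamp a b x = b by rewrite /clamp min_r ?max_r // ltW.
  have -> : clamp a c x = clamp b c x.
    rewrite /clamp !max_r // le_min ?(ltW bx) ?bc //; first by rewrite (le_trans ab) ?(ltW bx) ?(le_trans ab).
  by rewrite [LHS]surjective_pairing; congr pair; ring.
have c1 : continuous (fun x => (f (clamp a b x)).1 + (f (clamp b c x)).1 - (f b).1).
  by move=> x; apply: cvgB; [apply: cvgD; [exact: l1|exact: r1]|exact: cvg_cst].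
have c2 : continuous (fun x => (f (clamp a b x)).2 + (f (clamp b c x)).2 - (f b).2).
  by move=> x; apply: cvgB; [apply: cvgD; [exact: l2|exact: r2]|exact: cvg_cst].
split.
  by rewrite (_ : (fun x => _) = (fun x => (f (clamp a b x)).1 + (f (clamp b c x)).1 - (f b).1)) //;
    apply/funext => x; rewrite /= E.
by rewrite (_ : (fun x => _) = (fun x => (f (clamp a b x)).2 + (f (clamp b c x)).2 - (f b).2)) //;
  apply/funext => x; rewrite /= E.
Qed.

Lemma pcont_affine f g (a b k m : R) : a <= b -> pcont (f \o clamp 0 1) ->
  (forall x, a <= x <= b -> 0 <= k * x + m <= 1 /\ g x = f (k * x + m)) ->
  pcont (g \o clamp a b).
Proof.
move=> ab cf gE.
have -> : g \o clamp a b = (f \o clamp 0 1) \o (fun x => k * clamp a b x + m).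
  apply/funext => x /=; have [h1 h2] := gE _ (clamp_itv x ab).
  by rewrite h2 (clamp_id h1).
apply: pcont_comp => // x; apply: cvgD; last exact: cvg_cst.
by apply: cvgM; [exact: cvg_cst|exact: continuous_clamp].
Qed.

Lemma pcont_continuous f : pcont f -> continuous f.
Proof.
move=> [f1 f2] x; have h := cvg_pair (f1 x) (f2 x).
have e : f = (fun y => ((f y).1, (f y).2)) by apply/funext => y; rewrite -surjective_pairing.
rewrite e /continuous_at /=; exact: h.
Qed.

Lemma path_compact f : pcont (f \o clamp 0 1) -> compact (f @` `[0, 1]).
Proof.
move=> cf.
have -> : f @` `[0, 1] = (f \o clamp 0 1) @` `[0, 1].
  by apply: eq_imagel => x /=; rewrite in_itv /= => x01; rewrite clamp_id.
apply: continuous_compact; last exact: segment_compact.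
by apply: continuous_subspaceT; exact: pcont_continuous.
Qed.

Lemma cvx_ball z (e : R) : cvx (ball z e).
Proof.
move=> l u v /andP[l0 l1] [u1 u2] [v1 v2].
have key (c a b : R) : ball c e a -> ball c e b -> ball c e ((1 - l) * a + l * b).
  rewrite /ball /= !ltr_distlC => /andP[a1 a2] /andP[b1 b2].
  have -> : c - e < (1 - l) * a + l * b.
    have -> : c - e = (1 - l) * (c - e) + l * (c - e) by ring.
    case: (ltgtP l 0) l0 => // [l0|->] _; last by rewrite subr0 !mul1r !mul0r !addr0.
    by apply: ler_ltD; [rewrite ler_wpM2l ?subr_ge0 // ltW|rewrite ltr_pM2l].
  have -> : c + e = (1 - l) * (c + e) + l * (c + e) by ring.
  case: (ltgtP l 0) l0 => // [l0|->] _; last by rewrite subr0 !mul1r !mul0r !addr0.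
  by apply: ler_ltD; [rewrite ler_wpM2l ?subr_ge0 // ltW|rewrite ltr_pM2l].
by split; exact: key.
Qed.

Context (g : R -> R * R) (F : set (R * R)).
Context (cg : pcont (g \o clamp 0 1)) (g01 : g 0 = g 1) (clF : closed F).
Context (gF : forall x, 0 <= x <= 1 -> F (g x)).
Context (lifts : forall z, ~ F z -> exists th, lift_on g 0 1 z th).

(** A ball around z that avoids F is convex, so seen from a point of the path no two of its
points are opposite and [lift_on_move] applies. *)
Lemma lift_near z th : ~ F z -> lift_on g 0 1 z th ->
  \forall z' \near z, ~ F z' /\ lift_on g 0 1 z' th.
Proof.
move=> nF lz.
have oF : open (~` F) by rewrite openC.
have /nbhs_ballP[e /= e0 be] : nbhs z (~` F) by exact: open_nbhs_nbhs.
apply/nbhs_ballP; exists e => //= z' bz'; split; first exact: be.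
apply: (lift_on_move ler01 cg g01 _ lz) => x x01.
have nb : ~ ball z e (g x) by move=> /be; apply; exact: gF.
have := cvx_pos (@cvx_ball z e) (ballxx z e0) bz' nb.
have n w : nrm (dsp w (g x)) = nrm (dsp (g x) w).
  by rewrite /nrm /dsp /=; congr Num.sqrt; ring.
rewrite !n (_ : dot _ _ = dot (dsp (g x) z) (dsp (g x) z')) //.
by rewrite /dot /dsp /=; ring.
Qed.

Lemma open_lift (P : R -> Prop) : open [set z | ~ F z /\ exists2 th, P th & lift_on g 0 1 z th].
Proof.
rewrite openE => z [nF [th Pth lz]].
by apply: filterS (lift_near nF lz) => z' [nF' lz']; split=> //; exists th.
Qed.

(** The points with total angle th and those with another total angle are both open, and
they cover the complement of F. *)
Lemma component_lift z th : ~ F z -> lift_on g 0 1 z th ->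
  forall z', connected_component (~` F) z z' -> ~ F z' /\ lift_on g 0 1 z' th.
Proof.
move=> nF lz; set C := connected_component _ _.
have CF : C `<=` ~` F by exact: connected_component_sub.
have Cz : C z by exact: connected_component_refl.
(* the component meets the open set W (eq^~ th), which is closed in it *)
pose W P := [set z | ~ F z /\ exists2 th, P th & lift_on g 0 1 z th].
have conn : C `&` W (eq^~ th) = C.
  apply: (@component_connected _ (~` F) z).
  - by exists z; split=> //; split=> //; exists th.
  - by exists (W (eq^~ th)) => //; exact: open_lift.
  - exists (~` W (fun x => x <> th)); first by rewrite closedC; exact: open_lift.
    apply/seteqP; split=> z' [Cz' h]; split=> //.
      move: h => [_ [x -> lx]] [_ [y ny ly]]; apply: ny; exact: lift_on_uniq ler01 ly lx.
    split; first exact: CF.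
    have [x lx] := lifts (CF _ Cz'); exists x => //.
    by apply: contrapT => nx; apply: h; split; [exact: CF|exists x].
by move=> z' Cz'; have [_ [nF' [x -> lx]]] : (C `&` W (eq^~ th)) z' by rewrite conn.
Qed.

(** A continuous angle exists and its variation is unique, so the angle in
[has_winding_number], which is continuous only within [0, 1], may be replaced by one
that is defined on the whole line. *)
Lemma has_windingP z (n : int) : ~ F z ->
  has_winding_number g z n <-> lift_on g 0 1 z (2 * pi * n%:~R).
Proof.
move=> nF; split=> [[rad [theta [ct hr ht]]]|[Phi [cP hP e]]].
- have [th lz] := lifts nF; have [Phi [cP hP e]] := lz.
  suff -> : 2 * pi * n%:~R = th by [].
  rewrite -ht -e; apply: (@lift_within_uniq _ g 0 1 z) => //.
  + by apply: continuous_subspaceT.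
  + by move=> x x01; have [|r0 gx] := hr x; [rewrite in_itv|exists (rad x)].
- have : forall x, exists r, 0 <= x <= 1 -> 0 < r /\ g x = (z.1 + r * cos (Phi x), z.2 + r * sin (Phi x)).
    move=> x; have [x01|nx] := pselect (0 <= x <= 1); last by exists 0.
    by have [r r0 gx] := hP x x01; exists r.
  move=> /choice[rad hrad]; exists rad, Phi; split=> //.
    by apply: continuous_subspaceT.
Qed.

End ClosedPaths.

(** * Geometric rates and greedy signed expansions *)

(** All limits below have geometric rate; this is the only form in which they are used. *)
Lemma geometric_eq0 {R : realType} (C r d : R) : 0 <= r < 1 -> 0 <= d ->
  (forall k : nat, d <= C * r ^+ k) -> d = 0.
Proof.
move=> /andP[r0 r1] d0 h; apply/eqP; rewrite eq_le d0 andbT.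
have c : (fun k : nat => C * r ^+ k) @ \oo --> C * 0.
  by apply: cvgM; [exact: cvg_cst|apply: cvg_expr; rewrite ger0_norm].
rewrite mulr0 in c; rewrite -(cvg_lim (@Rhausdorff R) c).
by apply: limr_ge; [apply/cvg_ex; exists 0|exact: nearW].
Qed.

Lemma sum_blocks (V : nmodType) (m M : nat) (F : nat -> V) :
  \sum_(j < m) \sum_(0 <= i < M) F (j * M + i)%N = \sum_(0 <= i < m * M) F i.
Proof.
elim: m => [|m IH]; first by rewrite big_ord0 mul0n big_geq.
rewrite big_ord_recr /= IH mulSnr [RHS](@big_cat_nat _ _ _ (m * M)%N) ?leq_addr //=.
congr (_ + _); have := @big_addn _ 0 +%R 0 (m * M + M) (m * M) xpredT F.
by rewrite add0n addKn => ->; apply: eq_bigr => i _; rewrite addnC.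
Qed.

Section Greedy.
Context {R : realType}.

Definition sgn (e : bool) : R := if e then -1 else 1.

Lemma sum_threshold (c N : nat) : (c <= N)%N ->
  \sum_(0 <= i < N) sgn (~~ (i < c)%N) = 2 * c%:R - N%:R :> R.
Proof.
move=> cN; rewrite (@big_cat_nat _ _ _ c) //= [X in X + _](_ : _ = c%:R); last first.
  rewrite (@eq_big_nat _ _ _ _ _ _ (fun=> 1)); last by move=> i /andP[_ ->].
  by rewrite sumr_const_nat subn0.
rewrite (@eq_big_nat _ _ _ _ _ _ (fun=> -1)); last first.
  by move=> i /andP[ci _]; rewrite ltnNge ci.
by rewrite sumr_const_nat -[X in _ + X]mulr_natr natrB //; ring.
Qed.

(** The smallest c for which v is at most (2 c - N) B plus the tolerance works, where
B = H (1 - rho).  Consecutive candidates are 2 B apart, which is at most twice the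
tolerance because N >= 3 and rho >= 1/4; at both ends B + H rho = H makes the tolerance
exactly sufficient. *)
Lemma greedy_step (N : nat) (H rho v : R) : (3 <= N)%N -> 0 <= H -> 4^-1 <= rho ->
  `|v| <= N%:R * H -> exists2 c, (c <= N)%N &
  `|v - (2 * c%:R - N%:R) * (H * (1 - rho))| <= N%:R * H * rho.
Proof.
move=> N3 H0 r4; rewrite ler_norml => /andP[v1 v2].
set B := H * (1 - rho).
have n3 : 3 <= N%:R :> R by rewrite (ler_nat _ 3).
have hB : B <= N%:R * H * rho.
  have : 0 <= H * (N%:R * rho - (1 - rho)) by apply: mulr_ge0 => //; nra.
  by rewrite /B; lra.
suff gen c : (c <= N)%N -> v <= (2 * c%:R - N%:R) * B + N%:R * H * rho ->
    exists2 c, (c <= N)%N & `|v - (2 * c%:R - N%:R) * B| <= N%:R * H * rho.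
  by apply: (gen N) => //; rewrite /B; lra.
elim: c => [|c IH] cN hc.
  exists 0%N => //; rewrite ler_norml; apply/andP; split; last by lra.
  by move: v1; rewrite /B; lra.
have [le|gt] := leP v ((2 * c%:R - N%:R) * B + N%:R * H * rho).
  by apply: IH => //; exact: ltnW.
exists c.+1 => //; rewrite ler_norml; apply/andP; split; last by lra.
by rewrite -natr1; lra.
Qed.

(** The invariant is that after n levels the remainder, divided by r^n, is at most
3 * 4^n * H in absolute value, the largest sum that the levels from n on can reach. *)
Lemma greedy_expansion (H r v : R) : 0 <= H -> 16^-1 <= r -> `|v| <= 3 * H ->
  exists2 c : nat -> nat, (forall k, c k <= 3 * 4 ^ k)%N &
  forall n, `|v - H * (1 - 4 * r) * \sum_(k < n) r ^+ k * (2 * (c k)%:R - (3 * 4 ^ k)%:R)|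
    <= 3 * H * (4 * r) ^+ n.
Proof.
move=> H0 r0 v0.
have r4 : 4^-1 <= 4 * r by lra.
have rn : r != 0 by apply/eqP; lra.
have rp : 0 < r by lra.
pose N k := (3 * 4 ^ k)%N.
have N3 k : (3 <= N k)%N by rewrite /N leq_pmulr // expn_gt0.
have /choice[C hC] : forall kw : nat * R, exists c, `|kw.2| <= (N kw.1)%:R * H -> (c <= N kw.1)%N /\
    `|kw.2 - (2 * c%:R - (N kw.1)%:R) * (H * (1 - 4 * r))| <= (N kw.1)%:R * H * (4 * r).
  move=> [k w] /=; have [b|nb] := pselect (`|w| <= (N k)%:R * H); last by exists 0%N.
  by have [c c1 c2] := greedy_step (N3 k) H0 r4 b; exists c.
pose m k w : R := 2 * (C (k, w))%:R - (N k)%:R.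
(* the remainder after k levels, divided by r^k *)
pose st := fix st k := if k is k'.+1 then (st k' - m k' (st k') * (H * (1 - 4 * r))) / r else v.
have bnd k : `|st k| <= (N k)%:R * H.
  elim: k => [|k IH]; first by rewrite /= /N expn0 muln1.
  have [_] := hC (k, st k) IH; rewrite -/(m _ _) /= normrM normfV [`|r|]gtr0_norm // ler_pdivrMr //.
  by move=> h; apply: le_trans h _; rewrite /N expnS mulnCA !natrM; lra.
exists (fun k => C (k, st k)); first by move=> k; have [] := hC (k, st k) (bnd k).
move=> n.
have -> : v - H * (1 - 4 * r) * \sum_(k < n) r ^+ k * (2 * (C (k : nat, st k))%:R - (3 * 4 ^ k)%:R) =
    r ^+ n * st n.
  elim: n => [|n IH]; first by rewrite big_ord0 mulr0 subr0 mul1r.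
  rewrite big_ord_recr /= mulrDr opprD addrA IH exprSr.
  rewrite -[(r ^+ n * r) * _]mulrA [r * _]mulrC divfK // /m /N; ring.
rewrite normrM ger0_norm ?exprn_ge0 ?(ltW rp) // exprMn.
apply: le_trans (ler_wpM2l (exprn_ge0 _ (ltW rp)) (bnd n)) _.
by rewrite le_eqVlt; apply/orP; left; apply/eqP; rewrite /N natrM natrX; ring.
Qed.

End Greedy.

Section KochGeometry.
Context {R : realType} (p : R) (hp : 4^-1 < p <= 3^-1).
Local Notation q := (koch_q p).
Local Notation mu := ((@lebesgue_measure R) \x (@lebesgue_measure R))%E.
Local Notation mR := (measurableTypeR R).
Local Notation meas := (@measurable _ (mR * mR)%type).

(** * The rhombus and its four copies *)

Section Rhombus.
Implicit Types (z : R * R) (a : letter).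

Lemma p_bounds : 4^-1 < p /\ p <= 3^-1. Proof. by case/andP: hp. Qed.

Lemma q_sqr : q ^+ 2 = 4 * p - 1.
Proof. by case: p_bounds => *; rewrite sqr_sqrtr //; lra. Qed.

Lemma q_gt0 : 0 < q.
Proof. by case: p_bounds => *; rewrite sqrtr_gt0; lra. Qed.

Definition phi_m a : R * R := match val a.1, a.2 with
  | 1%N, false | 2%N, true => ((1 - 2 * p) / 2, q / 2)
  | 1%N, true | 2%N, false => ((1 - 2 * p) / 2, - (q / 2))
  | _, _ => (p, 0)
  end.

Definition phi_t a : R * R := match val a.1, a.2 with
  | 0%N, _ => (- ((1 - p) / 2), 0)
  | 1%N, false => ((2 * p - 1) / 4, q / 4)
  | 1%N, true => ((2 * p - 1) / 4, - (q / 4))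
  | 2%N, false => ((1 - 2 * p) / 4, q / 4)
  | 2%N, true => ((1 - 2 * p) / 4, - (q / 4))
  | _, _ => ((1 - p) / 2, 0)
  end.

Lemma phi_sim a z : phi p a z = sim (phi_m a) (phi_t a) z.
Proof.
by case: z => x y; case: a => -[[|[|[|[|//]]]] ?] [];
  rewrite /phi /sim /phi_m /phi_t /=; congr pair; field.
Qed.

Lemma phi_m_sqr a : (phi_m a).1 ^+ 2 + (phi_m a).2 ^+ 2 = p ^+ 2.
Proof.
have q2 := q_sqr.
by case: a => -[[|[|[|[|//]]]] ?] []; rewrite /phi_m /= ?expr0n ?addr0 ?sqrrN // !exprMn q2; field.
Qed.

Lemma phi_m_gt0 a : 0 < (phi_m a).1.
Proof. by case: p_bounds => ? ?; case: a => -[[|[|[|[|//]]]] ?] [] /=; rewrite /phi_m /=; lra. Qed.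

Definition psi_m a : R * R := ((phi_m a).1 / p ^+ 2, - (phi_m a).2 / p ^+ 2).
Definition psi_t a : R * R :=
  (- ((psi_m a).1 * (phi_t a).1 - (psi_m a).2 * (phi_t a).2),
   - ((psi_m a).2 * (phi_t a).1 + (psi_m a).1 * (phi_t a).2)).
Definition psi a z := sim (psi_m a) (psi_t a) z.

Lemma p_neq0 : p != 0.
Proof. by case: p_bounds => ? ?; rewrite gt_eqF //; lra. Qed.

Lemma phiK a : cancel (phi p a) (psi a).
Proof.
move=> [x y]; rewrite phi_sim /psi /sim /psi_t /psi_m /=.
have := phi_m_sqr a; case: (phi_m a) => c d /= cd; case: (phi_t a) => e f /=.
have p0 := p_neq0.
congr pair.
- transitivity (x * (c ^+ 2 + d ^+ 2) / p ^+ 2); first by field.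
  by rewrite cd mulfK // expf_neq0.
- transitivity (y * (c ^+ 2 + d ^+ 2) / p ^+ 2); first by field.
  by rewrite cd mulfK // expf_neq0.
Qed.

Lemma psiK a : cancel (psi a) (phi p a).
Proof.
move=> [x y]; rewrite phi_sim /psi /sim /psi_t /psi_m /=.
have := phi_m_sqr a; case: (phi_m a) => c d /= cd; case: (phi_t a) => e f /=.
have p0 := p_neq0.
congr pair.
- transitivity ((x - e) * (c ^+ 2 + d ^+ 2) / p ^+ 2 + e); first by field.
  by rewrite cd mulfK ?subrK // expf_neq0.
- transitivity ((y - f) * (c ^+ 2 + d ^+ 2) / p ^+ 2 + f); first by field.
  by rewrite cd mulfK ?subrK // expf_neq0.
Qed.

Definition d2 (z z' : R * R) : R := (z.1 - z'.1) ^+ 2 + (z.2 - z'.2) ^+ 2.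

Lemma d2_ge0 z z' : 0 <= d2 z z'. Proof. by rewrite addr_ge0 ?sqr_ge0. Qed.

Lemma d2_eq0 z z' : d2 z z' = 0 -> z = z'.
Proof.
move/eqP; rewrite paddr_eq0 ?sqr_ge0 // !sqrf_eq0 !subr_eq0 => /andP[/eqP e1 /eqP e2].
by rewrite [z]surjective_pairing e1 e2 -surjective_pairing.
Qed.

Lemma d2_phi a z z' : d2 (phi p a z) (phi p a z') = p ^+ 2 * d2 z z'.
Proof. by rewrite !phi_sim -(phi_m_sqr a) /d2 /sim /=; ring. Qed.

(** Inequalities are the form in which the rhombus is used; [rhombusE] identifies it with the
closed convex hull of the four vertices. *)
Definition V : set (R * R) := [set z | `|z.2| + q * `|z.1| <= q / 2].
Definition Vo : set (R * R) := [set z | `|z.2| + q * `|z.1| < q / 2].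

Lemma VP z : V z <-> [/\ z.2 + q * z.1 <= q / 2, z.2 - q * z.1 <= q / 2,
   - z.2 + q * z.1 <= q / 2 & - z.2 - q * z.1 <= q / 2].
Proof.
have q0 := q_gt0; rewrite /V /=; split.
  have := ler_norm z.2; have := ler_norm (- z.2); rewrite normrN.
  have := ler_norm z.1; have := ler_norm (- z.1); rewrite normrN => *; split; nra.
move=> [h1 h2 h3 h4]; have [|] := ger0P z.2; have [|] := ger0P z.1 => *; nra.
Qed.

Lemma VoP z : Vo z <-> [/\ z.2 + q * z.1 < q / 2, z.2 - q * z.1 < q / 2,
   - z.2 + q * z.1 < q / 2 & - z.2 - q * z.1 < q / 2].
Proof.
have q0 := q_gt0; rewrite /Vo /=; split.
  have := ler_norm z.2; have := ler_norm (- z.2); rewrite normrN.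
  have := ler_norm z.1; have := ler_norm (- z.1); rewrite normrN => *; split; nra.
move=> [h1 h2 h3 h4]; have [|] := ger0P z.2; have [|] := ger0P z.1 => *; nra.
Qed.

Lemma Vo_V : Vo `<=` V. Proof. by move=> z /ltW. Qed.

(** An affine function is at most its maximum over the four vertices. *)
Lemma V_affine_le (c d e : R) z : V z ->
  c / 2 + e <= 0 -> - c / 2 + e <= 0 -> d * q / 2 + e <= 0 -> - d * q / 2 + e <= 0 ->
  c * z.1 + d * z.2 + e <= 0.
Proof.
rewrite /V /= => Vz c1 c2 d1 d2; have q0 := q_gt0.
have h1 : c * z.1 <= `|c| * `|z.1| by rewrite -normrM ler_norm.
have h2 : d * z.2 <= `|d| * `|z.2| by rewrite -normrM ler_norm.
have h3 : `|c| * `|z.1| <= - 2 * e * `|z.1|.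
  by rewrite ler_wpM2r // ler_norml; apply/andP; split; lra.
have h4 : `|d| * `|z.2| * q <= - 2 * e * `|z.2|.
  have : `|d * q| <= - 2 * e by rewrite ler_norml; apply/andP; split; lra.
  by rewrite normrM (gtr0_norm q0); have := normr_ge0 z.2; nra.
have e0 : e <= 0 by lra.
suff : (c * z.1 + d * z.2 + e) * q <= 0 by rewrite pmulr_lle0.
have : - 2 * e * (`|z.2| + q * `|z.1|) <= - 2 * e * (q / 2) by rewrite ler_wpM2l //; lra.
nra.
Qed.

(** On the open rhombus an affine function that is at most 0 at the vertices is negative,
unless it vanishes identically, which e < 0 excludes. *)
Lemma Vo_affine_lt (c d e : R) z : Vo z -> e < 0 ->
  c / 2 + e <= 0 -> - c / 2 + e <= 0 -> d * q / 2 + e <= 0 -> - d * q / 2 + e <= 0 ->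
  c * z.1 + d * z.2 + e < 0.
Proof.
rewrite /Vo /= => Vz e0 c1 c2 d1 d2; have q0 := q_gt0.
have h1 : c * z.1 <= `|c| * `|z.1| by rewrite -normrM ler_norm.
have h2 : d * z.2 <= `|d| * `|z.2| by rewrite -normrM ler_norm.
have h3 : `|c| * `|z.1| <= - 2 * e * `|z.1|.
  by rewrite ler_wpM2r // ler_norml; apply/andP; split; lra.
have h4 : `|d| * `|z.2| * q <= - 2 * e * `|z.2|.
  have : `|d * q| <= - 2 * e by rewrite ler_norml; apply/andP; split; lra.
  by rewrite normrM (gtr0_norm q0); have := normr_ge0 z.2; nra.
suff : (c * z.1 + d * z.2 + e) * q < 0 by rewrite pmulr_llt0.
have : - 2 * e * (`|z.2| + q * `|z.1|) < - 2 * e * (q / 2) by rewrite ltr_pM2l //; lra.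
nra.
Qed.

(** The consequences of q^2 = 4 p - 1 and 1/4 < p <= 1/3 that make the inequalities below
linear in p, q, q p and q^3. *)
Lemma pq_facts : [/\ 0 < q, q / 4 < q * p, q * p <= q / 3, q * q = 4 * p - 1 & q * q * q = 4 * (q * p) - q].
Proof.
have [p1 p2] := p_bounds; have q0 := q_gt0; have q2 := q_sqr.
by rewrite -expr2 q2; split=> //; nra.
Qed.

(** Each side of V bounds an affine function, whose values at the images of the four
vertices are compared one by one. *)
Lemma phi_V a z : V z -> V (phi p a z).
Proof.
move=> Vz; have [q0 qp1 qp2 q2 q3] := pq_facts; have [p1 p2] := p_bounds.
pose m := phi_m a; pose t := phi_t a.
have L (s r : R) : (s == 1) || (s == -1) -> (r == 1) || (r == -1) ->
    s * (phi p a z).2 + r * (q * (phi p a z).1) <= q / 2.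
  move=> s1 r1; rewrite -subr_le0 phi_sim /sim -/m -/t /=.
  rewrite (_ : _ - _ = (s * m.2 + r * q * m.1) * z.1 + (s * m.1 - r * q * m.2) * z.2 +
    (s * t.2 + r * q * t.1 - q / 2)); last by field.
  apply: V_affine_le => //; rewrite /m /t {m t};
  case: a => -[[|[|[|[|//]]]] ?] []; rewrite /phi_m /phi_t /=;
  case/orP: s1 => /eqP ->; case/orP: r1 => /eqP ->; lra.
apply/VP; split.
- by have := L 1 1; rewrite !eqxx !mul1r; exact.
- by have := L 1 (-1); rewrite !eqxx !orbT !mul1r mulN1r; exact.
- by have := L (-1) 1; rewrite !eqxx !orbT !mul1r mulN1r; exact.
- by have := L (-1) (-1); rewrite !eqxx !orbT !mulN1r; exact.
Qed.

Lemma phi_Vo a z : Vo z -> Vo (phi p a z).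
Proof.
move=> Vz; have [q0 qp1 qp2 q2 q3] := pq_facts; have [p1 p2] := p_bounds.
pose m := phi_m a; pose t := phi_t a.
have L (s r : R) : (s == 1) || (s == -1) -> (r == 1) || (r == -1) ->
    s * (phi p a z).2 + r * (q * (phi p a z).1) < q / 2.
  move=> s1 r1; rewrite -subr_lt0 phi_sim /sim -/m -/t /=.
  rewrite (_ : _ - _ = (s * m.2 + r * q * m.1) * z.1 + (s * m.1 - r * q * m.2) * z.2 +
    (s * t.2 + r * q * t.1 - q / 2)); last by field.
  apply: Vo_affine_lt => //; rewrite /m /t {m t};
  case: a => -[[|[|[|[|//]]]] ?] []; rewrite /phi_m /phi_t /=;
  case/orP: s1 => /eqP ->; case/orP: r1 => /eqP ->; lra.
apply/VoP; split.
- by have := L 1 1; rewrite !eqxx !mul1r; exact.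
- by have := L 1 (-1); rewrite !eqxx !orbT !mul1r mulN1r; exact.
- by have := L (-1) 1; rewrite !eqxx !orbT !mul1r mulN1r; exact.
- by have := L (-1) (-1); rewrite !eqxx !orbT !mulN1r; exact.
Qed.

Lemma cvx_V : cvx V.
Proof.
move=> l u v /andP[l0 l1] /VP[u1 u2 u3 u4] /VP[v1 v2 v3 v4]; rewrite /between.
by apply/VP; split=> /=; nra.
Qed.

End Rhombus.

(** * Coding points *)

Section Coding.
Implicit Types (z : R * R) (a : letter) (w : nat -> letter).

Lemma convex_between (C : set (R * R)) u v (l : R) : convex_set C -> 0 <= l <= 1 ->
  C u -> C v -> C (between l u v).
Proof.
move=> cC /andP[l0 l1] Cu Cv.
have := cC v u (Itv01 l0 l1) (mem_set Cv) (mem_set Cu) => /set_mem.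
by congr C; exact: addrC.
Qed.

Lemma convex_set_cvx (C : set (R * R)) : cvx C -> convex_set C.
Proof.
move=> cC u v l /set_mem Cu /set_mem Cv; apply/mem_set.
have : C (between l%:num v u) by apply: cC => //; apply/andP; split.
congr C; change (conv l u v) with (l%:num *: (u : R * R) + (1 - l%:num) *: (v : R * R)).
by rewrite addrC.
Qed.

Lemma closed_V : closed V.
Proof.
have -> : V = (fun z => `|z.2| + q * `|z.1| : R) @^-1` [set x | x <= q / 2] by [].
apply: closed_comp; last exact: closed_le.
move=> x _; apply: cvgD.
  by apply: (@continuous_comp _ _ _ snd (fun x : R => `|x|)); [exact: cvg_snd|exact: norm_continuous].
apply: cvgM; first exact: cvg_cst.
by apply: (@continuous_comp _ _ _ fst (fun x : R => `|x|)); [exact: cvg_fst|exact: norm_continuous].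
Qed.

(** For the nontrivial inclusion a point of V is written as a convex combination of a point
of the long diagonal and of the upper or lower vertex, according to its sign. *)
Lemma rhombusE : rhombus p = V.
Proof.
have q0 := q_gt0.
apply/seteqP; split=> z; last first.
  move=> Vz C [[clC cvC] CG].
  pose x0 : R := 2^-1.
  have CP : C (x0, 0) by apply: CG; do 3 left.
  have CP' : C (- x0, 0) by apply: CG; do 2 left; right.
  have CQ (b : bool) : C (0, if b then q / 2 else - (q / 2)).
    by case: b; apply: CG; [left|]; right.
  have Cx (x : R) : - x0 <= x <= x0 -> C (x, 0).
    move=> /andP[h1 h2]; rewrite /x0 in h1 h2.
    have := @convex_between C (- x0, 0) (x0, 0) (x + x0) cvC _ CP' CP.
    have -> : between (x + x0) (- x0, 0) (x0, 0) = (x, 0).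
      by rewrite /between /= /x0; congr pair; field.
    by apply; rewrite /x0; apply/andP; split; lra.
  case: z Vz => x y /VP[/= v1 v2 v3 v4].
  (* the weight of the upper or lower vertex *)
  pose m := 2 * `|y| / q.
  have yq : `|y| <= q / 2 by rewrite ler_norml; apply/andP; split; lra.
  have m0 : 0 <= m by rewrite divr_ge0 ?mulr_ge0 // ltW.
  have mq : m * q = 2 * `|y| by rewrite /m divfK // gt_eqF.
  have m1 : m <= 1 by rewrite /m ler_pdivrMr // mul1r; lra.
  have sE : m * (if 0 <= y then q / 2 else - (q / 2)) = y.
    have [y0|y0] := leP 0 y; rewrite ?mulrN mulrA mq.
      by rewrite ger0_norm //; field.
    by rewrite ltr0_norm //; field.
  have [m11|m11] := eqVneq m 1.
    have := CQ (0 <= y); congr C; congr pair; last by rewrite -[RHS]sE m11 mul1r.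
    have yE : `|y| = q / 2 by move: mq; rewrite m11; lra.
    by move: v1 v2 v3 v4; have [y0|y0] := ger0P y; move: yE; rewrite ?(ger0_norm y0) ?(ltr0_norm y0) => ?; nra.
  have m2 : 0 < 1 - m by rewrite subr_gt0 lt_neqAle m11.
  have := @convex_between C (x / (1 - m), 0) (0, if 0 <= y then q / 2 else - (q / 2)) m cvC _ _ (CQ _).
  have -> : between m (x / (1 - m), 0) (0, if 0 <= y then q / 2 else - (q / 2)) = (x, y).
    rewrite /between /= sE mulr0 addr0 mulr0 add0r mulrC divfK //; exact: lt0r_neq0.
  apply; first by rewrite m0.
  apply: Cx; rewrite ler_pdivlMr // ler_pdivrMr // /x0.
  suff : `|x| <= 2^-1 * (1 - m) by rewrite ler_norml mulNr.
  rewrite -(ler_pM2l q0).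
  have -> : q * (2^-1 * (1 - m)) = (q - m * q) / 2 by field.
  rewrite mq.
  have [x0'|x0'] := ger0P x; have [y0|y0] := ger0P y; lra.
apply; split; first by split; [exact: closed_V|exact: (convex_set_cvx cvx_V)].
by move=> _ [[[->|->]|->]|->]; apply/VP => /=; split; lra.
Qed.

Lemma V_d2 z z' : V z -> V z' -> d2 z z' <= 2.
Proof.
have [q0 qp1 qp2 q2 q3] := pq_facts; have [p1 p2] := p_bounds.
move=> /VP[a1 a2 a3 a4] /VP[b1 b2 b3 b4].
have q1 : q <= 1 by nra.
have x1 : z.1 - z'.1 <= 1 by nra.
have x2 : - 1 <= z.1 - z'.1 by nra.
have y1 : z.2 - z'.2 <= 1 by nra.
have y2 : - 1 <= z.2 - z'.2 by nra.
by rewrite /d2; nra.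
Qed.

Lemma phi_comp_V w k z : V z -> V (phi_comp p w k z).
Proof. by elim: k z => [//|k IH] z Vz /=; apply: IH; exact: phi_V. Qed.

Lemma d2_phi_comp w k z z' :
  d2 (phi_comp p w k z) (phi_comp p w k z') = (p ^+ 2) ^+ k * d2 z z'.
Proof.
elim: k z z' => [|k IH] z z' /=; first by rewrite mul1r.
by rewrite IH d2_phi mulrA -exprSr.
Qed.

Lemma phi_comp_shift w k z : phi_comp p w k.+1 z = phi p (w 0%N) (phi_comp p (stail w) k z).
Proof. by elim: k z => [//|k IH] z; rewrite [LHS]/= -IH. Qed.

Lemma p2_lt1 : 0 <= p ^+ 2 < 1.
Proof. by have [p1 p2] := p_bounds; rewrite sqr_ge0 /=; nra. Qed.

(** The k-th image of V has diameter of order p^k. *)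
Lemma nested_uniq w z z' : (forall k, (phi_comp p w k @` V) z) ->
  (forall k, (phi_comp p w k @` V) z') -> z = z'.
Proof.
move=> h h'; apply: d2_eq0; apply: (geometric_eq0 p2_lt1 (d2_ge0 _ _)) => k.
have [u Vu <-] := h k; have [u' Vu' <-] := h' k.
rewrite d2_phi_comp mulrC; apply: ler_wpM2r (V_d2 Vu Vu'); apply: exprn_ge0.
by have /andP[] := p2_lt1.
Qed.

Lemma phi_continuous a : continuous (phi p a).
Proof.
have -> : phi p a = sim (phi_m a) (phi_t a) by apply/funext => z; exact: phi_sim.
exact: sim_continuous.
Qed.

Lemma phi_comp_continuous w k : continuous (phi_comp p w k).
Proof.
elim: k => [|k IH] z /=; first exact: cvg_id.
by apply: continuous_comp; [exact: phi_continuous|exact: IH].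
Qed.

Lemma compact_V : compact V.
Proof.
apply: (@subclosed_compact _ _ (`[(-1 : R), 1]%classic `*` `[(-1 : R), 1]%classic)); first exact: closed_V.
  by apply: compact_setX; exact: segment_compact.
have [q0 qp1 qp2 q2 q3] := pq_facts; have [p1 p2] := p_bounds.
move=> z /VP[a1 a2 a3 a4]; have q1 : q <= 1 by nra.
by split; rewrite /= in_itv /=; apply/andP; split; nra.
Qed.

(** A cluster point of the images of the origin, by compactness of V. *)
Lemma nested_nonempty w : exists z, forall k, (phi_comp p w k @` V) z.
Proof.
have V0 : V (0, 0) by apply/VP => /=; have := q_gt0; split; lra.
(* the sequence stays in the k-th image from the index k on *)
pose x k := phi_comp p w k (0, 0).
have [|c [Vc cl]] := @compact_V (x @ \oo) _; first by exists 0%N => // k _; exact: phi_comp_V.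
exists c => k.
have comK : compact (phi_comp p w k @` V).
  by apply: continuous_compact; [apply: continuous_subspaceT; exact: phi_comp_continuous|exact: compact_V].
have clK : closed (phi_comp p w k @` V).
  by apply: compact_closed => //; exact: norm_hausdorff.
apply: clK => B Bc; apply: cl => //.
exists k => // j /= kj; rewrite /x -(subnK kj) addnC.
exists (phi_comp p (fun i => w (k + i)%N) (j - k) (0, 0)); first exact: phi_comp_V.
elim: (j - k)%N (0, 0) => [|m IH] z /=; first by rewrite addn0.
by rewrite addnS /= IH.
Qed.

Lemma coding_point_in w k : (phi_comp p w k @` V) (coding_point p w).
Proof.
have [z hz] := nested_nonempty w.
have : (\bigcap_k (phi_comp p w k.+1 @` rhombus p)) (coding_point p w).
  by apply: getPex; exists z => j _; rewrite rhombusE.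
rewrite rhombusE => /(_ k I) [u Vu <-].
by exists (phi p (w k) u) => //; exact: phi_V.
Qed.

Lemma coding_point_uniq w z : (forall k, (phi_comp p w k @` V) z) -> coding_point p w = z.
Proof. by move=> h; apply: (nested_uniq (coding_point_in w) h). Qed.

Lemma coding_point_V w : V (coding_point p w).
Proof. by have [u Vu <-] := coding_point_in w 0. Qed.

Lemma coding_point_shift w : coding_point p w = phi p (w 0%N) (coding_point p (stail w)).
Proof.
apply: coding_point_uniq => -[|k]; first by exists (phi p (w 0%N) (coding_point p (stail w))) => //; apply/phi_V/coding_point_V.
have [u Vu <-] := coding_point_in (stail w) k.
by exists u => //; rewrite phi_comp_shift.
Qed.

End Coding.

(** * The parameterisation of a curve *)

Section Path.
Implicit Types (z : R * R) (a : letter) (w : nat -> letter).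

(** The two ends of every curve. *)
Definition Pm : R * R := (- 2^-1, 0).
Definition Pp : R * R := (2^-1, 0).

Lemma phi_Pm e : phi p (ord0, e) Pm = Pm.
Proof. by rewrite /phi /=; congr pair; field. Qed.

Lemma phi_Pp e : phi p (ord_max, e) Pp = Pp.
Proof. by rewrite /phi /=; congr pair; field. Qed.

(** Consecutive copies of the curve share an end point, so the curve is connected. *)
Lemma phi_joint (a b : 'I_4) e : (b = a.+1 :> nat) -> phi p (a, e) Pp = phi p (b, e) Pm.
Proof.
by case: a b => -[|[|[|[|//]]]] ? [] [|[|[|[|//]]]] //= ? _; case: e; congr pair; field.
Qed.

Lemma V_Pm : V Pm. Proof. by have q0 := q_gt0; apply/VP => /=; split; lra. Qed.
Lemma V_Pp : V Pp. Proof. by have q0 := q_gt0; apply/VP => /=; split; lra. Qed.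

Local Notation cp := (coding_point p).

Lemma coding_omega u s : cp (omega u s) = phi p (u 0%N, sign0 s) (cp (omega (stail u) (sub s (u 0%N)))).
Proof. by rewrite coding_point_shift omega0 omega_shift. Qed.

Lemma coding_max u s : (forall k, u k = ord_max) -> cp (omega u s) = Pp.
Proof.
move=> uE; apply: coding_point_uniq => k; exists Pp; first exact: V_Pp.
elim: k => [//|k IH]; change (phi_comp p (omega u s) k (phi p (omega u s k) Pp) = Pp).
by rewrite (_ : omega u s k = (ord_max, (omega u s k).2)) ?phi_Pp // /omega uE.
Qed.

Lemma coding_min u s : (forall k, u k = ord0) -> cp (omega u s) = Pm.
Proof.
move=> uE; apply: coding_point_uniq => k; exists Pm; first exact: V_Pm.
elim: k => [//|k IH]; change (phi_comp p (omega u s) k (phi p (omega u s k) Pm) = Pm).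
by rewrite (_ : omega u s k = (ord0, (omega u s k).2)) ?phi_Pm // /omega uE.
Qed.

Lemma d2_phi_le (C : R) n a z z' : d2 z z' <= C * (p ^+ 2) ^+ n ->
  d2 (phi p a z) (phi p a z') <= C * (p ^+ 2) ^+ n.+1.
Proof.
by move=> h; rewrite d2_phi (exprS (p ^+ 2)) mulrCA ler_wpM2l // sqr_ge0.
Qed.

(** As long as the first digits agree both points stay in the same copy, and everything is
scaled down.  When they differ, the tails expand 1 and 0, and the points are the
common end of two consecutive copies. *)
Lemma coding_expansion u u' s (t : R) : base4_expansion u t -> base4_expansion u' t ->
  cp (omega u s) = cp (omega u' s).
Proof.
move=> h h'; apply: d2_eq0; apply: (geometric_eq0 p2_lt1 (d2_ge0 _ _)) => k.
elim: k u u' s t h h' => [|k IH] u u' s t h h'.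
  by rewrite mulr1; apply: V_d2; exact: coding_point_V.
have /andP[a1 a2] := expansion_range (expansion_shift h).
have /andP[b1 b2] := expansion_range (expansion_shift h').
have [e|ne] := eqVneq (u 0%N) (u' 0%N).
  rewrite (coding_omega u) (coding_omega u') -e; apply: d2_phi_le.
  by apply: IH (expansion_shift h) _; rewrite e; exact: expansion_shift.
have C0 : 0 <= 2 * (p ^+ 2) ^+ k.+1 by rewrite mulr_ge0 // exprn_ge0 // sqr_ge0.
have main v v' : base4_expansion v t -> base4_expansion v' t ->
    (v 0 < v' 0)%N -> cp (omega v s) = cp (omega v' s).
  move=> hv hv' vv'.
  have /andP[c1 c2] := expansion_range (expansion_shift hv).
  have /andP[d1 d2] := expansion_range (expansion_shift hv').
  have r1 : ((v 0%N).+1)%:R <= (v' 0%N)%:R :> R by rewrite ler_nat.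
  rewrite -natr1 in r1.
  have e1 : 4 * t - (v 0%N)%:R = 1 by lra.
  have e2 : 4 * t - (v' 0%N)%:R = 0 by lra.
  have n1 : (v' 0%N = (v 0%N).+1 :> nat).
    by apply/eqP; rewrite -(eqr_nat R) -natr1; apply/eqP; lra.
  rewrite (coding_omega v) (coding_omega v') coding_max; last first.
    by have hS := expansion_shift hv; rewrite e1 in hS; exact: expansion_of_1 hS.
  rewrite coding_min; last by have hS := expansion_shift hv'; rewrite e2 in hS; exact: expansion_of_0 hS.
  exact: phi_joint.
have [l|l|l] := ltngtP (u 0%N) (u' 0%N).
- by rewrite (main _ _ h h' l) /d2 !subrr expr0n addr0.
- by rewrite (main _ _ h' h l) /d2 !subrr expr0n addr0.
- by move: ne; rewrite -val_eqE /= l eqxx.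
Qed.

Lemma koch_path_expansion s u (t : R) : base4_expansion u t -> koch_path p s t = cp (omega u s).
Proof.
move=> h; rewrite /koch_path.
have : [set cp (omega u s) | u in [set u | base4_expansion u t]]
    (get [set cp (omega u s) | u in [set u | base4_expansion u t]]).
  by apply: getPex; exists (cp (omega u s)), u.
by case=> u' h' <-; exact: coding_expansion h' h.
Qed.

Lemma koch_path_V s (t : R) : 0 <= t <= 1 -> V (koch_path p s t).
Proof. by move=> /expansion_exists[u h]; rewrite (koch_path_expansion s h); exact: coding_point_V. Qed.

Lemma koch_path_phi s (a : 'I_4) (t : R) : 0 <= 4 * t - a%:R <= 1 ->
  koch_path p s t = phi p (a, sign0 s) (koch_path p (sub s a) (4 * t - a%:R)).
Proof.
move=> /expansion_exists[u h]; rewrite (koch_path_expansion _ h).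
by rewrite (koch_path_expansion _ (expansion_cons h)) coding_omega.
Qed.

Lemma koch_path0 s : koch_path p s 0 = Pm.
Proof.
rewrite (@koch_path_expansion _ (fun=> ord0)) ?coding_min //.
by apply: (@digits_expansion _ _ _ (fun=> 0)) => // k; rewrite ?lexx ?ler01 // mulr0 subr0.
Qed.

Lemma koch_path1 s : koch_path p s 1 = Pp.
Proof.
rewrite (@koch_path_expansion _ (fun=> ord_max)) ?coding_max //.
by apply: (@digits_expansion _ _ _ (fun=> 1)) => // k; rewrite ?lexx ?ler01 //=; ring.
Qed.

Lemma koch_curve_path s : koch_curve p s = koch_path p s @` `[0, 1].
Proof.
apply/seteqP; split=> [_ [u _ <-]|_ [t t01 <-]].
  have [t h] := @series4_cvg R u; exists t; last exact: koch_path_expansion.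
  by rewrite /= in_itv /=; exact: expansion_range h.
rewrite /= in_itv /= in t01; have [u h] := expansion_exists t01.
by exists u => //; rewrite (koch_path_expansion _ h).
Qed.

Lemma koch_path_near0 n s (t : R) : 0 <= t -> t <= (4^-1) ^+ n ->
  d2 (koch_path p s t) Pm <= 2 * (p ^+ 2) ^+ n.
Proof.
elim: n s t => [|n IH] s t t0 tn.
  by rewrite mulr1; apply: V_d2; [apply: koch_path_V; rewrite t0|exact: V_Pm].
have t4 : 4 * t <= (4^-1) ^+ n by rewrite -ler_pdivlMl // -exprS.
have n1 : (4^-1 : R) ^+ n <= 1 by rewrite exprn_ile1 // ?invr_ge0 // invf_le1 // ler1n.
rewrite (@koch_path_phi s ord0 t); last by rewrite subr0; apply/andP; split; lra.
rewrite -[in X in d2 _ X](phi_Pm (sign0 s)) subr0; apply: d2_phi_le.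
by apply: IH => //; lra.
Qed.

Lemma koch_path_near1 n s (t : R) : t <= 1 -> 1 - t <= (4^-1) ^+ n ->
  d2 (koch_path p s t) Pp <= 2 * (p ^+ 2) ^+ n.
Proof.
elim: n s t => [|n IH] s t t1 tn.
  by rewrite mulr1; apply: V_d2; [apply: koch_path_V; rewrite expr0 in tn; apply/andP; split; lra|exact: V_Pp].
have t4 : 4 * (1 - t) <= (4^-1) ^+ n by rewrite -ler_pdivlMl // -exprS.
have n1 : (4^-1 : R) ^+ n <= 1 by rewrite exprn_ile1 // ?invr_ge0 // invf_le1 // ler1n.
rewrite (@koch_path_phi s ord_max t) /=; last by apply/andP; split; lra.
rewrite -[in X in d2 _ X](phi_Pp (sign0 s)); apply: d2_phi_le.
by apply: IH; lra.
Qed.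

Lemma d2_trans (x y z : R * R) : d2 x z <= 2 * d2 x y + 2 * d2 y z.
Proof.
have h (a b c : R) : (a - c) ^+ 2 <= 2 * (a - b) ^+ 2 + 2 * (b - c) ^+ 2.
  by have := sqr_ge0 (a - b - (b - c)); nra.
by rewrite /d2; have := h x.1 y.1 z.1; have := h x.2 y.2 z.2; lra.
Qed.

(** Times at distance at most 4^(-n) are in the same or in neighbouring copies of level n,
whose diameters are of order p^n. *)
Lemma koch_path_modulus n s (t t' : R) : 0 <= t -> t <= t' -> t' <= 1 -> t' - t <= (4^-1) ^+ n ->
  d2 (koch_path p s t) (koch_path p s t') <= 8 * (p ^+ 2) ^+ n.
Proof.
elim: n s t t' => [|n IH] s t t' t0 tt' t1 tn.
  rewrite mulr1; apply: le_trans (V_d2 _ _) _; try by apply: koch_path_V; apply/andP; split; lra.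
  lra.
have t4 : 4 * (t' - t) <= (4^-1) ^+ n by rewrite -ler_pdivlMl // -exprS.
have n1 : (4^-1 : R) ^+ n <= 1 by rewrite exprn_ile1 // ?invr_ge0 // invf_le1 // ler1n.
have [a a01] : exists a : 'I_4, 0 <= 4 * t - a%:R <= 1.
  by exists (digit t); apply: digit_range; apply/andP; split; lra.
have [h|h] := leP (4 * t' - a%:R) 1.
  move: a01 => /andP[a0 a1].
  rewrite (@koch_path_phi s a t) ?(@koch_path_phi s a t'); try by apply/andP; split; lra.
  by apply: d2_phi_le; apply: IH; lra.
move: a01 => /andP[a0 a1].
have [b ba] : exists b : 'I_4, b = a.+1 :> nat.
  have a3 : (a.+1 < 4)%N by rewrite -(ltr_nat R) -natr1; lra.
  by exists (Ordinal a3).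
have bE : b%:R = a%:R + 1 :> R by rewrite ba -natr1.
rewrite (@koch_path_phi s a t); last by apply/andP; split; lra.
rewrite (@koch_path_phi s b t'); last by rewrite bE; apply/andP; split; lra.
apply: le_trans (d2_trans _ (phi p (a, sign0 s) Pp) _) _.
have h1 := @koch_path_near1 n (sub s a) (4 * t - a%:R) a1 _.
have h2 := @koch_path_near0 n (sub s b) (4 * t' - b%:R) _ _.
have {}h1 : d2 (koch_path p (sub s a) (4 * t - a%:R)) Pp <= 2 * p ^+ 2 ^+ n by apply: h1; lra.
have {}h2 : d2 (koch_path p (sub s b) (4 * t' - b%:R)) Pm <= 2 * p ^+ 2 ^+ n by apply: h2; lra.
have d2C x y : d2 x y = d2 y x by rewrite /d2; ring.
have := @d2_phi_le _ _ (a, sign0 s) _ _ h1; have := @d2_phi_le _ _ (b, sign0 s) _ _ h2.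
rewrite -(phi_joint _ ba) => {}h2 {}h1; rewrite d2C in h2; lra.
Qed.

Lemma koch_path_continuous s : pcont (koch_path p s \o clamp 0 1).
Proof.
have key x (e : R) : 0 < e -> \forall y \near x,
    d2 (koch_path p s (clamp 0 1 x)) (koch_path p s (clamp 0 1 y)) < e.
  move=> e0.
  have [n hn] : exists n, 8 * (p ^+ 2) ^+ n < e.
    have : (fun k : nat => 8 * (p ^+ 2) ^+ k) @ \oo --> 8 * (0 : R).
      apply: cvgM; [exact: cvg_cst|apply: cvg_expr; have /andP[? ?] := p2_lt1].
      by rewrite ger0_norm.
    rewrite mulr0 => /cvgrPdist_lt/(_ _ e0)[n _ hn]; exists n.
    by have := hn n (leqnn n); rewrite sub0r normrN; apply: le_lt_trans; exact: ler_norm.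
  have n0 : 0 < (4^-1 : R) ^+ n by rewrite exprn_gt0 // invr_gt0.
  have := @continuous_clamp R 0 1 x; move=> /cvgrPdist_lt/(_ _ n0); apply: filterS => y.
  rewrite ltr_norml => /andP[h1 h2]; apply: le_lt_trans hn.
  have /andP[x0 x1] := @clamp_itv R 0 1 x ler01; have /andP[y0 y1] := @clamp_itv R 0 1 y ler01.
  have d2C u v : d2 u v = d2 v u by rewrite /d2; ring.
  have [xy|xy] := leP (clamp 0 1 x) (clamp 0 1 y).
    by apply: koch_path_modulus => //; lra.
  by rewrite d2C; apply: koch_path_modulus => //; lra.
have sq (a b : R) : `|a| ^+ 2 + b ^+ 2 < b ^+ 2 -> False by have := sqr_ge0 `|a|; lra.
split=> x; apply/cvgrPdist_lt => e e0; have e2 : 0 < e ^+ 2 by rewrite exprn_gt0.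
- have := key x _ e2; apply: filterS => y; rewrite /d2 => h.
  rewrite -(ltr_pXn2r (_ : 0 < 2)%N) ?nnegrE ?(ltW e0) // real_normK ?num_real //.
  by apply: le_lt_trans h; rewrite lerDl sqr_ge0.
- have := key x _ e2; apply: filterS => y; rewrite /d2 => h.
  rewrite -(ltr_pXn2r (_ : 0 < 2)%N) ?nnegrE ?(ltW e0) // real_normK ?num_real //.
  by apply: le_lt_trans h; rewrite lerDr sqr_ge0.
Qed.

End Path.

(** * The total angle of a curve around a point *)

Section Turning.
Implicit Types (z : R * R) (s : signs) (e : bool).

(** A point off the curve lies outside all rhombi after some finite number of
subdivisions, and this is the induction principle that goes with it. *)
Inductive clear : signs -> R * R -> Prop :=
| clear_out s z : ~ V z -> clear s z
| clear_sub s z : (forall a : 'I_4, clear (sub s a) (psi (a, sign0 s) z)) -> clear s z.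

Lemma clear_not_curve s z : clear s z -> ~ koch_curve p s z.
Proof.
elim=> {s z} [s z nV|s z _ IH] [u _ zE]; first by apply: nV; rewrite -zE; exact: coding_point_V.
apply: (IH (u 0%N)); exists (stail u) => //.
by rewrite -zE [in RHS](coding_omega u) phiK.
Qed.

(** If z is not [clear], one of the four smaller configurations is not either; iterating
this choice produces digits whose nested rhombi all contain z. *)
Lemma not_clear s z : ~ clear s z -> koch_curve p s z.
Proof.
pose ch (st : signs * (R * R)) : 'I_4 :=
  xget ord0 [set a | ~ clear (sub st.1 a) (psi (a, sign0 st.1) st.2)].
pose next st : signs * (R * R) := (sub st.1 (ch st), psi (ch st, sign0 st.1) st.2).
have chP (st : signs * (R * R)) : ~ clear st.1 st.2 -> ~ clear (next st).1 (next st).2.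
  move=> nc; rewrite /next /=.
  have : [set a | ~ clear (sub st.1 a) (psi (a, sign0 st.1) st.2)] (ch st); last by [].
  have [a na] : exists a, ~ clear (sub st.1 a) (psi (a, sign0 st.1) st.2).
    by apply/existsNP => h; apply: nc; exact: clear_sub.
  exact: (xgetI ord0 na).
have ncV s' z' : ~ clear s' z' -> V z'.
  by move=> nc; apply: contrapT => nV; apply: nc; exact: clear_out.
move=> nc.
pose u st k := ch (iter k next st).
exists (u (s, z)) => //; apply: coding_point_uniq => k.
exists (iter k next (s, z)).2.
  by apply: (ncV (iter k next (s, z)).1); elim: k => [//|k IH]; rewrite iterS; exact: chP.
elim: k s z {nc} => [//|k IH] s z; rewrite phi_comp_shift omega0 omega_shift iterSr.
have -> : stail (u (s, z)) = u (next (s, z)).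
  by apply/funext => j; rewrite /stail /u iterSr.
have -> : sub s (u (s, z) 0%N) = (next (s, z)).1 by [].
by rewrite [next (s, z)]surjective_pairing IH psiK.
Qed.

Lemma clearP s z : clear s z <-> ~ koch_curve p s z.
Proof.
split; first exact: clear_not_curve.
by move=> nk; apply: contrapT => nc; apply: nk; exact: not_clear.
Qed.

Definition turn s z th := lift_on (koch_path p s) 0 1 z th.

Lemma turn_turns s z th : turn s z th -> turns (dsp z Pm) (dsp z Pp) th.
Proof. by move=> /(lift_on_turns ler01); rewrite koch_path0 koch_path1. Qed.

Lemma turn_out s z : ~ V z -> exists2 th, - pi < th < pi & turn s z th.
Proof.
move=> nV; apply: (lift_on_convex cvx_V nV ler01); first exact: koch_path_continuous.
exact: koch_path_V.
Qed.

Lemma phi_m_neq0 a : phi_m a != (0, 0).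
Proof. by have := phi_m_gt0 a; case: (phi_m a) => x y /= x0; apply: contraTneq x0 => -[-> _]; rewrite ltxx. Qed.

Lemma turn_phi s (a : 'I_4) e z th : turn (sub s a) (psi (a, e) z) th ->
  lift_on (phi p (a, e) \o koch_path p (sub s a)) 0 1 z th.
Proof.
move=> /(lift_on_sim (phi_t (a, e)) (phi_m_neq0 (a, e))).
have -> : sim (phi_m (a, e)) (phi_t (a, e)) = phi p (a, e).
  by apply/funext => w; rewrite phi_sim.
by rewrite psiK.
Qed.

Lemma turn_edge s (a : 'I_4) e z th : turn (sub s a) (psi (a, e) z) th ->
  turns (dsp z (phi p (a, e) Pm)) (dsp z (phi p (a, e) Pp)) th.
Proof. by move=> /turn_phi/(lift_on_turns ler01) /=; rewrite koch_path0 koch_path1. Qed.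

Lemma turn_quarter s (a : 'I_4) z th : turn (sub s a) (psi (a, sign0 s) z) th ->
  lift_on (koch_path p s) (a%:R / 4) (a%:R / 4 + 4^-1) z th.
Proof.
move=> /turn_phi h.
have {h} : lift_on (fun x => (phi p (a, sign0 s) \o koch_path p (sub s a)) (4 * x + (- a%:R)))
    (a%:R / 4) (a%:R / 4 + 4^-1) z th.
  apply: lift_on_affine => //.
  have -> : 4 * (a%:R / 4) + - a%:R = 0 :> R by field.
  by have -> : 4 * (a%:R / 4 + 4^-1) + - a%:R = 1 :> R by field.
apply: lift_on_eq => x /andP[h1 h2]; rewrite [RHS](@koch_path_phi s a) //.
by apply/andP; split; lra.
Qed.

(** The four quarters of the path are glued; the total angle of a quarter around z is the
total angle of the smaller curve around the pulled back point, as similarities that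
preserve the orientation preserve angles. *)
Lemma turn_sub s z (th : 'I_4 -> R) :
  (forall a : 'I_4, turn (sub s a) (psi (a, sign0 s) z) (th a)) ->
  turn s z (\sum_(a < 4) th a).
Proof.
move=> h; have {}h a := turn_quarter (h a).
have h0 := h ord0; have h1 := h (lift ord0 ord0); have h2 := h (lift ord0 (lift ord0 ord0)).
have h3 := h (lift ord0 (lift ord0 (lift ord0 ord0))).
rewrite /= mul0r add0r in h0.
rewrite !lift0 /= in h1 h2 h3.
rewrite !big_ord_recl big_ord0 addr0 !addrA.
have e1 : 1 / 4 + 4^-1 = 2 / 4 :> R by field.
have e2 : 2 / 4 + 4^-1 = 3 / 4 :> R by field.
have e3 : 3 / 4 + 4^-1 = 1 :> R by field.
rewrite /bump /= in h1 h2 h3.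
rewrite e1 mul1r in h1; rewrite e2 in h2; rewrite e3 in h3.
have c1 := lift_on_cat _ _ h0 h1.
have {}c1 : lift_on (koch_path p s) 0 (2 / 4) z (th ord0 + th (lift ord0 ord0)) by apply: c1; lra.
have c2 := lift_on_cat _ _ c1 h2.
have {}c2 : lift_on (koch_path p s) 0 (3 / 4) z (th ord0 + th (lift ord0 ord0) + th (lift ord0 (lift ord0 ord0))) by apply: c2; lra.
have c3 := lift_on_cat _ _ c2 h3.
by apply: c3; lra.
Qed.

Lemma clear_turn s z : clear s z -> exists th, turn s z th.
Proof.
elim=> {s z} [s z /(turn_out s)[th _ h]|s z _ IH]; first by exists th.
have [th h] := choice IH; exists (\sum_(a < 4) th a); exact: turn_sub.
Qed.

(** The tent is the polygon through the ends of the four copies.  [over_tent] and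
[under_tent] describe the two sides of the tent that points up; for e = true the
tent points down and the two are exchanged by the reflection. *)
Definition over_tent z := 0 < z.2 /\ q * ((1 - 2 * p) / 2 - `|z.1|) < (1 - 2 * p) * z.2.
Definition under_tent z := z.2 < 0 \/ (1 - 2 * p) * z.2 < q * ((1 - 2 * p) / 2 - `|z.1|).
Definition above e z := if e then under_tent (mirror z) else over_tent z.
Definition below e z := if e then over_tent (mirror z) else under_tent z.

Lemma above_below e z : above e z -> below e z -> False.
Proof.
have ou z' : over_tent z' -> under_tent z' -> False by move=> [h1 h2] [h3|h4]; lra.
case: e => /= h1 h2; exact: ou h2 h1 || exact: ou h1 h2.
Qed.

Lemma phi_mirror (a : 'I_4) e z : phi p (a, ~~ e) (mirror z) = mirror (phi p (a, e) z).
Proof.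
by case: z => x y; case: a => -[|[|[|[|//]]]] ?; case: e; rewrite /phi /mirror /=; congr pair; field.
Qed.

Lemma psi_mirror (a : 'I_4) e z : psi (a, ~~ e) (mirror z) = mirror (psi (a, e) z).
Proof. by apply: (can_inj (phiK (a, ~~ e))); rewrite psiK phi_mirror psiK. Qed.

Lemma V_mirror z : V (mirror z) <-> V z.
Proof. by rewrite /V /= normrN. Qed.

Lemma dsp_mirror z u : dsp (mirror z) (mirror u) = mirror (dsp z u).
Proof. by rewrite /dsp /mirror /=; congr pair; ring. Qed.

(** An edge of the tent is seen from above whenever the vertical line through z meets it. *)
Lemma over_edge (a : 'I_4) z : over_tent z -> - 2^-1 < z.1 < 2^-1 ->
  (phi p (a, false) Pm).1 - z.1 <= 0 <= (phi p (a, false) Pp).1 - z.1 ->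
  0 < crs (dsp z (phi p (a, false) Pm)) (dsp z (phi p (a, false) Pp)).
Proof.
have [q0 qp1 qp2 q2 q3] := pq_facts; have [p1 p2] := p_bounds.
case: z => x y [/= y0 h] _; case: a => -[|[|[|[|//]]]] ? /=; rewrite /crs /dsp /phi /Pm /Pp /= => /andP[x1 x2].
- nra.
- have : x <= 0 by lra.
  move=> x0; rewrite (ler0_norm x0) in h; nra.
- have : 0 <= x by lra.
  move=> x0; rewrite (ger0_norm x0) in h; nra.
- nra.
Qed.

Lemma under_edge (a : 'I_4) z : under_tent z -> - 2^-1 < z.1 < 2^-1 ->
  (phi p (a, false) Pm).1 - z.1 <= 0 <= (phi p (a, false) Pp).1 - z.1 ->
  crs (dsp z (phi p (a, false) Pm)) (dsp z (phi p (a, false) Pp)) < 0.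
Proof.
have [q0 qp1 qp2 q2 q3] := pq_facts; have [p1 p2] := p_bounds.
case: z => x y h _; case: a => -[|[|[|[|//]]]] ? /=; rewrite /crs /dsp /phi /Pm /Pp /= => /andP[x1 x2].
- have y0 : y < 0.
    case: h => //= h; have : x <= 0 by lra.
    by move=> x0; rewrite (ler0_norm x0) in h; nra.
  nra.
- have : x <= 0 by lra.
  move=> x0; have {}h : (1 - 2 * p) * y < q * ((1 - 2 * p) / 2 + x).
    by case: h => /= h; [nra|move: h; rewrite (ler0_norm x0); lra].
  nra.
- have : 0 <= x by lra.
  move=> x0; have {}h : (1 - 2 * p) * y < q * ((1 - 2 * p) / 2 - x).
    by case: h => /= h; [nra|move: h; rewrite (ger0_norm x0); lra].
  nra.
- have y0 : y < 0.
    case: h => //= h; have : 0 <= x by lra.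
    by move=> x0; rewrite (ger0_norm x0) in h; nra.
  nra.
Qed.

Lemma mirror_P : mirror Pm = Pm :> R * R /\ mirror Pp = Pp :> R * R.
Proof. by rewrite /mirror /Pm /Pp /= oppr0. Qed.

Lemma edge_mirror (a : 'I_4) z :
  crs (dsp z (phi p (a, true) Pm)) (dsp z (phi p (a, true) Pp)) =
  - crs (dsp (mirror z) (phi p (a, false) Pm)) (dsp (mirror z) (phi p (a, false) Pp)).
Proof.
have [m1 m2] := mirror_P.
rewrite -crs_mirror -!dsp_mirror mirrorK -!phi_mirror m1 m2 //.
Qed.

Lemma phi1_sign (a : 'I_4) : (phi p (a, true) Pm).1 = (phi p (a, false) Pm).1 /\
  (phi p (a, true) Pp).1 = (phi p (a, false) Pp).1.
Proof. by case: a => -[|[|[|[|//]]]] ?; rewrite /phi /Pm /Pp /=; split; ring. Qed.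

Lemma above_edge (a : 'I_4) e z : above e z -> - 2^-1 < z.1 < 2^-1 ->
  (phi p (a, e) Pm).1 - z.1 <= 0 <= (phi p (a, e) Pp).1 - z.1 ->
  0 < crs (dsp z (phi p (a, e) Pm)) (dsp z (phi p (a, e) Pp)).
Proof.
case: e => /= [h x12|]; last exact: over_edge.
have [-> ->] := phi1_sign a; rewrite edge_mirror oppr_gt0 => hx.
exact: (@under_edge a (mirror z)).
Qed.

Lemma below_edge (a : 'I_4) e z : below e z -> - 2^-1 < z.1 < 2^-1 ->
  (phi p (a, e) Pm).1 - z.1 <= 0 <= (phi p (a, e) Pp).1 - z.1 ->
  crs (dsp z (phi p (a, e) Pm)) (dsp z (phi p (a, e) Pp)) < 0.
Proof.
case: e => /= [h x12|]; last exact: under_edge.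
have [-> ->] := phi1_sign a; rewrite edge_mirror oppr_lt0 => hx.
exact: (@over_edge a (mirror z)).
Qed.

Let o1 : 'I_4 := lift ord0 ord0.
Let o2 : 'I_4 := lift ord0 (lift ord0 ord0).
Let o3 : 'I_4 := lift ord0 (lift ord0 (lift ord0 ord0)).

Lemma tent_vertices e : [/\ (phi p (ord0, e) Pm).1 = - 2^-1,
  (phi p (ord0, e) Pp).1 = - ((1 - 2 * p) / 2), (phi p (o1, e) Pp).1 = 0,
  (phi p (o2, e) Pp).1 = (1 - 2 * p) / 2 & (phi p (o3, e) Pp).1 = 2^-1].
Proof. by case: e; rewrite /phi /Pm /Pp /=; split; field. Qed.

(** A point above the tent sees its four edges turn to the left: the vertices move to the
right, so [graph_turns_above] applies. *)
Lemma tent_above e z (t : 'I_4 -> R) : above e z -> - 2^-1 < z.1 < 2^-1 ->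
  (forall a, - pi < t a < pi) ->
  (forall a : 'I_4, turns (dsp z (phi p (a, e) Pm)) (dsp z (phi p (a, e) Pp)) (t a)) ->
  0 < \sum_(a < 4) t a < 2 * pi.
Proof.
move=> ab x12 tb tt; rewrite !big_ord_recl big_ord0 addr0 !addrA.
have [q0 qp1 qp2 q2 q3] := pq_facts; have [p1 p2] := p_bounds.
have E (a : 'I_4) := @above_edge a e z ab x12.
have j1 : phi p (o1, e) Pm = phi p (ord0, e) Pp by rewrite -(@phi_joint ord0 o1).
have j2 : phi p (o2, e) Pm = phi p (o1, e) Pp by rewrite -(@phi_joint o1 o2).
have j3 : phi p (o3, e) Pm = phi p (o2, e) Pp by rewrite -(@phi_joint o2 o3).
have := tt o1; have := tt o2; have := tt o3; have := E o1; have := E o2; have := E o3.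
rewrite j1 j2 j3 => E3 E2 E1 T3 T2 T1.
move: x12 => /andP[x1 x2].
have [r0 r1 r2 r3 r4] := tent_vertices e.
apply: (@graph_turns_above _ (dsp z (phi p (ord0, e) Pm)) (dsp z (phi p (ord0, e) Pp))
   (dsp z (phi p (o1, e) Pp)) (dsp z (phi p (o2, e) Pp)) (dsp z (phi p (o3, e) Pp)));
  try by [exact: E ord0|exact: E1|exact: E2|exact: E3|exact: tb|exact: tt|exact: T1|exact: T2|exact: T3];
  rewrite /dsp /= ?r0 ?r1 ?r2 ?r3 ?r4; clear -x1 x2 p1 p2 hp; lra.
Qed.

Lemma tent_below e z (t : 'I_4 -> R) : below e z -> - 2^-1 < z.1 < 2^-1 ->
  (forall a, - pi < t a < pi) ->
  (forall a : 'I_4, turns (dsp z (phi p (a, e) Pm)) (dsp z (phi p (a, e) Pp)) (t a)) ->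
  - (2 * pi) < \sum_(a < 4) t a < 0.
Proof.
move=> ab x12 tb tt; rewrite !big_ord_recl big_ord0 addr0 !addrA.
have [q0 qp1 qp2 q2 q3] := pq_facts; have [p1 p2] := p_bounds.
have E (a : 'I_4) := @below_edge a e z ab x12.
have j1 : phi p (o1, e) Pm = phi p (ord0, e) Pp by rewrite -(@phi_joint ord0 o1).
have j2 : phi p (o2, e) Pm = phi p (o1, e) Pp by rewrite -(@phi_joint o1 o2).
have j3 : phi p (o3, e) Pm = phi p (o2, e) Pp by rewrite -(@phi_joint o2 o3).
have := tt o1; have := tt o2; have := tt o3; have := E o1; have := E o2; have := E o3.
rewrite j1 j2 j3 => E3 E2 E1 T3 T2 T1.
move: x12 => /andP[x1 x2].
have [r0 r1 r2 r3 r4] := tent_vertices e.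
apply: (@graph_turns_below _ (dsp z (phi p (ord0, e) Pm)) (dsp z (phi p (ord0, e) Pp))
   (dsp z (phi p (o1, e) Pp)) (dsp z (phi p (o2, e) Pp)) (dsp z (phi p (o3, e) Pp)));
  try by [exact: E ord0|exact: E1|exact: E2|exact: E3|exact: tb|exact: tt|exact: T1|exact: T2|exact: T3];
  rewrite /dsp /= ?r0 ?r1 ?r2 ?r3 ?r4; clear -x1 x2 p1 p2 hp; lra.
Qed.

(** A point on the tent lies on one of its four edges, which are the long diagonals of the
four small rhombi. *)
Lemma tent_cases e z : V z ->
  [\/ above e z, below e z | exists a : 'I_4, V (psi (a, e) z)].
Proof.
have [q0 qp1 qp2 q2 q3] := pq_facts; have [p1 p2] := p_bounds.
have main z' : V z' -> [\/ over_tent z', under_tent z' | exists a : 'I_4, V (psi (a, false) z')].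
  have seg (a : 'I_4) x : - 2^-1 <= x <= 2^-1 -> phi p (a, false) (x, 0) = z' -> 
      exists a : 'I_4, V (psi (a, false) z').
    move=> /andP[x1 x2] <-; exists a; rewrite phiK.
    by apply/VP => /=; split; nra.
  case: z' seg => x y seg /VP[/= v1 v2 v3 v4].
  have [y0|y0|y0] := ltrgtP y 0; first by apply: Or32; left.
    have [h|h|h] := ltrgtP ((1 - 2 * p) * y) (q * ((1 - 2 * p) / 2 - `|x|)).
    - by apply: Or32; right.
    - by apply: Or31.
    - apply: Or33; have c0 : 1 - 2 * p != 0 by rewrite gt_eqF //; lra.
      have yE : y = q * ((1 - 2 * p) / 2 - `|x|) / (1 - 2 * p) by rewrite -h; field.
      (* the point is the image of a point of the diagonal, found by solving for the abscissa *)
      have [x0|x0] := leP x 0.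
        rewrite (ler0_norm x0) in h yE.
        apply: (seg o1 (2^-1 + 2 * x / (1 - 2 * p))).
          have cp : 0 < 1 - 2 * p by lra.
          have h2 : - (1 - 2 * p) <= 2 * x by nra.
          apply/andP; split.
            suff : - 1 <= 2 * x / (1 - 2 * p) by lra.
            by rewrite ler_pdivlMr //; lra.
          suff : 2 * x / (1 - 2 * p) <= 0 by lra.
          by rewrite pmulr_lle0 ?invr_gt0 //; lra.
        by rewrite /phi /= yE; congr pair; field.
      rewrite (gtr0_norm x0) in h yE.
      apply: (seg o2 (- 2^-1 + 2 * x / (1 - 2 * p))).
        have cp : 0 < 1 - 2 * p by lra.
        have h2 : 2 * x <= (1 - 2 * p) by nra.
        apply/andP; split.
          suff : 0 <= 2 * x / (1 - 2 * p) by lra.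
          by rewrite divr_ge0 //; lra.
        suff : 2 * x / (1 - 2 * p) <= 1 by lra.
        by rewrite ler_pdivrMr //; lra.
      by rewrite /phi /= yE; congr pair; field.
  subst y; have pn0 : p != 0 by rewrite gt_eqF //; lra.
  have pp : 0 < p by lra.
  have [h|h] := ltP `|x| ((1 - 2 * p) / 2).
    by apply: Or32; right => /=; rewrite mulr0 mulr_gt0 // subr_gt0.
  apply: Or33; have [x0|x0] := leP x 0.
    rewrite (ler0_norm x0) in h.
    apply: (seg ord0 ((x + (1 - p) / 2) / p)).
      by rewrite ler_pdivlMr // ler_pdivrMr //; apply/andP; split; nra.
    by rewrite /phi /=; congr pair; field.
  rewrite (gtr0_norm x0) in h.
  apply: (seg o3 ((x - (1 - p) / 2) / p)).
    by rewrite ler_pdivlMr // ler_pdivrMr //; apply/andP; split; nra.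
  by rewrite /phi /=; congr pair; field.
case: e => Vz; last exact: main.
have /V_mirror Vm := Vz; case: (main _ Vm) => [h|h|[a Va]].
- exact: Or32.
- exact: Or31.
- by apply: Or33; exists a; apply/V_mirror; rewrite -psi_mirror.
Qed.

Lemma Vo_x z : Vo z -> - 2^-1 < z.1 < 2^-1.
Proof.
have [q0 qp1 qp2 q2 q3] := pq_facts.
by move=> /VoP[h1 h2 h3 h4]; apply/andP; split; nra.
Qed.

(** The abscissas of the vertices of the tent; they separate the four small rhombi. *)
Definition tent_break (k : nat) : R := nth 2^-1 [:: - 2^-1; - ((1 - 2 * p) / 2); 0; (1 - 2 * p) / 2] k.

Lemma phi_tent_break (a : 'I_4) e w : Vo w -> tent_break a < (phi p (a, e) w).1 < tent_break a.+1.
Proof.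
have [q0 qp1 qp2 q2 q3] := pq_facts; have [p1 p2] := p_bounds.
move=> Vw; have /andP[x1 x2] := Vo_x Vw.
have A c d f := @Vo_affine_lt c d f w Vw.
have B (x : R) (l r : R) : l - x < 0 -> x - r < 0 -> l < x < r by move=> *; apply/andP; split; lra.
case: a => -[|[|[|[|//]]]] ?; rewrite /tent_break /=; case: w x1 x2 A {Vw} => x y /= x1 x2 A.
- by rewrite /phi /=; apply/andP; split; nra.
- apply: B.
    have := A (- ((1 - 2 * p) / 2)) (if e then - (q / 2) else q / 2) (- ((1 - 2 * p) / 4)).
    by rewrite /phi /=; case: e => /= A'; (have {}A' := A' _ _ _ _ _; lra) || (apply: le_lt_trans (A' _ _ _ _ _); lra).
  have := A ((1 - 2 * p) / 2) (if e then q / 2 else - (q / 2)) (- ((1 - 2 * p) / 4)).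
  by rewrite /phi /=; case: e => /= A'; apply: le_lt_trans (A' _ _ _ _ _); lra.
- apply: B.
    have := A (- ((1 - 2 * p) / 2)) (if e then q / 2 else - (q / 2)) (- ((1 - 2 * p) / 4)).
    by rewrite /phi /=; case: e => /= A'; apply: le_lt_trans (A' _ _ _ _ _); lra.
  have := A ((1 - 2 * p) / 2) (if e then - (q / 2) else q / 2) (- ((1 - 2 * p) / 4)).
  by rewrite /phi /=; case: e => /= A'; apply: le_lt_trans (A' _ _ _ _ _); lra.
- by rewrite /phi /=; apply/andP; split; nra.
Qed.

Lemma tent_break_mono (a b : 'I_4) : (a < b)%N -> tent_break a.+1 <= tent_break b.
Proof.
have [p1 p2] := p_bounds.
by case: a b => -[|[|[|[|//]]]] ? [[|[|[|[|//]]]] ?] //= _; rewrite /tent_break /=; lra.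
Qed.

Lemma psi_disjoint (a b : 'I_4) e z : Vo (psi (a, e) z) -> Vo (psi (b, e) z) -> a = b.
Proof.
move=> Va Vb; have := @phi_tent_break a e _ Va; have := @phi_tent_break b e _ Vb; rewrite !psiK.
move=> /andP[b1 b2] /andP[a1 a2].
by have [l|l|/val_inj //] := ltngtP a b; exfalso; have := tent_break_mono l; lra.
Qed.

(** The diagonal of a small rhombus is an edge of the tent, and the rhombus does not reach
over the neighbouring edges, so within it the side of the tent is the side of the
diagonal. *)
Lemma phi_side (a : 'I_4) e w : Vo w -> w.2 != 0 ->
  (0 < w.2 -> above e (phi p (a, e) w)) /\ (w.2 < 0 -> below e (phi p (a, e) w)).
Proof.
have [q0 qp1 qp2 q2 q3] := pq_facts; have [p1 p2] := p_bounds.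
have main w' : Vo w' -> (0 < w'.2 -> over_tent (phi p (a, false) w')) /\ (w'.2 < 0 -> under_tent (phi p (a, false) w')).
  move=> Vw; have /andP[s1 s2] := @phi_tent_break a false _ Vw; have /andP[x1 x2] := Vo_x Vw.
  have A := @Vo_affine_lt (- (q / 2)) (- ((1 - 2 * p) / 2)) (- (q / 4)) w' Vw.
  have A' := @Vo_affine_lt (q / 2) (- ((1 - 2 * p) / 2)) (- (q / 4)) w' Vw.
  have pp : 0 < p * p by nra.
  case: w' Vw x1 x2 s1 s2 A A' => x y Vw /= x1 x2.
  case: a => -[|[|[|[|//]]]] ?; rewrite /tent_break /= => s1 s2 A A'; rewrite /over_tent /under_tent /=.
  - by rewrite ltr0_norm; [split=> y0; [split; nra|left; nra]|nra].
  - have z2 : 0 < 2^-1 * (q * x + (1 - 2 * p) * y) + q / 4.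
      by rewrite -oppr_lt0; apply: le_lt_trans (A _ _ _ _ _); lra.
    rewrite ltr0_norm //.
    split=> y0; [split=> //|right]; rewrite -subr_gt0.
      rewrite [X in 0 < X](_ : _ = ((1 - 2 * p) ^+ 2 + q * q) / 2 * y); last by field.
      by rewrite q2; nra.
    rewrite [X in 0 < X](_ : _ = - (((1 - 2 * p) ^+ 2 + q * q) / 2 * y)); last by field.
    by rewrite q2; nra.
  - have z2 : 0 < 2^-1 * (- q * x + (1 - 2 * p) * y) + q / 4.
      by rewrite -oppr_lt0; apply: le_lt_trans (A' _ _ _ _ _); lra.
    rewrite gtr0_norm //.
    split=> y0; [split=> //|right]; rewrite -subr_gt0.
      rewrite [X in 0 < X](_ : _ = ((1 - 2 * p) ^+ 2 + q * q) / 2 * y); last by field.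
      by rewrite q2; nra.
    rewrite [X in 0 < X](_ : _ = - (((1 - 2 * p) ^+ 2 + q * q) / 2 * y)); last by field.
    by rewrite q2; nra.
  - by rewrite gtr0_norm; [split=> y0; [split; nra|left; nra]|nra].
case: e => Vw w0; last exact: main.
have Vm : Vo (mirror w) by rewrite /Vo /= normrN.
have [h1 h2] := main _ Vm; rewrite /above /below -phi_mirror /=.
by split=> y0; [apply: h2 => /=; rewrite oppr_lt0|apply: h1 => /=; rewrite oppr_gt0].
Qed.

End Turning.

(** * Points below a curve *)

Section Sides.
Implicit Types (z : R * R) (s : signs) (e : bool).

(** The points at which the side of the curve is not decided by strict inequalities. *)
Definition seam : set (R * R) := [set z | V z /\ ~ (Vo z /\ z.2 != 0)].

Fixpoint seams (n : nat) s : set (R * R) :=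
  if n is n'.+1 then \bigcup_(a in [set: 'I_4]) (psi (a, sign0 s) @^-1` seams n' (sub s a))
  else seam.

Definition generic s z := forall n, ~ seams n s z.

Lemma generic_Vo s z : generic s z -> V z -> Vo z /\ z.2 != 0.
Proof. by move=> /(_ 0%N) h Vz; apply: contrapT => h2; apply: h. Qed.

Lemma generic_sub s z (a : 'I_4) : generic s z -> generic (sub s a) (psi (a, sign0 s) z).
Proof. by move=> h n hn; apply: (h n.+1); exists a. Qed.

Definition gap e : set (R * R) :=
  [set z | [/\ Vo z, below e z & forall a : 'I_4, ~ V (psi (a, e) z)]].

(** The points which are found to be below the curve after at most n subdivisions. *)
Fixpoint lower_ n s : set (R * R) :=
  if n is n'.+1 then
    gap (sign0 s) `|` \bigcup_(a in [set: 'I_4]) (psi (a, sign0 s) @^-1` lower_ n' (sub s a))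
  else set0.

(** The part of the open rhombus below the curve.  As a set this is only meaningful up to
the null set of the points that are not generic. *)
Definition lower s : set (R * R) := \bigcup_n lower_ n s.

Lemma lowerE s : lower s =
  gap (sign0 s) `|` \bigcup_(a in [set: 'I_4]) (psi (a, sign0 s) @^-1` lower (sub s a)).
Proof.
apply/seteqP; split=> [z [[//|n] _ /= [h|[a _ h]]]|z [h|[a _ [n _ h]]]].
- by left.
- by right; exists a => //; exists n.
- by exists 1%N => //; left.
- by exists n.+1 => //; right; exists a.
Qed.

Lemma lower_Vo s : lower s `<=` Vo.
Proof.
move=> z [n _]; elim: n s z => [//|n IH] s z /= [[]//|[a _ h]].
by rewrite -(psiK (a, sign0 s) z); apply: phi_Vo; exact: IH h.
Qed.

Lemma turns_add2pi (u v : R * R) th : turns u v th -> turns u v (th + 2 * pi).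
Proof.
move=> [k k0 ->]; exists k => //.
have -> : 2 * pi = pi *+ 2 :> R by rewrite mulr_natl.
by rewrite cosD2pi sinD2pi.
Qed.

(** The angle under which the diagonal of V is seen: positive from above, negative from
below. *)
Lemma base_angle (w : R * R) : w.2 != 0 -> let g := signed_angle (dsp w Pm) (dsp w Pp) in
  [/\ - pi < g < pi, turns (dsp w Pm) (dsp w Pp) g, 0 < w.2 -> 0 < g & w.2 < 0 -> g < 0].
Proof.
move=> w0 /=.
have pos : 0 < nrm (dsp w Pm) * nrm (dsp w Pp) + dot (dsp w Pm) (dsp w Pp).
  apply: not_opposite => l _; apply: contraNneq w0 => -[_ /= h2].
  by apply/eqP; move: h2; rewrite /dsp /Pm /Pp /=; lra.
have c : crs (dsp w Pm) (dsp w Pp) = w.2 by rewrite /crs /dsp /Pm /Pp /=; field.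
split; [exact: signed_angle_lt|exact: signed_angle_turns| |] => wp.
- by apply: signed_angle_gt0; rewrite ?c.
- by apply: signed_angle_lt0; rewrite ?c.
Qed.

Lemma turns_phi a z u v th : turns (dsp (psi a z) u) (dsp (psi a z) v) th ->
  turns (dsp z (phi p a u)) (dsp z (phi p a v)) th.
Proof.
move=> [k k0 e]; exists k => //.
have E u' : dsp z (phi p a u') = ((phi_m a).1 * (dsp (psi a z) u').1 - (phi_m a).2 * (dsp (psi a z) u').2,
    (phi_m a).2 * (dsp (psi a z) u').1 + (phi_m a).1 * (dsp (psi a z) u').2).
  by rewrite -{1}(psiK a z) !phi_sim /sim /dsp /=; congr pair; ring.
by rewrite !E e /=; congr pair; ring.
Qed.

Lemma Pm_neq (w : R * R) : w.2 != 0 -> dsp w Pm != (0, 0).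
Proof. by apply: contraNneq; rewrite /dsp /Pm /= sub0r => -[_ /eqP]; rewrite oppr_eq0. Qed.

(** By induction on [clear].  If z is in no small rhombus, the total angles of the four
copies are the angles under which the edges of the tent are seen, and [tent_above] or
[tent_below] gives the sum.  If z is in the a-th small rhombus, and hence in no other,
the same sum is compared with the true one: they differ only in the a-th term, where
the total angle of the small curve replaces the angle of its diagonal.  By induction
this is the angle of the diagonal itself when z is on the same side of both, and
otherwise that angle plus or minus 2 pi, which moves the sum to the other interval. *)
Lemma clear_angle s z : clear s z -> generic s z -> V z ->
  exists2 th, turn s z th &
    (lower s z /\ - (2 * pi) < th < 0) \/ (~ lower s z /\ 0 < th < 2 * pi).
Proof.
elim=> {s z} [s z nV _ //|s z _ IH gen Vz].
set e := sign0 s in IH *.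
have [Vzo z20] := generic_Vo gen Vz.
have x12 := Vo_x Vzo.
have genS a : generic (sub s a) (psi (a, e) z) by exact: generic_sub gen.
have [[a Va]|noV] := pselect (exists a : 'I_4, V (psi (a, e) z)); last first.
  have nV a : ~ V (psi (a, e) z) by move=> Va; apply: noV; exists a.
  have /choice[t ht] : forall a : 'I_4, exists x,
      - pi < x < pi /\ turn (sub s a) (psi (a, e) z) x.
    by move=> a; have [x xb xt] := turn_out (sub s a) (nV a); exists x.
  have tt a := turn_edge (ht a).2.
  exists (\sum_(a < 4) t a); first by apply: turn_sub => a; have [] := ht a.
  have nlow a : ~ lower (sub s a) (psi (a, e) z) by move=> /lower_Vo/Vo_V; exact: nV.
  have [ab|be|[a /nV //]] := tent_cases e Vz.
    right; split; last exact: tent_above ab x12 (fun a => (ht a).1) tt.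
    by rewrite lowerE => -[[_ be _]|[a _ /nlow //]]; exact: above_below ab be.
  left; split; last exact: tent_below be x12 (fun a => (ht a).1) tt.
  by rewrite lowerE; left.
set w := psi (a, e) z in Va.
have [Vwo w20] := generic_Vo (genS a) Va.
have nVb (b : 'I_4) : b != a -> ~ V (psi (b, e) z).
  move=> ba Vb; have [Vbo _] := generic_Vo (genS b) Vb.
  by move: ba; rewrite (psi_disjoint Vbo Vwo) eqxx.
have [tha turna dich] := IH a (genS a) Va.
(* T lists the total angles of the four copies, and t below replaces the a-th one by the
   angle g of its diagonal *)
pose T (b : 'I_4) : R := if b == a then tha else xget 0 [set x | - pi < x < pi /\ turn (sub s b) (psi (b, e) z) x].
have TP (b : 'I_4) : b != a -> - pi < T b < pi /\ turn (sub s b) (psi (b, e) z) (T b).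
  move=> ba; rewrite /T (negbTE ba).
  have [x xb xt] := turn_out (sub s b) (nVb b ba).
  exact: (@xgetI _ 0 [set x | - pi < x < pi /\ turn (sub s b) (psi (b, e) z) x] x).
have Tturn b : turn (sub s b) (psi (b, e) z) (T b).
  by have [->|/TP[]//] := eqVneq b a; rewrite /T eqxx.
have [gb gt gp gn] := base_angle w20.
set g := signed_angle _ _ in gb gt gp gn.
pose t (b : 'I_4) : R := if b == a then g else T b.
have tb b : - pi < t b < pi by rewrite /t; case: eqVneq => // /TP[].
have tt b : turns (dsp z (phi p (b, e) Pm)) (dsp z (phi p (b, e) Pp)) (t b).
  rewrite /t; case: eqVneq => [->|_]; first exact: turns_phi gt.
  exact: turn_edge (Tturn b).
have sumE : \sum_(b < 4) T b = \sum_(b < 4) t b - g + tha.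
  rewrite (bigD1 a) //= [in RHS](bigD1 a) //= /T /t !eqxx.
  rewrite [X in tha + X](eq_bigr (fun b => if b == a then g else if b == a then tha else xget 0 [set x | - pi < x < pi /\ turn (sub s b) (psi (b, e) z) x])).
    by ring.
  by move=> b /negbTE ->.
exists (\sum_(b < 4) T b); first exact: turn_sub.
have lowE : lower s z <-> lower (sub s a) w.
  rewrite lowerE; split=> [[[_ _ /(_ a)//]|[b _ h]]|h]; last by right; exists a.
  by have ba : b = a := psi_disjoint (lower_Vo h) Vwo; rewrite ba in h; exact: h.
have [above_z below_z] := @phi_side a e w Vwo w20; rewrite /w psiK -/w in above_z below_z.
have tg := turn_turns turna; rewrite -/w in tg.
have pi0 := pi_gt0 R.
have U x y : turns (dsp w Pm) (dsp w Pp) x -> turns (dsp w Pm) (dsp w Pp) y ->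
    `|x - y| < 2 * pi -> x = y by exact: turns_uniq (Pm_neq w20).
have [wn|wp|w0] := ltrgtP w.2 0; last by move: w20; rewrite -/w w0 eqxx.
- have /andP[s1 s2] := tent_below (below_z wn) x12 tb tt.
  have g0 := gn wn; move: gb => /andP[g1 g2].
  case: dich => -[lw /andP[t1 t2]]; [left|right]; (split; [by rewrite lowE|]).
    have e1 : tha = g by apply: (U _ _ tg gt); rewrite ltr_norml; apply/andP; split; lra.
    by rewrite sumE e1 subrK s1 s2.
  have e1 : tha = g + 2 * pi.
    by apply: (U _ _ tg (turns_add2pi gt)); rewrite ltr_norml; apply/andP; split; lra.
  by rewrite sumE e1; apply/andP; split; lra.
- have /andP[s1 s2] := tent_above (above_z wp) x12 tb tt.
  have g0 := gp wp; move: gb => /andP[g1 g2].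
  case: dich => -[lw /andP[t1 t2]]; [left|right]; (split; [by rewrite lowE|]).
    have e1 : tha + 2 * pi = g.
      by apply: (U _ _ (turns_add2pi tg) gt); rewrite ltr_norml; apply/andP; split; lra.
    by rewrite sumE -e1; apply/andP; split; lra.
  have e1 : tha = g by apply: (U _ _ tg gt); rewrite ltr_norml; apply/andP; split; lra.
  by rewrite sumE e1 subrK s1 s2.
Qed.
End Sides.

(** * The area below a curve *)

Section Areas.
Implicit Types (z : R * R) (s : signs) (e : bool).

Lemma muU (A B : set (R * R)) : meas A -> meas B -> A `&` B = set0 ->
  mu (A `|` B) = (mu A + mu B)%E.
Proof. exact: measureU. Qed.

(** Comparison of sets up to a null set that need not be measurable. *)
Lemma mu_eq_ae (A B N : set (R * R)) : meas A -> meas B -> mu.-negligible N ->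
  (forall z, ~ N z -> A z <-> B z) -> mu A = mu B.
Proof.
move=> mA mB [N' [mN' N'0 NN']] AB.
rewrite -(measureU0 mA mN' N'0) -(measureU0 mB mN' N'0); congr (mu _).
apply/seteqP; split=> z [h|h]; try by right.
- by have [n|n] := pselect (N z); [right; exact: NN'|left; apply/AB].
- by have [n|n] := pselect (N z); [right; exact: NN'|left; apply/AB].
Qed.

Lemma measurable_psi a (A : set (R * R)) : meas A -> meas (psi a @^-1` A).
Proof. by move=> mA; exact: (measurable_sim (psi_m a) (psi_t a) mA). Qed.

Lemma mu_psi a (A : set (R * R)) : meas A -> mu (psi a @^-1` A) = ((p ^+ 2)%:E * mu A)%E.
Proof.
move=> mA; have p0 := p_neq0.
have m0 : (psi_m a).1 != 0.
  by rewrite /psi_m /= mulf_neq0 // ?invr_neq0 ?expf_neq0 // gt_eqF // phi_m_gt0.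
have := lambda2_sim (psi_t a) m0 mA; rewrite -[sim _ _]/(psi a) => ->; congr (_%:E * _)%E.
rewrite /psi_m /= !exprMn sqrrN -mulrDl (phi_m_sqr a); field.
by [].
Qed.

Lemma negligible_psi a (N : set (R * R)) : mu.-negligible N -> mu.-negligible (psi a @^-1` N).
Proof.
move=> [A [mA A0 NA]]; exists (psi a @^-1` A); split; first exact: measurable_psi.
  by rewrite mu_psi // A0 mule0.
by move=> z; exact: NA.
Qed.

Lemma measurable_mirror (A : set (R * R)) : meas A -> meas (mirror @^-1` A).
Proof.
move=> /(measurable_affine_map 1 0 0 0 (-1) 0).
by congr (meas _); apply/seteqP; split => -[x y]; rewrite /mirror /= !mul0r mul1r mulN1r !addr0 add0r.
Qed.

Lemma mu_mirror (A : set (R * R)) : meas A -> mu (mirror @^-1` A) = mu A.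
Proof.
move=> mA; have := @lambda2_shear_y R (-1) 0 0 A; rewrite oppr_eq0 oner_eq0 => /(_ isT mA).
rewrite normrN normr1 invr1 mul1e => <-; congr (mu _).
by apply/seteqP; split => -[x y]; rewrite /mirror /= mul0r mulN1r addr0 add0r.
Qed.

Lemma negligible_graph (f : R -> R) : continuous f -> mu.-negligible [set z : R * R | z.2 = f z.1].
Proof.
move=> cf; have [|mG G0] := @lambda2_graph R f; first exact: continuous_measurable_fun.
by exists [set z : R * R | z.2 = f z.1]; split.
Qed.

Lemma negligible_seam : mu.-negligible seam.
Proof.
have cabs (a b : R) : continuous (fun x : R => a + b * `|x|).
  by move=> x; apply: cvgD; [exact: cvg_cst|apply: cvgM; [exact: cvg_cst|exact: norm_continuous]].
have n1 := negligible_graph (cabs (q / 2) (- q)).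
have n2 := negligible_graph (cabs (- (q / 2)) q).
have n3 := negligible_graph (cabs 0 0).
apply: negligibleS (negligibleU (negligibleU n1 n2) n3).
move=> z [Vz nz]; rewrite /V /= in Vz.
have [z0|z0] := eqVneq z.2 0; first by right; rewrite /= z0 mul0r addr0.
left; have nVo : ~ Vo z by move=> h; apply: nz; split.
rewrite /Vo /= in nVo; move/negP: nVo; rewrite -leNgt => nVo.
by have [y0|y0] := ger0P z.2; [left|right] => /=; move: Vz nVo; rewrite ?(ger0_norm y0) ?(ltr0_norm y0) => ? ?; lra.
Qed.

Lemma negligible_cup4 (F : 'I_4 -> set (R * R)) : (forall a, mu.-negligible (F a)) ->
  mu.-negligible (\bigcup_(a in [set: 'I_4]) F a).
Proof.
move=> nF.
have -> : \bigcup_(a in [set: 'I_4]) F a = \bigcup_(n : nat) (if insub n is Some a then F a else set0).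
  apply/seteqP; split=> [z [a _ h]|z [n _]].
    by exists (a : nat) => //; rewrite valK.
  by case: insubP => // a _ _ h; exists a.
by apply: negligible_bigcup => n; case: insubP => [a _ _|_]; [exact: nF|exact: negligible_set0].
Qed.

Lemma negligible_seams s : mu.-negligible (\bigcup_n seams n s).
Proof.
apply: negligible_bigcup => n; elim: n s => [|n IH] s /=; first exact: negligible_seam.
by apply: negligible_cup4 => a; apply: negligible_psi.
Qed.

Lemma generic_ae s z : ~ (\bigcup_n seams n s) z -> generic s z.
Proof. by move=> h n hn; apply: h; exists n. Qed.

Lemma open_under : open under_tent.
Proof.
have cl (f : R * R -> R) : continuous f -> open [set z | f z < 0].
  by move=> cf; apply: (@open_comp _ _ f [set x | x < 0]); [move=> z _; exact: cf|exact: open_lt].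
have -> : under_tent = [set z | z.2 < 0] `|`
   [set z | (1 - 2 * p) * z.2 - q * ((1 - 2 * p) / 2 - `|z.1|) < 0].
  by apply/seteqP; split=> z /= [h|h]; [left|right|left|right]; move: h => /=; lra.
apply: openU; apply: cl; first by move=> z; exact: cvg_snd.
move=> z; apply: cvgB; first by apply: cvgM; [exact: cvg_cst|exact: cvg_snd].
apply: cvgM; first exact: cvg_cst.
apply: cvgB; first exact: cvg_cst.
by apply: (@continuous_comp _ _ _ fst (fun x : R => `|x|)); [exact: cvg_fst|exact: norm_continuous].
Qed.

Lemma open_over : open over_tent.
Proof.
have cl (f : R * R -> R) : continuous f -> open [set z | f z < 0].
  by move=> cf; apply: (@open_comp _ _ f [set x | x < 0]); [move=> z _; exact: cf|exact: open_lt].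
have -> : over_tent = [set z | - z.2 < 0] `&`
   [set z | q * ((1 - 2 * p) / 2 - `|z.1|) - (1 - 2 * p) * z.2 < 0].
  by apply/seteqP; split=> z /= [h h']; split; move: h h' => /=; lra.
apply: openI; apply: cl; first by move=> z; apply: cvgN; exact: cvg_snd.
move=> z; apply: cvgB; last by apply: cvgM; [exact: cvg_cst|exact: cvg_snd].
apply: cvgM; first exact: cvg_cst.
apply: cvgB; first exact: cvg_cst.
by apply: (@continuous_comp _ _ _ fst (fun x : R => `|x|)); [exact: cvg_fst|exact: norm_continuous].
Qed.

Lemma open_Vo : open Vo.
Proof.
have -> : Vo = (fun z => `|z.2| + q * `|z.1| : R) @^-1` [set x | x < q / 2] by [].
apply: open_comp; last exact: open_lt.
move=> x _; apply: cvgD.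
  by apply: (@continuous_comp _ _ _ snd (fun x : R => `|x|)); [exact: cvg_snd|exact: norm_continuous].
apply: cvgM; first exact: cvg_cst.
by apply: (@continuous_comp _ _ _ fst (fun x : R => `|x|)); [exact: cvg_fst|exact: norm_continuous].
Qed.

Lemma measurable_Vo : meas Vo. Proof. exact: open_plane_measurable open_Vo. Qed.
Lemma measurable_over : meas over_tent. Proof. exact: open_plane_measurable open_over. Qed.
Lemma measurable_under : meas under_tent. Proof. exact: open_plane_measurable open_under. Qed.

Lemma measurable_V : meas V.
Proof.
have oV : open (~` V) by rewrite openC; exact: closed_V.
by rewrite -[V]setCK; apply: measurableC; exact: open_plane_measurable oV.
Qed.

Lemma measurable_below e : meas (below e).
Proof.
case: e; last exact: measurable_under.
exact: measurable_mirror measurable_over.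
Qed.

Lemma measurable_cup4 (F : 'I_4 -> set (R * R)) : (forall a, meas (F a)) ->
  meas (\bigcup_(a in [set: 'I_4]) F a).
Proof. by move=> mF; apply: fin_bigcup_measurable => //; exact: finite_finset. Qed.

Lemma measurable_gap e : meas (gap e).
Proof.
have -> : gap e = (Vo `&` below e) `\` \bigcup_(a in [set: 'I_4]) (psi (a, e) @^-1` V).
  apply/seteqP; split=> z.
    by move=> [h1 h2 h3]; split=> // -[a _ /h3].
  by move=> [[h1 h2] h3]; split=> // a Va; apply: h3; exists a.
apply: measurableD; first by apply: measurableI; [exact: measurable_Vo|exact: measurable_below].
by apply: measurable_cup4 => a; apply: measurable_psi; exact: measurable_V.
Qed.

Lemma measurable_lower s : meas (lower s).
Proof.
apply: bigcupT_measurable => n; elim: n s => [|n IH] s /=; first exact: measurable0.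
apply: measurableU; first exact: measurable_gap.
by apply: measurable_cup4 => a; apply: measurable_psi.
Qed.

Lemma mu_Vo_lty (A : set (R * R)) : meas A -> A `<=` Vo -> (mu A < +oo)%E.
Proof.
move=> mA AV.
pose B : set R := `[(-1 : R), 1]%classic.
have : (mu A <= mu (B `*` B))%E.
  have mB : meas (B `*` B) by apply: measurableX; exact: measurable_itv.
  apply: le_measure; rewrite ?inE //.
  move=> z /AV Vz; have /andP[x1 x2] := Vo_x Vz; have [q0 qp1 qp2 q2 q3] := pq_facts.
  have [p1 p2] := p_bounds; have q1 : q <= 1 by nra.
  have /VoP[a1 a2 a3 a4] := Vz.
  by split; rewrite /B /= in_itv /=; apply/andP; split; lra.
have mB : measurable (B : set mR) by exact: measurable_itv.
move=> /le_lt_trans; apply; rewrite product_measure1E //.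
rewrite -[X in (X < _)%E]/((lebesgue_measure B * lebesgue_measure B)%E) /B.
rewrite lebesgue_measure_itv /= lte_fin.
by case: ifP => _; rewrite -?EFinB -?EFinM ?mule0 ltry.
Qed.

Definition area (A : set (R * R)) : R := fine (mu A).

Lemma areaE (A : set (R * R)) : meas A -> A `<=` Vo -> mu A = (area A)%:E.
Proof.
move=> mA AV; rewrite fineK // ge0_fin_numE ?measure_ge0 //; exact: mu_Vo_lty.
Qed.

Lemma bigcup4 (F : 'I_4 -> set (R * R)) :
  \bigcup_(a in [set: 'I_4]) F a = \big[setU/set0]_(a < 4) F a.
Proof.
have := @bigcup_pred 'I_4 _ xpredT F.
have -> : [set` (xpredT : pred 'I_4)] = [set: 'I_4] by apply/seteqP; split.
by move=> ->; apply: eq_bigl.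
Qed.

(** The four images are disjoint from each other and from G, and each is scaled by p^2. *)
Lemma area_cup4 e (G : set (R * R)) (F : 'I_4 -> set (R * R)) :
  meas G -> G `<=` Vo -> (forall a, meas (F a)) -> (forall a, F a `<=` Vo) ->
  (forall z, G z -> forall a : 'I_4, ~ V (psi (a, e) z)) ->
  area (G `|` \bigcup_(a in [set: 'I_4]) (psi (a, e) @^-1` F a)) =
  area G + p ^+ 2 * \sum_(a < 4) area (F a).
Proof.
move=> mG GV mF FV Gdis.
have mP a : meas (psi (a, e) @^-1` F a) by exact: measurable_psi.
have mU : meas (\bigcup_(a in [set: 'I_4]) (psi (a, e) @^-1` F a)) by exact: measurable_cup4.
have PV (a : 'I_4) : psi (a, e) @^-1` F a `<=` Vo.
  by move=> z /= /FV Vz; rewrite -(psiK (a, e) z); exact: phi_Vo.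
rewrite /area muU //; last first.
  apply/seteqP; split=> z // -[Gz [a _ /= /FV/Vo_V]]; exact: Gdis.
have -> : mu (\bigcup_(a in [set: 'I_4]) (psi (a, e) @^-1` F a)) =
    (p ^+ 2 * \sum_(a < 4) area (F a))%:E.
  rewrite bigcup4 measure_bigsetU_ord //; last first.
    by move=> a b _ _ [z [/= /FV Va /FV Vb]]; exact: psi_disjoint Va Vb.
  rewrite mulr_sumr -sumEFin; apply: eq_bigr => a _.
  by rewrite -[LHS]/(mu (psi (a, e) @^-1` F a)) mu_psi // (areaE (mF a) (FV a)).
by rewrite (areaE mG GV) -EFinD /=.
Qed.

(** The part of V below the diagonal has [half_area]; [bump] is what is gained by replacing
the diagonal by a tent that points up. *)
Definition lower_half : set (R * R) := Vo `&` [set z | z.2 < 0].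
Definition half_area := area lower_half.
Definition bump := area (Vo `&` under_tent) - half_area.

Lemma measurable_neg : meas [set z : R * R | z.2 < 0].
Proof.
apply: open_plane_measurable; apply: (@open_comp _ _ snd [set x : R | x < 0]); last exact: open_lt.
by move=> z _; exact: cvg_snd.
Qed.

Lemma measurable_lower_half : meas lower_half.
Proof. by apply: measurableI; [exact: measurable_Vo|exact: measurable_neg]. Qed.

Lemma lower_half_Vo : lower_half `<=` Vo. Proof. by move=> z []. Qed.

Lemma area_eq_ae (A B N : set (R * R)) : meas A -> meas B -> mu.-negligible N ->
  (forall z, ~ N z -> A z <-> B z) -> area A = area B.
Proof. by move=> mA mB nN AB; rewrite /area (mu_eq_ae mA mB nN AB). Qed.

Lemma areaU (A B : set (R * R)) : meas A -> meas B -> A `<=` Vo -> B `<=` Vo ->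
  A `&` B = set0 -> area (A `|` B) = area A + area B.
Proof.
by move=> mA mB AV BV AB; rewrite /area muU // (areaE mA AV) (areaE mB BV).
Qed.

Lemma area_mirror (A : set (R * R)) : meas A -> area (mirror @^-1` A) = area A.
Proof. by move=> mA; rewrite /area mu_mirror. Qed.

Lemma mirror_Vo z : Vo (mirror z) <-> Vo z. Proof. by rewrite /Vo /= normrN. Qed.

Lemma negligible_axis : mu.-negligible [set z : R * R | z.2 = 0].
Proof. by apply: (@negligible_graph (fun=> 0)) => x; exact: cvg_cst. Qed.

Lemma area_Vo : area Vo = 2 * half_area.
Proof.
have mH := measurable_lower_half; have mmH := measurable_mirror mH.
have -> : area Vo = area (lower_half `|` mirror @^-1` lower_half).
  apply: (area_eq_ae measurable_Vo (measurableU _ _ mH mmH) negligible_axis) => z nz.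
  split=> [Vz|[[]//|[/mirror_Vo//]]].
  have [zn|zp|//] := ltrgtP z.2 0; first by left.
  by right; split; [apply/mirror_Vo|rewrite /= oppr_lt0].
rewrite areaU //.
- by rewrite area_mirror // /half_area; ring.
- exact: lower_half_Vo.
- by move=> z [/mirror_Vo].
- by apply/seteqP; split=> // z [[_ /= z1] [_ /= z2]]; lra.
Qed.

(** The points of V on neither side of the tent lie on the diagonal or on the graph of a
continuous function, hence in a null set. *)
Lemma area_under_over : area (Vo `&` under_tent) + area (Vo `&` over_tent) = 2 * half_area.
Proof.
have m1 := measurableI _ _ measurable_Vo measurable_under.
have m2 := measurableI _ _ measurable_Vo measurable_over.
have [p1 p2] := p_bounds.
have dj : (Vo `&` under_tent) `&` (Vo `&` over_tent) = set0.
  by apply/seteqP; split=> // z [[_ h1] [_ [h2 h3]]]; case: h1; lra.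
rewrite -area_Vo -(areaU m1 m2 (@subIsetl _ _ _) (@subIsetl _ _ _) dj).
have c0 : 1 - 2 * p != 0 by rewrite gt_eqF //; lra.
have cG : continuous (fun x : R => q / (1 - 2 * p) * ((1 - 2 * p) / 2 - `|x|)).
  by move=> x; apply: cvgM; [exact: cvg_cst|apply: cvgB; [exact: cvg_cst|exact: norm_continuous]].
apply/esym; apply: (area_eq_ae measurable_Vo (measurableU _ _ m1 m2)
   (negligibleU negligible_axis (negligible_graph cG))) => z nz.
split=> [Vz|[[]|[]]//].
have [zn|zp|z0] := ltrgtP z.2 0; last by case: nz; left.
  by left; split=> //; left.
have [h1|h1|h1] := ltrgtP ((1 - 2 * p) * z.2) (q * ((1 - 2 * p) / 2 - `|z.1|)).
- by left; split=> //; right.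
- by right.
- by case: nz; right => /=; rewrite mulrAC -h1; field.
Qed.

Lemma area_below e : area (Vo `&` below e) = half_area + sgn e * bump.
Proof.
case: e; last by rewrite /bump /= mul1r addrC subrK.
have -> : area (Vo `&` below true) = area (Vo `&` over_tent).
  rewrite -(area_mirror (measurableI _ _ measurable_Vo measurable_over)).
  by congr area; apply/seteqP; split=> z [/mirror_Vo h1 h2].
by have := area_under_over; rewrite /bump /=; lra.
Qed.

(** Up to a null set, the part of V below the tent is the gap together with the lower halves
of the four small rhombi. *)
Lemma area_gap e : area (gap e) = half_area + sgn e * bump - 4 * p ^+ 2 * half_area.
Proof.
have m1 := measurableI _ _ measurable_Vo (measurable_below e).
have gV : gap e `<=` Vo by move=> z [].
have := @area_cup4 e (gap e) (fun=> lower_half) (measurable_gap e) gV (fun=> measurable_lower_half) (fun=> lower_half_Vo).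
have -> : area (gap e `|` \bigcup_(a in [set: 'I_4]) (psi (a, e) @^-1` lower_half)) = area (Vo `&` below e).
  apply: (area_eq_ae _ m1 (N := \bigcup_(a in [set: 'I_4]) (psi (a, e) @^-1` seam))).
  - apply: measurableU; first exact: measurable_gap.
    by apply: measurable_cup4 => a; apply: measurable_psi; exact: measurable_lower_half.
  - by apply: negligible_cup4 => a; apply: negligible_psi; exact: negligible_seam.
  move=> z nz; split=> [[[]//|[a _ [/= Va ya]]]|[Vz bz]].
    rewrite -(psiK (a, e) z); split; first exact: phi_Vo.
    by have [|_] := @phi_side a e _ Va; [rewrite lt_eqF|apply].
  have [[a Va]|noV] := pselect (exists a : 'I_4, V (psi (a, e) z)); last first.
    by left; split=> // a Va; apply: noV; exists a.
  right; exists a => //.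
  have [Vwo w0] : Vo (psi (a, e) z) /\ (psi (a, e) z).2 != 0.
    by apply: contrapT => h0; apply: nz; exists a.
  split=> //=; have [//|yp|y0] := ltrgtP (psi (a, e) z).2 0; last by rewrite y0 eqxx in w0.
  have [ab _] := @phi_side a e _ Vwo w0; rewrite psiK in ab.
  by have := above_below (ab yp) bz.
rewrite area_below sumr_const card_ord -/half_area => H.
rewrite H; first by rewrite -[half_area *+ 4]mulr_natr; ring.
by move=> z [].
Qed.

(** By [lowerE] and [area_gap]; the terms in [half_area] cancel after subtracting it from
both sides, which leaves a recursion with source term the first sign. *)
Lemma area_lower s : area (lower s) - half_area =
  sgn (sign0 s) * bump + p ^+ 2 * \sum_(a < 4) (area (lower (sub s a)) - half_area).
Proof.
rewrite {1}lowerE area_cup4 //.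
- rewrite area_gap sumrB sumr_const card_ord -[half_area *+ 4]mulr_natr; ring.
- exact: measurable_gap.
- by move=> z [].
- by move=> a; exact: measurable_lower.
- by move=> a; exact: lower_Vo.
- by move=> z [].
Qed.

Lemma area_ge0 A : 0 <= area A.
Proof. exact: fine_ge0. Qed.

Lemma area_lower_bound s : `|area (lower s) - half_area| <= half_area.
Proof.
have : area (lower s) <= area Vo.
  rewrite /area fine_le //.
  - by rewrite (areaE (measurable_lower s) (@lower_Vo s)).
  - by rewrite (areaE measurable_Vo (@subset_refl _ Vo)).
  - by apply: le_measure; rewrite ?inE; [exact: measurable_lower|exact: measurable_Vo|exact: lower_Vo].
rewrite area_Vo => h1; have h0 := area_ge0 (lower s).
by rewrite ler_norml; apply/andP; split; lra.
Qed.

Fixpoint sign_sum (k : nat) s : R :=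
  if k is k'.+1 then \sum_(a < 4) sign_sum k' (sub s a) else sgn (sign0 s).

(** Unfolding [area_lower] n times; each unfolding multiplies the error by 4 p^2 < 1. *)
Lemma area_lower_approx n s :
  `|area (lower s) - half_area - bump * \sum_(k < n) (p ^+ 2) ^+ k * sign_sum k s| <= half_area * (4 * p ^+ 2) ^+ n.
Proof.
elim: n s => [|n IH] s; first by rewrite big_ord0 mulr0 subr0 mulr1 area_lower_bound.
have -> : area (lower s) - half_area - bump * \sum_(k < n.+1) (p ^+ 2) ^+ k * sign_sum k s =
    p ^+ 2 * \sum_(a < 4) (area (lower (sub s a)) - half_area -
       bump * \sum_(k < n) (p ^+ 2) ^+ k * sign_sum k (sub s a)).
  have -> : \sum_(k < n.+1) (p ^+ 2) ^+ k * sign_sum k s = sgn (sign0 s) +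
      p ^+ 2 * \sum_(i < n) \sum_(a < 4) (p ^+ 2) ^+ i * sign_sum i (sub s a).
    rewrite big_ord_recl; congr (_ + _); first by rewrite /= expr0 mul1r.
    rewrite mulr_sumr; apply: eq_bigr => i _.
    by rewrite lift0 /= (exprS (p ^+ 2)) -mulrA mulr_sumr.
  rewrite area_lower [in RHS]sumrB -[X in _ = _ * (_ - X)]mulr_sumr exchange_big /=.
  ring.
rewrite normrM ger0_norm ?sqr_ge0 //.
apply: le_trans (ler_wpM2l (sqr_ge0 p) (ler_norm_sum _ _ _)) _.
apply: le_trans (ler_wpM2l (sqr_ge0 p) (ler_sum _ (fun a _ => IH (sub s a)))) _.
rewrite sumr_const card_ord -[X in _ * X]mulr_natr (exprS (4 * p ^+ 2)).
by rewrite le_eqVlt; apply/orP; left; apply/eqP; ring.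
Qed.

End Areas.

(** * The interior of a snowflake *)

Section Snowflake.
Implicit Types (z : R * R) (s : signs) (e : bool).

Lemma lower_clear s z : generic s z -> lower s z -> clear s z.
Proof.
move=> gen [n _]; elim: n s z gen => [//|n IH] s z gen /= [[_ _ nV]|[a _ h]].
  by apply: clear_sub => a; apply: clear_out.
have genS b : generic (sub s b) (psi (b, sign0 s) z) by exact: generic_sub gen.
have Vo_a : Vo (psi (a, sign0 s) z) by apply: (@lower_Vo (sub s a)); exists n.
apply: clear_sub => b; have [->|ba] := eqVneq b a; first exact: IH h.
apply: clear_out => Vb; have [Vo_b _] := generic_Vo (genS b) Vb.
by move: ba; rewrite (psi_disjoint Vo_b Vo_a) eqxx.
Qed.

Local Notation r3 := (Num.sqrt 3 : R).

Lemma r3_sqr : r3 * r3 = 3. Proof. by rewrite -expr2 sqr_sqrtr. Qed.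
Lemma r3_gt0 : 0 < r3. Proof. by rewrite sqrtr_gt0. Qed.

Lemma side1_sim : @side1 R = sim (- 2^-1, - (r3 / 2)) (4^-1, - (r3 / 4)).
Proof. by apply/funext => -[x y]; rewrite /side1 /sim /=; congr pair; ring. Qed.

Lemma side2_sim : @side2 R = sim (- 2^-1, r3 / 2) (- 4^-1, - (r3 / 4)).
Proof. by apply/funext => -[x y]; rewrite /side2 /sim /=; congr pair; ring. Qed.

Lemma side12 : cancel (@side1 R) (@side2 R).
Proof.
move=> [x y]; rewrite /side1 /side2; have r := r3_sqr.
congr pair.
- transitivity (x / 4 + r3 * r3 / 4 * x - 2^-1 * 4^-1 + r3 * r3 / 8 - 4^-1); first by field.
  by rewrite r; field.
- transitivity (y / 4 + r3 * r3 / 4 * y); first by field.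
  by rewrite r; field.
Qed.

Lemma side21 : cancel (@side2 R) (@side1 R).
Proof.
move=> [x y]; rewrite /side1 /side2; have r := r3_sqr.
congr pair.
- transitivity (x / 4 + r3 * r3 / 4 * x + 2^-1 * 4^-1 - r3 * r3 / 8 + 4^-1); first by field.
  by rewrite r; field.
- transitivity (y / 4 + r3 * r3 / 4 * y); first by field.
  by rewrite r; field.
Qed.

Lemma side22 (z : R * R) : side2 (side2 z) = side1 z.
Proof.
case: z => x y; rewrite /side1 /side2; have r := r3_sqr.
congr pair.
- transitivity (x / 4 - r3 * r3 / 4 * x + r3 / 2 * y + 2^-1 * 4^-1 + r3 * r3 / 8 - 4^-1); first by field.
  by rewrite r; field.
- transitivity (y / 4 - r3 * r3 / 4 * y - r3 / 2 * x - r3 / 4); first by field.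
  by rewrite r; field.
Qed.

(** The maps [side1] and [side2] are the two rotations of the triangle, inverse to each
other. *)
Lemma side11 (z : R * R) : side1 (side1 z) = side2 z.
Proof. by rewrite -[RHS](side21 (side2 z)) side22. Qed.

(** The lower vertex of the triangle on the base from P- to P+. *)
Definition Pb : R * R := (0, - (r3 / 2)).

Lemma side1_Pm : side1 Pm = Pp :> R * R. Proof. by rewrite /side1 /Pm /Pp /=; congr pair; field. Qed.
Lemma side1_Pp : side1 Pp = Pb :> R * R. Proof. by rewrite /side1 /Pb /Pp /=; congr pair; field. Qed.
Lemma side2_Pm : side2 Pm = Pb :> R * R. Proof. by rewrite /side2 /Pm /Pb /=; congr pair; field. Qed.
Lemma side2_Pp : side2 Pp = Pm :> R * R. Proof. by rewrite /side2 /Pm /Pp /=; congr pair; field. Qed.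

Lemma Vo_side_neg z : Vo z -> (side1 z).2 < 0 /\ (side2 z).2 < 0.
Proof.
move=> Vz; have [q0 qp1 qp2 q2 q3] := pq_facts; have [p1 p2] := p_bounds.
have r := r3_sqr; have r0 := r3_gt0.
have q1 : q <= 1 by nra.
have r1 : 1 <= r3 by nra.
have A c d f := @Vo_affine_lt c d f z Vz.
case: z Vz A => x y Vz A; rewrite /side1 /side2 /=; split.
- have A' : - (r3 / 2) * x + - 2^-1 * y + - (r3 / 4) < 0 by apply: A; nra.
  by lra.
- have A' : r3 / 2 * x + - 2^-1 * y + - (r3 / 4) < 0 by apply: A; nra.
  by lra.
Qed.

(** The triangle is equilateral and the half angle of V at P- and P+ is at most 30 degrees,
because q <= 1 / sqrt 3; so the rhombi on two of its sides have disjoint interiors. *)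
Lemma Vo_side1 z : Vo z -> ~ Vo (side1 z).
Proof.
have [q0 qp1 qp2 q2 q3] := pq_facts; have [p1 p2] := p_bounds.
have r := r3_sqr; have r0 := r3_gt0.
have rq : r3 * q <= 1.
  have : (r3 * q) * (r3 * q) <= 1 * 1.
    by rewrite (_ : r3 * q * (r3 * q) = (r3 * r3) * (q * q)); [rewrite r q2; lra|ring].
  have : 0 <= r3 * q by rewrite mulr_ge0 // ltW.
  nra.
have rq0 : 0 < r3 * q by rewrite mulr_gt0.
have A w : Vo w -> 0 < r3 * w.2 - w.1 + 2^-1 /\ 0 < r3 * w.2 + w.1 + 2^-1.
  move=> Vw.
  have B1 := @Vo_affine_lt 1 (- r3) (- 2^-1) w Vw; have B2 := @Vo_affine_lt (- 1) (- r3) (- 2^-1) w Vw.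
  have {}B1 : 1 * w.1 + - r3 * w.2 - 2^-1 < 0 by apply: B1; lra.
  have {}B2 : - 1 * w.1 + - r3 * w.2 - 2^-1 < 0 by apply: B2; lra.
  by split; lra.
move=> /A[_ a] /A[b _]; case: z a b => x y /=.
rewrite (_ : r3 * (- (r3 / 2) * x - 2^-1 * y - r3 / 4) = - (r3 * r3) / 2 * x - r3 * y / 2 - (r3 * r3) / 4); last by field.
by rewrite r; lra.
Qed.

Lemma Vo_side2 z : Vo z -> ~ Vo (side2 z).
Proof. by move=> Vz /Vo_side1; rewrite side21. Qed.

Local Notation ang w := (signed_angle (dsp w Pm) (dsp w Pp)).

Lemma turns_sim m t z u v th : turns (dsp z u) (dsp z v) th ->
  turns (dsp (sim m t z) (sim m t u)) (dsp (sim m t z) (sim m t v)) th.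
Proof.
move=> [k k0 e]; exists k => //.
have E u' : dsp (sim m t z) (sim m t u') = (m.1 * (dsp z u').1 - m.2 * (dsp z u').2,
    m.2 * (dsp z u').1 + m.1 * (dsp z u').2).
  by rewrite /sim /dsp /=; congr pair; ring.
by rewrite !E e /=; congr pair; ring.
Qed.

(** The open triangle: the point is below each of its three sides. *)
Definition in_triangle z := [/\ z.2 < 0, (side2 z).2 < 0 & (side1 z).2 < 0].

(** The sum of the three angles under which the sides are seen is a multiple of 2 pi, and
only within the triangle are all three negative.  A point is below at least one side,
as the sum of the three heights is negative, so the sum is less than 2 pi. *)
Lemma triangle_sum z : z.2 != 0 -> (side2 z).2 != 0 -> (side1 z).2 != 0 ->
  (in_triangle z /\ ang z + ang (side2 z) + ang (side1 z) = - (2 * pi)) \/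
  (~ in_triangle z /\ ang z + ang (side2 z) + ang (side1 z) = 0).
Proof.
move=> n0 n1 n2.
have [/andP[b0 b0'] t0 p0 m0] := base_angle n0; have [/andP[b1 b1'] t1 p1 m1] := base_angle n1.
have [/andP[b2 b2'] t2 p2 m2] := base_angle n2.
have {}t1 : turns (dsp z Pp) (dsp z Pb) (ang (side2 z)).
  have := turns_sim (- 2^-1, - (r3 / 2)) (4^-1, - (r3 / 4)) t1.
  by rewrite -side1_sim side21 side1_Pm side1_Pp.
have {}t2 : turns (dsp z Pb) (dsp z Pm) (ang (side1 z)).
  have := turns_sim (- 2^-1, r3 / 2) (- 4^-1, - (r3 / 4)) t2.
  by rewrite -side2_sim side12 side2_Pm side2_Pp.
have /(turns_refl_cos (Pm_neq n0)) c := turns_trans (turns_trans t0 t1) t2.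
have neg : z.2 + (side2 z).2 + (side1 z).2 < 0.
  by have := r3_gt0; case: z {n0 n1 n2 b0 b0' t0 p0 m0 b1 b1' t1 p1 m1 b2 b2' t2 p2 m2 c} => x y /= ?; lra.
move: b0 b0' p0 m0 b1 b1' p1 m1 b2 b2' p2 m2 c.
set g0 := ang z; set g1 := ang (side2 z); set g2 := ang (side1 z).
move=> b0 b0' p0 m0 b1 b1' p1 m1 b2 b2' p2 m2 c.
have zero : `|g0 + g1 + g2| < 2 * pi -> g0 + g1 + g2 = 0 by exact: cos1_small.
have pi0 := pi_gt0 R.
have [z0|z0] := ltP z.2 0; have [z1|z1] := ltP (side2 z).2 0; have [z2|z2] := ltP (side1 z).2 0.
- left; split=> //; have := m0 z0; have := m1 z1; have := m2 z2 => h2 h1 h0.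
  have : g0 + g1 + g2 + 2 * pi = 0; last by lra.
  apply: cos1_small; last by rewrite ltr_norml; apply/andP; split; lra.
  have -> : 2 * pi = pi *+ 2 :> R by rewrite mulr_natl.
  by rewrite cosD2pi.
all: right; split; [by move=> [h0 h1 h2]; lra|]; apply: zero; rewrite ltr_norml.
all: have P0 : 0 <= z.2 -> 0 < g0 by move=> h; apply: p0; rewrite lt_def n0.
all: have P1 : 0 <= (side2 z).2 -> 0 < g1 by move=> h; apply: p1; rewrite lt_def n1.
all: have P2 : 0 <= (side1 z).2 -> 0 < g2 by move=> h; apply: p2; rewrite lt_def n2.
all: try have := m0 z0; try have := P0 z0; try have := m1 z1; try have := P1 z1;
  try have := m2 z2; try have := P2 z2.
all: by move=> *; apply/andP; split; lra.
Qed.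

Definition core : set (R * R) :=
  [set z | [/\ in_triangle z, ~ V z, ~ V (side2 z) & ~ V (side1 z)]].

(** The candidate for the enclosed region. *)
Definition snow_interior s t r : set (R * R) :=
  core `|` (lower s `|` (@side2 R @^-1` lower t `|` @side1 R @^-1` lower r)).

(** Almost every point is generic for the three curves and on none of the three lines that
carry the sides of the triangle. *)
Definition generic3 s t r z := [/\ generic s z, generic t (side2 z) & generic r (side1 z)] /\
  [/\ z.2 != 0, (side2 z).2 != 0 & (side1 z).2 != 0].

Lemma core_rot z : core z -> core (side2 z).
Proof.
by move=> [[i0 i1 i2] v0 v1 v2]; rewrite /core /in_triangle /= side22 side21.
Qed.

Lemma interior_rot s t r z : snow_interior s t r z -> snow_interior t r s (side2 z).
Proof.
move=> [/core_rot|[h|[h|h]]]; first by left.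
- by right; right; right; rewrite /= side21.
- by right; left.
- by right; right; left; rewrite /= side22.
Qed.

(** The rotation of the triangle permutes the three curves cyclically; the proofs below
only treat the first curve. *)
Lemma interior_rotE s t r z : snow_interior t r s (side2 z) <-> snow_interior s t r z.
Proof.
split; last exact: interior_rot.
by move=> /interior_rot/interior_rot; rewrite side22 side21.
Qed.

Lemma turn_principal s w : w.2 != 0 -> ~ V w -> turn s w (ang w).
Proof.
move=> w0 nV; have [/andP[b1 b2] t _ _] := base_angle w0.
have [th /andP[th1 th2] h] := turn_out s nV; have pi0 := pi_gt0 R.
suff <- : th = ang w by [].
apply: (turns_uniq (Pm_neq w0) (turn_turns h) t).
by rewrite ltr_norml; apply/andP; split; lra.
Qed.

(** [clear_angle] determines the total angle from the angle of the diagonal, to which it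
is congruent modulo 2 pi. *)
Lemma turn_sided s w : generic s w -> clear s w -> V w ->
  exists2 th, turn s w th & (lower s w /\ (w.2 < 0 -> th = ang w) /\ (0 < w.2 -> th = ang w - 2 * pi)) \/
    (~ lower s w /\ (w.2 < 0 -> th = ang w + 2 * pi) /\ (0 < w.2 -> th = ang w)).
Proof.
move=> gen cl Vw; have [Vow w0] := generic_Vo gen Vw.
have [/andP[b1 b2] t tp tm] := base_angle w0; have pi0 := pi_gt0 R.
have [th h d] := clear_angle cl gen Vw; exists th => //.
have th_t := turn_turns h.
have U x y : turns (dsp w Pm) (dsp w Pp) x -> turns (dsp w Pm) (dsp w Pp) y ->
    `|x - y| < 2 * pi -> x = y by exact: turns_uniq (Pm_neq w0).
case: d => -[lw /andP[t1 t2]]; [left|right]; split=> //; split=> sg.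
- have := tm sg => g0.
  by apply: (U _ _ th_t t); rewrite ltr_norml; apply/andP; split; lra.
- have := tp sg => g0.
  suff : th + 2 * pi = ang w by lra.
  by apply: (U _ _ (turns_add2pi th_t) t); rewrite ltr_norml; apply/andP; split; lra.
- have := tm sg => g0.
  by apply: (U _ _ th_t (turns_add2pi t)); rewrite ltr_norml; apply/andP; split; lra.
- have := tp sg => g0.
  by apply: (U _ _ th_t t); rewrite ltr_norml; apply/andP; split; lra.
Qed.

(** The total angle along the three curves, traversed from P- to P+ each, which is the
opposite of the direction of the snowflake. *)
Definition winds s t r z := exists th0 th1 th2,
  [/\ turn s z th0, turn t (side2 z) th1, turn r (side1 z) th2 &
   (snow_interior s t r z /\ th0 + th1 + th2 = - (2 * pi)) \/
   (~ snow_interior s t r z /\ th0 + th1 + th2 = 0)].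

Lemma winds_rot s t r z : winds t r s (side2 z) -> winds s t r z.
Proof.
rewrite /winds side22 side21 => -[th1 [th2 [th0 [h1 h2 h0 d]]]]; exists th0, th1, th2; split=> //.
case: d => -[/interior_rotE i e]; [left|right]; split=> //; lra.
Qed.

(** At a point of the first rhombus the other two curves turn as their diagonals do, and
the point is below both of them; it is in the triangle exactly when it is below the
first diagonal.  The correction by 2 pi in [turn_sided] then replaces the side of the
diagonal by the side of the curve. *)
Lemma winds_in_V s t r z : generic3 s t r z -> clear s z -> V z -> winds s t r z.
Proof.
move=> [[g0 g1 g2] [n0 n1 n2]] c0 Vz; have [Voz _] := generic_Vo g0 Vz.
have nV1 : ~ V (side2 z) by move=> /(generic_Vo g1)[/(Vo_side2 Voz)].
have nV2 : ~ V (side1 z) by move=> /(generic_Vo g2)[/(Vo_side1 Voz)].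
have t1 := turn_principal t n1 nV1; have t2 := turn_principal r n2 nV2.
have [th0 t0 d] := turn_sided g0 c0 Vz.
exists th0, (ang (side2 z)), (ang (side1 z)); split=> //.
have iE : snow_interior s t r z <-> lower s z.
  split=> [[[]//|[//|[|]]]|h]; last by right; left.
    by move=> /lower_Vo/Vo_V.
  by move=> /lower_Vo/Vo_V.
have [s1 s2] := Vo_side_neg Voz; have ts := triangle_sum n0 n1 n2.
have [zn|zp|z0] := ltrgtP z.2 0; last by move: n0; rewrite z0 eqxx.
- have T : ang z + ang (side2 z) + ang (side1 z) = - (2 * pi).
    by case: ts => -[i //]; case: i.
  case: d => -[lw [e _]]; [left|right]; rewrite (e zn); split; rewrite ?iE //; lra.
- have T : ang z + ang (side2 z) + ang (side1 z) = 0.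
    by case: ts => -[i //]; case: i; lra.
  case: d => -[lw [_ e]]; [left|right]; rewrite (e zp); split; rewrite ?iE //; lra.
Qed.

Lemma generic3_rot s t r z : generic3 s t r z -> generic3 t r s (side2 z).
Proof. by move=> [[g0 g1 g2] [n0 n1 n2]]; split; split; rewrite ?side22 ?side21. Qed.

Lemma windsP s t r z : generic3 s t r z ->
  clear s z -> clear t (side2 z) -> clear r (side1 z) -> winds s t r z.
Proof.
move=> g c0 c1 c2.
have [V0|V0] := pselect (V z); first exact: winds_in_V g c0 V0.
have g' := generic3_rot g.
have [V1|V1] := pselect (V (side2 z)); first by apply: winds_rot; exact: winds_in_V g' c1 V1.
have [V2|V2] := pselect (V (side1 z)).
  apply: winds_rot; apply: winds_rot; rewrite side22.
  by apply: winds_in_V V2; rewrite // -side22; exact: generic3_rot g'.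
have [[g0 g1 g2] [n0 n1 n2]] := g.
exists (ang z), (ang (side2 z)), (ang (side1 z)).
split; [exact: turn_principal|exact: turn_principal|exact: turn_principal|].
have ic : snow_interior s t r z <-> in_triangle z.
  split=> [[[]//|[|[|]] /lower_Vo/Vo_V //]|i]; by left.
by case: (triangle_sum n0 n1 n2) => -[i e]; [left|right]; rewrite ?ic.
Qed.

Lemma interior_clear s t r z : generic3 s t r z -> snow_interior s t r z ->
  [/\ clear s z, clear t (side2 z) & clear r (side1 z)].
Proof.
have main s' t' r' z' : generic3 s' t' r' z' -> lower s' z' ->
    [/\ clear s' z', clear t' (side2 z') & clear r' (side1 z')].
  move=> [[g0 g1 g2] _] l; have Voz := lower_Vo l.
  split; first exact: lower_clear.
    by apply: clear_out => /(generic_Vo g1)[/(Vo_side2 Voz)].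
  by apply: clear_out => /(generic_Vo g2)[/(Vo_side1 Voz)].
move=> g; have g' := generic3_rot g; have g'' := generic3_rot g'.
move=> [[_ v0 v1 v2]|[h|[h|h]]].
- by split; apply: clear_out.
- exact: main h.
- by have [c1 c2 c0] := main _ _ _ _ g' h; rewrite side22 side21 in c2 c0.
- rewrite side22 in g''; have [c2 c0 c1] := main _ _ _ _ g'' h.
  by rewrite side12 in c0; rewrite side11 in c1.
Qed.

Definition nongeneric3 s t r : set (R * R) :=
  \bigcup_n seams n s `|` (@side2 R @^-1` (\bigcup_n seams n t) `|` @side1 R @^-1` (\bigcup_n seams n r))
  `|` ([set z | z.2 = 0] `|` (@side2 R @^-1` [set z | z.2 = 0] `|` @side1 R @^-1` [set z | z.2 = 0])).

Lemma generic3_ae s t r z : ~ nongeneric3 s t r z -> generic3 s t r z.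
Proof.
move=> nb; split; split.
- by apply: generic_ae => h; apply: nb; left; left.
- by apply: generic_ae => h; apply: nb; left; right; left.
- by apply: generic_ae => h; apply: nb; left; right; right.
- by apply/eqP => h; apply: nb; right; left.
- by apply/eqP => h; apply: nb; right; right; left.
- by apply/eqP => h; apply: nb; right; right; right.
Qed.

Lemma measurable_side1 (A : set (R * R)) : meas A -> meas (@side1 R @^-1` A).
Proof. by rewrite side1_sim; exact: measurable_sim. Qed.
Lemma measurable_side2 (A : set (R * R)) : meas A -> meas (@side2 R @^-1` A).
Proof. by rewrite side2_sim; exact: measurable_sim. Qed.

Lemma mu_side1 (A : set (R * R)) : meas A -> mu (@side1 R @^-1` A) = mu A.
Proof.
move=> mA; have c0 : ((- 2^-1, - (r3 / 2)) : R * R).1 != 0 by rewrite /= oppr_eq0 invr_eq0 pnatr_eq0.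
rewrite side1_sim (lambda2_sim _ c0 mA) /= (_ : _ + _ = 1) ?invr1 ?mul1e //.
by transitivity ((1 + r3 * r3) / 4); [field|rewrite r3_sqr; field].
Qed.

Lemma mu_side2 (A : set (R * R)) : meas A -> mu (@side2 R @^-1` A) = mu A.
Proof.
move=> mA; have c0 : ((- 2^-1, r3 / 2) : R * R).1 != 0 by rewrite /= oppr_eq0 invr_eq0 pnatr_eq0.
rewrite side2_sim (lambda2_sim _ c0 mA) /= (_ : _ + _ = 1) ?invr1 ?mul1e //.
by transitivity ((1 + r3 * r3) / 4); [field|rewrite r3_sqr; field].
Qed.

Lemma negligible_side1 (N : set (R * R)) : mu.-negligible N -> mu.-negligible (@side1 R @^-1` N).
Proof.
move=> [A [mA A0 NA]]; exists (@side1 R @^-1` A); split; first exact: measurable_side1.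
  by rewrite mu_side1.
by move=> z; exact: NA.
Qed.

Lemma negligible_side2 (N : set (R * R)) : mu.-negligible N -> mu.-negligible (@side2 R @^-1` N).
Proof.
move=> [A [mA A0 NA]]; exists (@side2 R @^-1` A); split; first exact: measurable_side2.
  by rewrite mu_side2.
by move=> z; exact: NA.
Qed.

Lemma negligible_nongeneric3 s t r : mu.-negligible (nongeneric3 s t r).
Proof.
have n0 := negligible_axis; have n s' := negligible_seams s'.
apply: negligibleU; apply: negligibleU => //; apply: negligibleU;
  by [apply: negligible_side1|apply: negligible_side2].
Qed.

Lemma measurable_core : meas core.
Proof.
have mN := measurable_neg; have mV := measurable_V.
have -> : core = (([set z | z.2 < 0] `&` (@side2 R @^-1` [set z | z.2 < 0] `&` @side1 R @^-1` [set z | z.2 < 0]))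
   `\` (V `|` (@side2 R @^-1` V `|` @side1 R @^-1` V))).
  apply/seteqP; split=> [z [[i0 i1 i2] v0 v1 v2]|z [[i0 [i1 i2]] v]].
    by split=> // -[|[|]].
  by split=> // h; apply: v; [left|right; left|right; right].
apply: measurableD.
  apply: measurableI => //; apply: measurableI; [exact: measurable_side2|exact: measurable_side1].
apply: measurableU => //; apply: measurableU; [exact: measurable_side2|exact: measurable_side1].
Qed.

Lemma measurable_interior s t r : meas (snow_interior s t r).
Proof.
have mL := measurable_lower.
apply: measurableU; first exact: measurable_core.
apply: measurableU => //; apply: measurableU; [exact: measurable_side2|exact: measurable_side1].
Qed.

(** The four pieces are disjoint and rotations preserve the measure. *)
Lemma mu_interior s t r : mu (snow_interior s t r) =
  (mu core + (area (lower s) + area (lower t) + area (lower r))%:E)%E.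
Proof.
have mL := measurable_lower; have m1 A := @measurable_side1 A; have m2 A := @measurable_side2 A.
have mU1 : meas (@side2 R @^-1` lower t `|` @side1 R @^-1` lower r).
  by apply: measurableU; [exact: m2|exact: m1].
rewrite /snow_interior muU; [|exact: measurable_core|exact: measurableU|]; last first.
  by apply/seteqP; split=> // z [[_ v0 v1 v2] [|[|]] /lower_Vo/Vo_V].
rewrite muU //; last first.
  apply/seteqP; split=> // z [/lower_Vo V0 [/lower_Vo V1|/lower_Vo V1]].
    exact: Vo_side2 V0 V1.
  exact: Vo_side1 V0 V1.
rewrite muU; [|exact: m2|exact: m1|]; last first.
  apply/seteqP; split=> // z [/lower_Vo V1 /lower_Vo V2].
  by apply: (Vo_side2 V1); rewrite side22.
rewrite mu_side1 // mu_side2 // !(areaE (mL _) (@lower_Vo _)).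
by rewrite -!EFinD addrA.
Qed.

End Snowflake.

(** * The region enclosed by a snowflake *)

Section Region.
Implicit Types (z : R * R) (s : signs) (e : bool).

Lemma snowflakeP s t r z : ~ snowflake p s t r z <->
  [/\ clear s z, clear t (side2 z) & clear r (side1 z)].
Proof.
split=> [nF|[/clearP n0 /clearP n1 /clearP n2] [[//|[w Fw e]]|[w Fw e]]].
- split; apply/clearP => F; apply: nF; first by left; left.
    by left; right; exists (side2 z) => //; rewrite side21.
  by right; exists (side1 z) => //; rewrite side12.
- by apply: n1; rewrite -e side12.
- by apply: n2; rewrite -e side21.
Qed.

(** On its closed third the path is given by one formula, because the three curves match
at the vertices of the triangle. *)
Lemma snowflake_path1 s t r (x : R) : 0 <= x <= 3^-1 ->
  snowflake_path p s t r x = koch_path p s (- 3 * x + 1).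
Proof.
move=> /andP[x0 x1]; rewrite /snowflake_path; case: ltP => h; first by congr koch_path; ring.
have -> : x = 3^-1 by lra.
rewrite ifT; last by lra.
have -> : 2 - 3 * 3^-1 = 1 :> R by field.
have -> : - 3 * 3^-1 + 1 = 0 :> R by field.
by rewrite koch_path1 koch_path0 side2_Pp.
Qed.

Lemma snowflake_path2 s t r (x : R) : 3^-1 <= x <= 2 / 3 ->
  snowflake_path p s t r x = side2 (koch_path p r (- 3 * x + 2)).
Proof.
move=> /andP[x0 x1]; rewrite /snowflake_path ifF; last by apply/negbTE; rewrite -leNgt.
case: ltP => h; first by congr (side2 (koch_path _ _ _)); ring.
have -> : x = 2 / 3 by lra.
have -> : 3 - 3 * (2 / 3) = 1 :> R by field.
have -> : - 3 * (2 / 3) + 2 = 0 :> R by field.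
by rewrite koch_path1 koch_path0 side2_Pm side1_Pp.
Qed.

Lemma snowflake_path3 s t r (x : R) : 2 / 3 <= x <= 1 ->
  snowflake_path p s t r x = side1 (koch_path p t (- 3 * x + 3)).
Proof.
move=> /andP[x0 x1]; rewrite /snowflake_path !ifF; try by apply/negbTE; rewrite -leNgt; lra.
by congr (side1 (koch_path _ _ _)); ring.
Qed.

Lemma snowflake_path_pcont s t r : pcont (snowflake_path p s t r \o clamp 0 1).
Proof.
apply: (@pcont_cat _ _ 0 (2 / 3) 1); [lra|lra| |].
  apply: (@pcont_cat _ _ 0 (3^-1) (2 / 3)); [lra|lra| |].
    apply: (@pcont_affine _ (koch_path p s) _ 0 3^-1 (- 3) 1); [lra|exact: koch_path_continuous|].
    move=> x x01; rewrite snowflake_path1 //; split=> //.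
    by move: x01 => /andP[x0 x1]; apply/andP; split; lra.
  apply: (@pcont_affine _ (@side2 R \o koch_path p r) _ (3^-1) (2 / 3) (- 3) 2); [lra| |].
    by rewrite side2_sim; exact: (pcont_sim _ _ (koch_path_continuous r)).
  move=> x x01; rewrite snowflake_path2 //; split=> //.
  by move: x01 => /andP[x0 x1]; apply/andP; split; lra.
apply: (@pcont_affine _ (@side1 R \o koch_path p t) _ (2 / 3) 1 (- 3) 3); [lra| |].
  by rewrite side1_sim; exact: (pcont_sim _ _ (koch_path_continuous t)).
move=> x x01; rewrite snowflake_path3 //; split=> //.
by move: x01 => /andP[x0 x1]; apply/andP; split; lra.
Qed.

(** The snowflake is traversed through the first, third and second curve, each backwards. *)
Lemma snowflake_lift s t r z th0 th1 th2 :
  turn s z th0 -> turn t (side2 z) th1 -> turn r (side1 z) th2 ->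
  lift_on (snowflake_path p s t r) 0 1 z (- (th0 + th1 + th2)).
Proof.
move=> h0 h1 h2.
have m1 : ((- 2^-1, - (Num.sqrt 3 / 2)) : R * R) != (0, 0).
  by apply/eqP => -[/eqP]; rewrite oppr_eq0 invr_eq0 pnatr_eq0.
have m2 : ((- 2^-1, Num.sqrt 3 / 2) : R * R) != (0, 0).
  by apply/eqP => -[/eqP]; rewrite oppr_eq0 invr_eq0 pnatr_eq0.
have n3 : - 3 < 0 :> R by lra.
have {}h0 : lift_on (snowflake_path p s t r) 0 3^-1 z (- th0).
  have := @lift_on_reverse _ (koch_path p s) 0 3^-1 (- 3) 1 z th0 n3.
  have -> : - 3 * 3^-1 + 1 = 0 :> R by field.
  have -> : - 3 * 0 + 1 = 1 :> R by ring.
  by move=> /(_ h0); apply: lift_on_eq => x x01; rewrite snowflake_path1.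
have {}h2 : lift_on (snowflake_path p s t r) 3^-1 (2 / 3) z (- th2).
  have := lift_on_sim (- 4^-1, - (Num.sqrt 3 / 4)) m2 h2.
  rewrite -side2_sim side12 => {}h2.
  have := @lift_on_reverse _ (@side2 R \o koch_path p r) 3^-1 (2 / 3) (- 3) 2 z th2 n3.
  have -> : - 3 * (2 / 3) + 2 = 0 :> R by field.
  have -> : - 3 * 3^-1 + 2 = 1 :> R by field.
  by move=> /(_ h2); apply: lift_on_eq => x x01; rewrite snowflake_path2.
have {}h1 : lift_on (snowflake_path p s t r) (2 / 3) 1 z (- th1).
  have := lift_on_sim (4^-1, - (Num.sqrt 3 / 4)) m1 h1.
  rewrite -side1_sim side21 => {}h1.
  have := @lift_on_reverse _ (@side1 R \o koch_path p t) (2 / 3) 1 (- 3) 3 z th1 n3.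
  have -> : - 3 * (2 / 3) + 3 = 1 :> R by field.
  have -> : - 3 * 1 + 3 = 0 :> R by ring.
  by move=> /(_ h1); apply: lift_on_eq => x x01; rewrite snowflake_path3.
have l1 : lift_on (snowflake_path p s t r) 0 (2 / 3) z (- th0 + - th2).
  by apply: lift_on_cat h0 h2; lra.
have -> : - (th0 + th1 + th2) = (- th0 + - th2) + - th1 by ring.
by apply: lift_on_cat l1 h1; lra.
Qed.

Lemma snowflake_path_in s t r (x : R) : 0 <= x <= 1 -> snowflake p s t r (snowflake_path p s t r x).
Proof.
move=> /andP[x0 x1].
have K s' (y : R) : 0 <= y <= 1 -> koch_curve p s' (koch_path p s' y).
  by move=> y01; rewrite koch_curve_path; exists y => //=; rewrite in_itv.
have [h1|h1] := leP x 3^-1.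
  rewrite snowflake_path1 ?x0 //; left; left; apply: K; apply/andP; split; lra.
have [h2|h2] := leP x (2 / 3).
  rewrite snowflake_path2 ?(ltW h1) //; right.
  exists (koch_path p r (- 3 * x + 2)) => //; apply: K; apply/andP; split; lra.
rewrite snowflake_path3 ?(ltW h2) //; left; right.
exists (koch_path p t (- 3 * x + 3)) => //; apply: K; apply/andP; split; lra.
Qed.

Lemma snowflake_path01 s t r : snowflake_path p s t r 0 = snowflake_path p s t r 1.
Proof.
rewrite snowflake_path1 ?snowflake_path3; [|by apply/andP; split; lra|by apply/andP; split; lra].
have -> : - 3 * 0 + 1 = 1 :> R by ring.
have -> : - 3 * 1 + 3 = 0 :> R by ring.
by rewrite koch_path1 koch_path0 side1_Pm.
Qed.

Lemma snowflake_closed s t r : closed (snowflake p s t r).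
Proof.
have K s' : compact (koch_curve p s').
  by rewrite koch_curve_path; apply: path_compact; exact: koch_path_continuous.
apply: compact_closed; first exact: norm_hausdorff.
apply: compactU; first apply: compactU => //.
  rewrite side1_sim; apply: continuous_compact (K t).
  by apply: continuous_subspaceT; exact: sim_continuous.
rewrite side2_sim; apply: continuous_compact (K r).
by apply: continuous_subspaceT; exact: sim_continuous.
Qed.

Lemma snowflake_lifts s t r z : ~ snowflake p s t r z ->
  exists th, lift_on (snowflake_path p s t r) 0 1 z th.
Proof.
move=> /snowflakeP[/(clear_turn)[th0 h0] /(clear_turn)[th1 h1] /(clear_turn)[th2 h2]].
by exists (- (th0 + th1 + th2)); exact: snowflake_lift.
Qed.

Definition box : set (R * R) := [set z | - 2 <= z.1 <= 2 /\ - 2 <= z.2 <= 2].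

Lemma cvx_box : cvx box.
Proof.
move=> l u v /andP[l0 l1] [/andP[u1 u2] /andP[u3 u4]] [/andP[v1 v2] /andP[v3 v4]].
by split; apply/andP; split => /=; nra.
Qed.

Lemma snowflake_box s t r (x : R) : 0 <= x <= 1 -> box (snowflake_path p s t r x).
Proof.
move=> /andP[x0 x1]; have [q0 qp1 qp2 q2 q3] := pq_facts; have [p1 p2] := p_bounds.
have q1 : q <= 1 by nra.
have w := r3_sqr; have w0 := r3_gt0.
have sq2 : Num.sqrt 3 <= 2 :> R by nra.
have wB (X : R) : - 2^-1 <= X -> X <= 2^-1 -> - 1 <= Num.sqrt 3 * X <= 1.
  by move=> X1 X2; apply/andP; split; nra.
have K s' (y : R) : 0 <= y <= 1 -> [/\ - 2^-1 <= (koch_path p s' y).1, (koch_path p s' y).1 <= 2^-1,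
    - 2^-1 <= (koch_path p s' y).2 & (koch_path p s' y).2 <= 2^-1].
  by move=> /(koch_path_V s')/VP[a1 a2 a3 a4]; split; nra.
have [h1|h1] := leP x 3^-1.
  rewrite snowflake_path1 ?x0 //; have [|a1 a2 a3 a4] := K s (- 3 * x + 1); first by apply/andP; split; lra.
  by split; apply/andP; split => /=; lra.
have [h2|h2] := leP x (2 / 3).
  rewrite snowflake_path2 ?(ltW h1) //.
  have [|a1 a2 a3 a4] := K r (- 3 * x + 2); first by apply/andP; split; lra.
  have /andP[b1 b2] := wB _ a1 a2; have /andP[b3 b4] := wB _ a3 a4.
  move: a1 a2 a3 a4 b1 b2 b3 b4; rewrite /side2; case: koch_path => X Y /= *.
  by split; apply/andP; split => /=; lra.
rewrite snowflake_path3 ?(ltW h2) //.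
have [|a1 a2 a3 a4] := K t (- 3 * x + 3); first by apply/andP; split; lra.
have /andP[b1 b2] := wB _ a1 a2; have /andP[b3 b4] := wB _ a3 a4.
move: a1 a2 a3 a4 b1 b2 b3 b4; rewrite /side1; case: koch_path => X Y /= *.
by split; apply/andP; split => /=; lra.
Qed.

(** Outside a convex set that contains the path, the total angle is in (-pi, pi), and as
the path is closed it is a multiple of 2 pi. *)
Lemma lift_out_box s t r z th : ~ box z -> lift_on (snowflake_path p s t r) 0 1 z th -> th = 0.
Proof.
move=> nB l; have pi0 := pi_gt0 R.
have [th' /andP[b1 b2] l'] := lift_on_convex cvx_box nB ler01 (snowflake_path_pcont s t r) (@snowflake_box s t r).
rewrite (lift_on_uniq ler01 l l').
have := lift_on_turns ler01 l'; rewrite -snowflake_path01.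
have n0 : dsp z (snowflake_path p s t r 0) != (0, 0) by apply: (lift_on_neq l'); rewrite lexx ler01.
by move=> /(turns_refl_cos n0) c; apply: cos1_small => //; rewrite ltr_norml; apply/andP; split; lra.
Qed.

Definition winding1 s t r : set (R * R) :=
  [set z | ~ snowflake p s t r z /\ lift_on (snowflake_path p s t r) 0 1 z (2 * pi)].

Lemma winding1_box s t r : winding1 s t r `<=` box.
Proof.
move=> z [_ l]; apply: contrapT => /lift_out_box/(_ l); have := pi_gt0 R; lra.
Qed.

Lemma winding1P s t r z : ~ snowflake p s t r z ->
  has_winding_number (snowflake_path p s t r) z 1 <-> lift_on (snowflake_path p s t r) 0 1 z (2 * pi).
Proof.
move=> nF; have := @has_windingP _ _ _ (@snowflake_lifts s t r) z 1 nF.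
by rewrite mulr1.
Qed.

(** The total angle is constant on components by [component_lift]; a component with winding
number 1 is bounded because far away the total angle is 0. *)
Lemma enclosed_regionE s t r : enclosed_region p s t r = winding1 s t r.
Proof.
apply/seteqP; split=> [z [C [[w nFw ->] _ W] Cz]|z [nF l]].
  have nFz : ~ snowflake p s t r z by exact: (connected_component_sub Cz).
  by split=> //; apply/(winding1P nFz); exact: W.
have comp := component_lift (snowflake_path_pcont s t r) (snowflake_path01 s t r)
  (@snowflake_closed s t r) (@snowflake_path_in s t r) (@snowflake_lifts s t r) nF l.
exists (connected_component (~` snowflake p s t r) z); last exact: connected_component_refl.
split; first by exists z.
- exists 2; split; first by rewrite num_real.
  move=> M M2 w /comp/winding1_box[/andP[a1 a2] /andP[a3 a4]] /=.
  by rewrite prod_normE ge_max !ler_norml; apply/andP; split; apply/andP; split; lra.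
- by move=> w /comp[nFw lw]; apply/(winding1P nFw).
Qed.

Lemma open_winding1 s t r : open (winding1 s t r).
Proof.
have := open_lift (snowflake_path_pcont s t r) (snowflake_path01 s t r)
  (@snowflake_closed s t r) (@snowflake_path_in s t r) (P := eq^~ (2 * pi)).
congr open; apply/seteqP; split=> z [nF].
  by move=> [x -> l].
by move=> l; split=> //; exists (2 * pi).
Qed.

(** [windsP] read with the reversed orientation. *)
Lemma winding1_interior s t r z : generic3 s t r z -> winding1 s t r z <-> snow_interior s t r z.
Proof.
move=> g; have pi0 := pi_gt0 R; split=> [[nF l]|i].
  have /snowflakeP[c0 c1 c2] := nF.
  have [th0 [th1 [th2 [h0 h1 h2 d]]]] := windsP g c0 c1 c2.
  have e := lift_on_uniq ler01 l (snowflake_lift h0 h1 h2).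
  by case: d => -[// _ e2]; move: e; rewrite e2; lra.
have [c0 c1 c2] := interior_clear g i.
split; first exact/snowflakeP.
have [th0 [th1 [th2 [h0 h1 h2 d]]]] := windsP g c0 c1 c2.
have := snowflake_lift h0 h1 h2.
by case: d => -[// _ ->]; rewrite opprK.
Qed.

Lemma enclosed_areaE s t r : enclosed_area p s t r =
  (mu core + (area (lower s) + area (lower t) + area (lower r))%:E)%E.
Proof.
rewrite /enclosed_area enclosed_regionE -mu_interior.
apply: mu_eq_ae (measurable_interior s t r) (negligible_nongeneric3 s t r) _.
  by apply: open_plane_measurable; exact: open_winding1.
by move=> z /generic3_ae; exact: winding1_interior.
Qed.

End Region.

(** * All intermediate areas *)

(** With indices that are plain numbers the signs of a level can be counted across the three
curves of a snowflake. *)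
Definition signs_of (P : nat -> nat -> bool) : signs := fun k i => P k i.

Lemma sign_sum_of k P : sign_sum k (signs_of P) = \sum_(0 <= i < 4 ^ k) sgn (P k i) :> R.
Proof.
elim: k P => [|k IH] P; first by rewrite expn0 big_nat1.
rewrite expnS -sum_blocks; apply: eq_bigr => a _.
by rewrite -(IH (fun j i => P j.+1 (a * 4 ^ j + i)%N)).
Qed.

Lemma area_lower_const e :
  area (lower (signs_of (fun _ _ => e))) = half_area + sgn e * (bump / (1 - 4 * p ^+ 2)).
Proof.
have [p1 p2] := p_bounds.
have rho1 : 1 - 4 * p ^+ 2 != 0 by apply/eqP; nra.
set H := bump / _; have HB : bump = H * (1 - 4 * p ^+ 2) by rewrite divfK.
apply/eqP; rewrite -subr_eq0 -normr_eq0; apply/eqP.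
apply: (@geometric_eq0 _ (half_area + `|H|) (4 * p ^+ 2)); first by apply/andP; split; nra.
  exact: normr_ge0.
move=> n; have := area_lower_approx n (signs_of (fun _ _ => e)).
have -> : bump * \sum_(k < n) (p ^+ 2) ^+ k * sign_sum k (signs_of (fun _ _ => e)) =
    sgn e * H - sgn e * H * (4 * p ^+ 2) ^+ n.
  rewrite HB; elim: n => [|n IH]; first by rewrite big_ord0; ring.
  rewrite big_ord_recr /= mulrDr IH sign_sum_of sumr_const_nat subn0 -[sgn e *+ _]mulr_natr natrX.
  rewrite [(4 * p ^+ 2) ^+ n.+1]exprS [(4 * p ^+ 2) ^+ n]exprMn; ring.
move=> b; rewrite mulrDl; set E := (4 * p ^+ 2) ^+ n in b *.
have E0 : 0 <= E by apply: exprn_ge0; nra.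
have -> : area (lower (signs_of (fun _ _ => e))) - (half_area + sgn e * H) =
  (area (lower (signs_of (fun _ _ => e))) - half_area - (sgn e * H - sgn e * H * E)) - sgn e * H * E by ring.
apply: le_trans (ler_normB _ _) _; apply: lerD => //.
rewrite !normrM (ger0_norm E0) ler_wpM2r // ler_piMl //.
by rewrite /sgn; case: e {b}; rewrite ?normrN normr1.
Qed.

(** The three curves share the c_k positive signs of level k, numbering the signs of the
first, second and third curve consecutively. *)
Lemma area_lower_surj (v : R) : 
  3 * (half_area - bump / (1 - 4 * p ^+ 2)) <= v <= 3 * (half_area + bump / (1 - 4 * p ^+ 2)) ->
  exists s t r, area (lower s) + area (lower t) + area (lower r) = v.
Proof.
have [p1 p2] := p_bounds.
have rho1 : 1 - 4 * p ^+ 2 != 0 by apply/eqP; nra.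
set H := bump / _; have HB : bump = H * (1 - 4 * p ^+ 2) by rewrite divfK.
move=> /andP[v1 v2].
have H0 : 0 <= H by lra.
have vH : `|v - 3 * half_area| <= 3 * H by rewrite ler_norml; apply/andP; split; lra.
have r16 : 16^-1 <= p ^+ 2 by nra.
have [c cN hc] := greedy_expansion H0 r16 vH.
pose s (j : nat) := signs_of (fun k i => ~~ (j * 4 ^ k + i < c k)%N).
have S k : \sum_(j < 3) sign_sum k (s j) = 2 * (c k)%:R - (3 * 4 ^ k)%:R :> R.
  rewrite -sum_threshold // -sum_blocks; apply: eq_bigr => j _; exact: sign_sum_of.
exists (s 0%N), (s 1%N), (s 2%N).
apply/eqP; rewrite -subr_eq0 -normr_eq0; apply/eqP.
apply: (@geometric_eq0 _ (3 * half_area + 3 * H) (4 * p ^+ 2)); first by apply/andP; split; nra.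
  exact: normr_ge0.
move=> n; have {hc} := hc n; rewrite -HB.
have -> : \sum_(k < n) (p ^+ 2) ^+ k * (2 * (c k)%:R - (3 * 4 ^ k)%:R) =
   \sum_(k < n) (p ^+ 2) ^+ k * sign_sum k (s 0%N) + \sum_(k < n) (p ^+ 2) ^+ k * sign_sum k (s 1%N)
   + \sum_(k < n) (p ^+ 2) ^+ k * sign_sum k (s 2%N).
  rewrite -!big_split; apply: eq_bigr => k _ /=.
  by rewrite -S !big_ord_recr big_ord0 /= add0r !mulrDr.
have := area_lower_approx n (s 0%N); have := area_lower_approx n (s 1%N).
have := area_lower_approx n (s 2%N).
move: (\sum_(k < n) _ * sign_sum k (s 0%N)) (\sum_(k < n) _ * sign_sum k (s 1%N))
  (\sum_(k < n) _ * sign_sum k (s 2%N)) ((4 * p ^+ 2) ^+ n) => S0 S1 S2 E.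
move: (area _) (area _) (area _) => A0 A1 A2.
clearbody H; rewrite !ler_norml => /andP[? ?] /andP[? ?] /andP[? ?] /andP[? ?].
by apply/andP; split; lra.
Qed.

Lemma area_signs1 : area (lower signs1) = half_area - bump / (1 - 4 * p ^+ 2).
Proof. by have := area_lower_const true; rewrite /sgn mulN1r. Qed.

Lemma area_signs0 : area (lower signs0) = half_area + bump / (1 - 4 * p ^+ 2).
Proof. by have := area_lower_const false; rewrite /sgn mul1r. Qed.

End KochGeometry.

Theorem theorem4p1 (R : realType) (p : R) (hp : 4^-1 < p <= 3^-1) (y : R)
  (hy : (enclosed_area p signs1 signs1 signs1 <= y%:E
           <= enclosed_area p signs0 signs0 signs0)%E) :
  exists s t r : signs, enclosed_area p s t r = y%:E.
Proof.
move: hy; rewrite !(enclosed_areaE hp) (area_signs1 hp) (area_signs0 hp).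
have : (0 <= (lebesgue_measure \x lebesgue_measure) (core p))%E by exact: measure_ge0.
case Ec: ((lebesgue_measure \x lebesgue_measure)%E (core p)) => [c| |] // _ /andP[//].
rewrite !lee_fin => y1 y2.
have [|s [t [r e]]] := @area_lower_surj R p hp (y - c).
  by apply/andP; split; lra.
by exists s, t, r; rewrite enclosed_areaE // Ec e -EFinD; congr EFin; lra.
Qed.
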